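(* Let $Y=(Y^1,Y^2)$ be the bivariate fractional Ornstein--Uhlenbeck process with parameters $\alpha_1,\alpha_2,\nu_1,\nu_2>0$, $H_1,H_2\in(0,1)\setminus\{1/2\}$, $H=H_1+H_2$, and correlation parameters $\rho,\eta_{12}$. Let $T_n>0$, $\Delta_n=T_n/n$, and let $$\tilde\rho_n=\frac1{\nu_1\nu_2n\Delta_n^H}\sum_{k=0}^{n-1}\big(Y^1_{(k+1)\Delta_n}-Y^1_{k\Delta_n}\big)\big(Y^2_{(k+1)\Delta_n}-Y^2_{k\Delta_n}\big),$$ $$\tilde\eta_{12,n}=\frac1{\nu_1\nu_2n\Delta_n^H}\sum_{k=0}^{n-1}\big(Y^1_{k\Delta_n}Y^2_{(k+1)\Delta_n}-Y^1_{(k+1)\Delta_n}Y^2_{k\Delta_n}\big).$$ Suppose that $\Delta_n\to0$ and $n\Delta_n\to+\infty$ as $n\to+\infty$. Then, as $n\to\infty$, the following convergences hold in $L^2(\mathbb{P})$, and so in probability: $\tilde\rho_n\to\rho$ if $H\in(0,2)\setminus\{1\}$, and $\tilde\eta_{12,n}\to\eta_{12}$ if $H\in(0,1)$.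
   Context: Let $H_1,H_2\in(0,1)\setminus\{1/2\}$, $H=H_1+H_2$. A bivariate fractional Brownian motion is a centered Gaussian process $(B^{H_1}_t,B^{H_2}_t)_{t\in\mathbb{R}}$ (with continuous paths) whose components are fractional Brownian motions with Hurst indices $H_1,H_2$, with $(B^{H_1}_{\lambda t},B^{H_2}_{\lambda t})_t\overset{d}{=}(\lambda^{H_1}B^{H_1}_t,\lambda^{H_2}B^{H_2}_t)_t$ for all $\lambda>0$ and with stationary increments, normalized by $\mathrm{Var}(B^{H_i}_1)=1$. There are then (known fact) $\rho=\rho_{12}=\rho_{21}\in[-1,1]$ and $\eta_{12}=-\eta_{21}\in\mathbb{R}$ with, if $H\ne1$, $$\mathrm{Cov}(B^{H_1}_t,B^{H_2}_u)=\tfrac12\big((\rho+\mathrm{sign}(t)\eta_{12})|t|^{H}+(\rho-\mathrm{sign}(u)\eta_{12})|u|^{H}-(\rho-\mathrm{sign}(u-t)\eta_{12})|u-t|^{H}\big),$$ where $\mathrm{sign}(x)=1$ for $x\ge0$, $-1$ for $x<0$. The bivariate fractional Ornstein--Uhlenbeck process is $Y^i_t=\nu_i\int_{-\infty}^te^{-\alpha_i(t-u)}dB^{H_i}_u$, $i=1,2$, $t\in\mathbb{R}$, with $\alpha_i,\nu_i>0$ and pathwise Riemann--Stieltjes integrals, i.e. $Y^i_t=\nu_i(B^{H_i}_t-\alpha_i\int_{-\infty}^tB^{H_i}_ue^{-\alpha_i(t-u)}du)$. *)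

(* Defs.v *)
From HB Require Import structures.
From mathcomp Require Import all_boot all_order all_algebra.
From mathcomp Require Import all_classical all_reals all_analysis.

Set Implicit Arguments.
Unset Strict Implicit.
Unset Printing Implicit Defensive.

Import Order.TTheory GRing.Theory Num.Theory.
Import numFieldNormedType.Exports.

Local Open Scope classical_set_scope.
Local Open Scope ring_scope.

Section Gaussian.
Context {d : measure_display} {Omega : measurableType d} {R : realType}.
Variable P : probability Omega R.

(* [normal_prob m 0] is not the Dirac mass at [m] (at s = 0 the library's
   density is that of the uniform law on [0, 1]), so degenerate Gaussian laws
   have to be added by hand. *)
Definition gaussian_law (m s : R) (A : set R) : \bar R :=
  if s == 0 then \d_m A else normal_prob m s A.

Definition gaussian_rv (X : Omega -> R) : Prop :=
  exists m s : R, 0 <= s /\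
    forall A : set R, measurable A -> P (X @^-1` A) = gaussian_law m s A.

Definition gaussian_process (I : Type) (X : I -> Omega -> R) : Prop :=
  forall (n : nat) (a : 'I_n -> R) (t : 'I_n -> I),
    gaussian_rv (fun w => \sum_(i < n) a i * X (t i) w).

Definition centered_process (I : Type) (X : I -> Omega -> R) : Prop :=
  forall i : I, ('E_P[X i] = 0)%E.

End Gaussian.

Section LawOfProcess.
Context {d : measure_display} {Omega : measurableType d} {R : realType}.
Variable P : probability Omega R.

Definition cylinders : set (set (R -> R * R)) :=
  [set E | exists (t : R) (A : set (R * R)),
     measurable A /\ E = [set x | A (x t)]].

(* Equality of the laws of two R^2-valued processes indexed by the real line,
   as probabilities on the product sigma-algebra of (R^2)^R. *)
Definition eq_law (X X' : R -> Omega -> R * R) : Prop :=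
  forall E : set (R -> R * R), <<s cylinders >> E ->
    P [set w | E (fun t => X t w)] = P [set w | E (fun t => X' t w)].

End LawOfProcess.

Section FractionalBrownianMotion.
Context {d : measure_display} {Omega : measurableType d} {R : realType}.
Variable P : probability Omega R.

Definition continuous_paths (B : R -> Omega -> R) : Prop :=
  forall w : Omega, continuous (fun t => B t w).

Record is_fBm (H : R) (B : R -> {RV P >-> R}) : Prop := IsFBm {
  fBm_gaussian : gaussian_process P (fun t => B t : Omega -> R) ;
  fBm_centered : centered_process P (fun t => B t : Omega -> R) ;
  fBm_continuous : continuous_paths (fun t => B t : Omega -> R) ;
  fBm_covariance : forall t u : R,
    covariance P (B t) (B u) =
      ('V_P[B 1%R] *
       (2^-1 * (`|t| `^ (2 * H) + `|u| `^ (2 * H)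
                - `|u - t| `^ (2 * H)))%:E)%E }.

Definition both (B1 B2 : R -> {RV P >-> R}) (i : R + R) : Omega -> R :=
  match i with inl t => B1 t | inr t => B2 t end.

Record is_bfBm (H1 H2 : R) (B1 B2 : R -> {RV P >-> R}) : Prop := IsBfBm {
  bfBm_gaussian : gaussian_process P (both B1 B2) ;
  bfBm_centered : centered_process P (both B1 B2) ;
  bfBm_fBm1 : is_fBm H1 B1 ;
  bfBm_fBm2 : is_fBm H2 B2 ;
  bfBm_selfsimilar : forall l : R, 0 < l ->
    eq_law P (fun t w => (B1 (l * t) w, B2 (l * t) w))
             (fun t w => (l `^ H1 * B1 t w, l `^ H2 * B2 t w)) ;
  bfBm_stationary_increments : forall h : R,
    eq_law P (fun t w => (B1 (t + h) w - B1 h w, B2 (t + h) w - B2 h w))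
             (fun t w => (B1 t w - B1 0 w, B2 t w - B2 0 w)) ;
  bfBm_var1 : ('V_P[B1 1%R] = 1)%E ;
  bfBm_var2 : ('V_P[B2 1%R] = 1)%E }.

(* Unlike [Num.sg], this sign function takes the value 1 at 0. *)
Definition sign (x : R) : R := if x < 0 then -1 else 1.

Record bfBm_correlations (H1 H2 rho eta12 : R)
    (B1 B2 : R -> {RV P >-> R}) : Prop := BfBmCorrelations {
  bfBm_rho : -1 <= rho <= 1 ;
  bfBm_cross_covariance : let H := H1 + H2 in H != 1 -> forall t u : R,
    covariance P (B1 t) (B2 u) =
      (2^-1 * ((rho + sign t * eta12) * `|t| `^ H
               + (rho - sign u * eta12) * `|u| `^ H
               - (rho - sign (u - t) * eta12) * `|u - t| `^ H))%:E }.

(* The pathwise integral nu * \int_(-oo)^t e^(-alpha (t - u)) dB_u, written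
   after integration by parts.  The integrand below is almost surely integrable;
   on the remaining null event [Rintegral] takes a default value. *)
Definition fOU (alpha nu : R) (B : R -> {RV P >-> R}) (t : R) (w : Omega) : R :=
  nu * (B t w - alpha * \int[lebesgue_measure]_(u in `]-oo, t])
                          (B u w * expR (- alpha * (t - u)))).

End FractionalBrownianMotion.

Section Estimators.
Context {Omega : Type} {R : realType}.
Variables (nu1 nu2 H Delta : R) (Y1 Y2 : R -> Omega -> R) (n : nat).

Definition rho_est (w : Omega) : R :=
  (nu1 * nu2 * n%:R * Delta `^ H)^-1 *
  \sum_(0 <= k < n) (Y1 (k.+1%:R * Delta) w - Y1 (k%:R * Delta) w) *
                    (Y2 (k.+1%:R * Delta) w - Y2 (k%:R * Delta) w).

Definition eta_est (w : Omega) : R :=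
  (nu1 * nu2 * n%:R * Delta `^ H)^-1 *
  \sum_(0 <= k < n) (Y1 (k%:R * Delta) w * Y2 (k.+1%:R * Delta) w -
                     Y1 (k.+1%:R * Delta) w * Y2 (k%:R * Delta) w).

End Estimators.

Section Convergence.
Context {d : measure_display} {Omega : measurableType d} {R : realType}.
Variable P : probability Omega R.

Definition cvg_in_L2 (X : nat -> Omega -> R) (c : R) : Prop :=
  (forall n, X n \in Lfun P 2%:E) /\
  ('N[P]_2%:E[(fun w => (X n w - c)%:E)])%E @[n --> \oo] --> 0%E.

Definition cvg_in_probability (X : nat -> Omega -> R) (c : R) : Prop :=
  forall eps : R, 0 < eps ->
    P [set w | eps < `|X n w - c|] @[n --> \oo] --> 0%E.

End Convergence.

(* Main.v *)
Require Import Defs.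
From HB Require Import structures.
From mathcomp Require Import all_boot all_order all_algebra.
From mathcomp Require Import all_classical all_reals all_analysis.
From mathcomp Require Import measurable_realfun.
From mathcomp Require Import ring lra.

Set Implicit Arguments.
Unset Strict Implicit.
Unset Printing Implicit Defensive.

Import Order.TTheory GRing.Theory Num.Theory.
Import numFieldNormedType.Exports.

Local Open Scope classical_set_scope.
Local Open Scope ring_scope.

(** Write [mu_i] for the exponential law of rate [alpha_i].  The integral that
    defines the Ornstein-Uhlenbeck process is an average of lagged increments:
    almost surely [Y^i_t] is the mean over [s] of law [mu_i] of
    [nu_i (B^i_t - B^i_(t - s))] (lemma [fOU_has_mean]).  Both estimators are
    bilinear in [(Y^1, Y^2)], so they are averages over two independent lags
    [s1], [s2] of the same statistics with [Y^i_t] replaced by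
    [B^i_t - B^i_(t - s_i)].  By Jensen's inequality the mean square error of an
    estimator is at most the average of the errors at fixed lags
    ([mean_square_average], [rho_est_averaged], [eta_est_averaged]), and
    dominated convergence leaves only fixed lags [s1 <> s2] ([averaged_cvg]).

    At fixed lags only jointly Gaussian increments of [B] occur, and Isserlis'
    formula gives the second moment of a sum of products exactly
    ([isserlis], [second_moment_bilinear]).  Covariances of increments are
    differences of the functions [g x = c |x|^p], with a constant [c] depending
    on the sign of [x].  On a grid of step [D] the increments over two cells
    seen with lags [a] and [b] have a covariance proportional to the second
    difference of [g] at [l - k + (a - b) / D].  For [0 < p < 2] second
    differences are bounded and vanish at infinity; so do first differences for
    [0 < p < 1].  Hence their double sums over a grid of size [n] are [o(n^2)],
    uniformly in the shift ([bounded_vanishing_mean]): the variances vanish.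

    For rho, the lagged statistic is a signed sum of four sums of products of
    cells, with lags [0] or [s1] and [0] or [s2].  Their means are half the
    second difference of [g] at [(a - b) / D]; as [D] vanishes this tends to
    zero unless [a = b = 0], where it is the constant rho ([rho_form_rate]).

    For eta12, summation by parts expresses the statistic by the one for rho,
    two end terms of size [1 / (n D^H)], and sums of products of a cell of the
    first component with a lagged increment of the second one
    ([eta_form_rate]).  The means of these sums give [rho + eta12] in the limit.
    The covariances of the long lagged increments do not decay with [D]; their
    contribution to the variance is controlled by an explicit rate
    ([row_rate]) that vanishes when [2 H2 < 1].  As [H1 + H2 < 1], this holds
    when [H2 <= H1]; the other case follows by exchanging the components, which
    changes the sign of both the estimator and eta12. *)

(** * Differences of power functions and their double sums *)

Section PowerIncrements.
Context {R : realType}.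
Implicit Types (p cp cm x y : R) (f : R -> R).

(** The covariances of a bivariate fractional Brownian motion are combinations of
    such functions: [cp = cm = 1] for each component, [cp = rho - eta12] and
    [cm = rho + eta12] between the two components. *)
Definition signed_power p cp cm x : R := (if x < 0 then cm else cp) * `|x| `^ p.

Definition diff1 f x : R := f (x + 1) - f x.

Definition diff2 f x : R := f (x + 1) - 2 * f x + f (x - 1).

Definition bounded_vanishing f : Prop :=
  (exists2 K : R, 0 <= K & forall x, `|f x| <= K) /\
  (forall e : R, 0 < e -> exists2 M : R, 0 <= M & forall x, M <= `|x| -> `|f x| <= e).

Lemma signed_power0 p cp cm : p != 0 -> signed_power p cp cm 0 = 0.
Proof. by move=> p0; rewrite /signed_power normr0 powR0 ?mulr0. Qed.

Lemma signed_powerN p cp cm x : p != 0 ->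
  signed_power p cp cm (- x) = signed_power p cm cp x.
Proof.
move=> p0; have [->|x0] := eqVneq x 0; first by rewrite oppr0 !signed_power0.
rewrite /signed_power normrN oppr_lt0.
by have [?|?|E] := ltrgt0P x => //; rewrite E eqxx in x0.
Qed.

Lemma signed_powerM p cp cm a x : 0 < a ->
  signed_power p cp cm (a * x) = a `^ p * signed_power p cp cm x.
Proof.
move=> a0; rewrite /signed_power normrM (gtr0_norm a0) powRM ?normr_ge0 ?ltW//.
by rewrite pmulr_rlt0// mulrCA.
Qed.

Lemma signed_power_ge0 p cp cm x : 0 <= x ->
  signed_power p cp cm x = cp * x `^ p.
Proof. by move=> x0; rewrite /signed_power ltNge x0 /= ger0_norm. Qed.

Lemma signed_power_le p cp cm x y : 0 <= p -> `|x| <= y ->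
  `|signed_power p cp cm x| <= (`|cp| + `|cm|) * y `^ p.
Proof.
move=> p0 xy; rewrite /signed_power normrM (ger0_norm (powR_ge0 _ _)).
apply: ler_pM; rewrite ?normr_ge0 ?powR_ge0//.
  by case: ifP => _; rewrite ?lerDl ?lerDr.
by apply: ge0_ler_powR; rewrite ?nnegrE ?normr_ge0// (le_trans _ xy).
Qed.

Lemma powR_MVT p x y : 0 < x -> x < y ->
  exists2 c, x < c < y & y `^ p - x `^ p = p * c `^ (p - 1) * (y - x).
Proof.
move=> x0 xy.
have [| |c cxy ->] :=
    @MVT R (fun z => z `^ p) (fun z => p * z `^ (p - 1)) x y xy.
- move=> z; rewrite in_itv /= => /andP[z0 z1].
  by apply: is_derive1_powR; lra.
- apply: derivable_within_continuous => z; rewrite in_itv /= => /andP[xz _].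
  by apply: derivable_powR; rewrite in_itv/= andbT; lra.
- by exists c => //; move: cxy; rewrite in_itv.
Qed.

Lemma is_derive_powR_shift p (z a : R) : 0 < z + a ->
  is_derive z 1 (fun w : R => (w + a) `^ p) (p * (z + a) `^ (p - 1)).
Proof.
move=> za.
have H : is_derive (z + a) 1 (fun w : R => w `^ p) (p * (z + a) `^ (p - 1)).
  exact: is_derive1_powR.
have H2 : is_derive z 1 (fun w : R => w + a) 1.
  by apply: is_derive_eq; rewrite ?addr0.
have := @is_derive1_comp R (fun w : R => w `^ p) (fun w : R => w + a) z _ _ H H2.
by rewrite /comp /= mulr1.
Qed.

(** The mean value theorem, applied to [y |-> (y + 1) `^ p - y `^ p] and then to
    its derivative. *)
Lemma diff2_powR_MVT p x : 1 < x ->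
  exists2 c, x - 1 < c < x + 1 &
    (x + 1) `^ p - 2 * x `^ p + (x - 1) `^ p = p * (p - 1) * c `^ (p - 2).
Proof.
move=> x1.
have [|||c cx E] := @MVT R (fun y => (y + 1) `^ p - (y + 0) `^ p)
    (fun z => p * (z + 1) `^ (p - 1) - p * (z + 0) `^ (p - 1)) (x - 1) x.
- lra.
- move=> z; rewrite in_itv/= => /andP[z0 z1].
  by apply: is_deriveB; apply: is_derive_powR_shift; lra.
- apply: derivable_within_continuous => z; rewrite in_itv /= => /andP[xz _].
  apply: derivableB; apply: ex_derive; apply: is_derive_powR_shift; lra.
move: cx E; rewrite in_itv/= => /andP[c1 c2].
have [|//|c' /andP[c'1 c'2]] := @powR_MVT (p - 1) c (c + 1); first lra.
  lra.
rewrite (_ : c + 1 - c = 1); last lra.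
rewrite mulr1 !addr0 subrK (_ : x - (x - 1) = 1); last lra.
rewrite mulr1 => E' E.
exists c'; first by apply/andP; split; lra.
have -> : p - 2 = p - 1 - 1 by lra.
rewrite -mulrA -E'.
lra.
Qed.

Lemma powR_small (q e : R) : q < 0 -> 0 < e ->
  exists2 M : R, 0 < M & forall x : R, M <= x -> x `^ q <= e.
Proof.
move=> q0 e0; exists (e^-1 `^ (- q)^-1); first by rewrite powR_gt0 ?invr_gt0.
move=> x Mx.
have x0 : 0 < x by rewrite (lt_le_trans _ Mx)// powR_gt0 ?invr_gt0.
rewrite -[q]opprK powRN -[e]invrK lef_pV2 ?posrE ?invr_gt0 ?powR_gt0//.
rewrite -[leLHS](@powRr1 _ e^-1) ?invr_ge0 ?(ltW e0)//.
rewrite -[1](@mulVf _ (- q)); last by rewrite oppr_eq0; apply/eqP; lra.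
rewrite powRrM; apply: ge0_ler_powR; rewrite ?nnegrE ?powR_ge0//; lra.
Qed.

(** Away from the origin a second difference is a second derivative, of order
    [x `^ (p - 2)]; near the origin the three values are bounded. *)
Lemma diff2_signed_power_vanishing p cp cm : 0 < p < 2 ->
  bounded_vanishing (diff2 (signed_power p cp cm)).
Proof.
move=> /andP[p0 p2].
have pn0 : p != 0 by rewrite gt_eqF.
(* by reflection it is enough to look at the right half-line *)
have refl a b x : diff2 (signed_power p a b) (- x) = diff2 (signed_power p b a) x.
  rewrite /diff2 (_ : - x + 1 = - (x - 1)); last lra.
  by rewrite (_ : - x - 1 = - (x + 1)) ?signed_powerN//; lra.
have far a b x : 2 <= x -> `|diff2 (signed_power p a b) x| <=
    `|a| * `|p * (p - 1)| * (x - 1) `^ (p - 2).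
  move=> x2; rewrite /diff2 !signed_power_ge0; [|lra..].
  have [|c /andP[c1 c2] E] := @diff2_powR_MVT p x; first lra.
  rewrite (_ : _ + _ = a * (p * (p - 1) * c `^ (p - 2))); last by rewrite -E; ring.
  rewrite !normrM (ger0_norm (powR_ge0 c _)) mulrA.
  apply: ler_wpM2l; first by rewrite !mulr_ge0.
  rewrite (_ : p - 2 = - (2 - p)); last lra.
  rewrite !powRN lef_pV2 ?posrE ?powR_gt0; [|lra..].
  by apply: ge0_ler_powR; rewrite ?nnegrE; lra.
split.
  pose K := `|cp| + `|cm|.
  have K0 : 0 <= K by rewrite addr_ge0.
  exists (4 * (K * 3 `^ p) + K * `|p * (p - 1)|).
    by rewrite addr_ge0 ?mulr_ge0 ?powR_ge0.
  have near0 x : `|x| <= 2 -> `|diff2 (signed_power p cp cm) x| <= 4 * (K * 3 `^ p).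
    move=> x2; rewrite /diff2.
    have B z : `|z| <= 3 -> `|signed_power p cp cm z| <= K * 3 `^ p.
      by apply: signed_power_le; exact: ltW.
    have := B (x + 1); have := B x; have := B (x - 1).
    move: x2; rewrite !ler_norml => /andP[x1 x2].
    move=> /(_ _)/andP[|b1 b2]; first by apply/andP; split; lra.
    move=> /(_ _)/andP[|b3 b4]; first by apply/andP; split; lra.
    move=> /(_ _)/andP[|b5 b6]; first by apply/andP; split; lra.
    by apply/andP; split; lra.
  have pow1 x : 2 <= x -> (x - 1) `^ (p - 2) <= 1.
    move=> x2; rewrite -[leRHS](powRr0 (x - 1)); apply: ler_powR; lra.
  have far' a b x : `|a| <= K -> 2 <= x -> `|diff2 (signed_power p a b) x| <=
      K * `|p * (p - 1)|.
    move=> aK x2; apply: (le_trans (far _ _ _ x2)).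
    rewrite -[leRHS]mulr1; apply: ler_pM; rewrite ?mulr_ge0 ?powR_ge0 ?pow1//.
    by rewrite ler_wpM2r.
  move=> x; have [x2|x2] := leP `|x| 2.
    by rewrite (le_trans (near0 _ x2))// lerDl mulr_ge0.
  have K3 : 0 <= 4 * (K * 3 `^ p) by rewrite !mulr_ge0 ?powR_ge0.
  have [x0|x0] := leP 0 x.
    rewrite ger0_norm// in x2.
    by rewrite (le_trans (far' _ _ _ _ _)) ?lerDr// ?lerDl// ltW.
  rewrite ltr0_norm// in x2.
  rewrite -[x in diff2 _ x]opprK refl.
  by rewrite (le_trans (far' _ _ _ _ _)) ?lerDr// ?lerDl// ltW.
move=> e e0.
pose K := (`|cp| + `|cm|) * `|p * (p - 1)| + 1.
have K0 : 0 < K by rewrite ltr_wpDl// mulr_ge0// addr_ge0.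
have [||M M0 MP] := @powR_small (p - 2) (e / K); [lra|by rewrite divr_gt0|].
exists (M + 2); first lra.
have far' a b x : `|a| <= `|cp| + `|cm| -> M + 2 <= x ->
    `|diff2 (signed_power p a b) x| <= e.
  move=> aK xM; apply: (le_trans (far _ _ _ _)); first lra.
  rewrite -[leRHS](@divfK _ K) ?gt_eqF// mulrC.
  apply: ler_pM; rewrite ?powR_ge0 ?mulr_ge0//; first by apply: MP; lra.
  rewrite /K (le_trans (ler_wpM2r _ aK))// lerDl//.
move=> x; have [x0|x0] := leP 0 x.
  by rewrite ger0_norm// => xM; apply: far' => //; rewrite lerDl.
rewrite ltr0_norm// => xM.
rewrite -[x in diff2 _ x]opprK refl; apply: far' => //; rewrite lerDr//.
Qed.

End PowerIncrements.

Section DoubleSums.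
Context {R : realType}.
Implicit Types (p cp cm x y : R) (f : R -> R).

(** As for second differences, with the derivative of order [x `^ (p - 1)]. *)
Lemma diff1_signed_power_vanishing p cp cm : 0 < p < 1 ->
  bounded_vanishing (diff1 (signed_power p cp cm)).
Proof.
move=> /andP[p0 p1].
have pn0 : p != 0 by rewrite gt_eqF.
have refl a b x : `|diff1 (signed_power p a b) (- x)| =
    `|diff1 (signed_power p b a) (x - 1)|.
  rewrite /diff1 (_ : - x + 1 = - (x - 1)); last lra.
  by rewrite !signed_powerN// subrK distrC.
have far a b x : 1 <= x -> `|diff1 (signed_power p a b) x| <=
    `|a| * p * x `^ (p - 1).
  move=> x1; rewrite /diff1 !signed_power_ge0; [|lra..].
  have [||c /andP[c1 c2] E] := @powR_MVT R p x (x + 1); [lra..|].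
  rewrite -mulrBr E (_ : x + 1 - x = 1); last lra.
  rewrite mulr1 !normrM (ger0_norm (powR_ge0 c _)) (gtr0_norm p0) mulrA.
  apply: ler_wpM2l; first by rewrite mulr_ge0// ltW.
  rewrite (_ : p - 1 = - (1 - p)); last lra.
  rewrite !powRN lef_pV2 ?posrE ?powR_gt0; [|lra..].
  by apply: ge0_ler_powR; rewrite ?nnegrE; lra.
split.
  pose K := `|cp| + `|cm|.
  have K0 : 0 <= K by rewrite addr_ge0.
  exists (2 * (K * 3 `^ p) + K * p).
    by rewrite addr_ge0 ?mulr_ge0 ?powR_ge0// ltW.
  have near0 x : `|x| <= 2 ->
      `|diff1 (signed_power p cp cm) x| <= 2 * (K * 3 `^ p).
    move=> x2; rewrite /diff1.
    have B z : `|z| <= 3 -> `|signed_power p cp cm z| <= K * 3 `^ p.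
      by apply: signed_power_le; exact: ltW.
    have := B (x + 1); have := B x.
    move: x2; rewrite !ler_norml => /andP[x1 x2].
    move=> /(_ _)/andP[|b1 b2]; first by apply/andP; split; lra.
    move=> /(_ _)/andP[|b3 b4]; first by apply/andP; split; lra.
    by apply/andP; split; lra.
  have pow1 x : 1 <= x -> x `^ (p - 1) <= 1.
    move=> x2; rewrite -[leRHS](powRr0 x); apply: ler_powR; lra.
  have far' a b x : `|a| <= K -> 1 <= x -> `|diff1 (signed_power p a b) x| <=
      K * p.
    move=> aK x2; apply: (le_trans (far _ _ _ x2)).
    rewrite -[leRHS]mulr1; apply: ler_pM; rewrite ?mulr_ge0 ?powR_ge0 ?pow1//.
    - exact: ltW.
    - by rewrite ler_wpM2r// ltW.
  move=> x; have [x2|x2] := leP `|x| 2.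
    by rewrite (le_trans (near0 _ x2))// lerDl mulr_ge0// ltW.
  have K3 : 0 <= 2 * (K * 3 `^ p) by rewrite !mulr_ge0 ?powR_ge0.
  have [x0|x0] := leP 0 x.
    rewrite ger0_norm// in x2.
    by rewrite (le_trans (far' _ _ _ _ _)) ?lerDr// ?lerDl//; lra.
  rewrite ltr0_norm// in x2.
  rewrite -[x in diff1 _ x]opprK refl.
  by rewrite (le_trans (far' _ _ _ _ _)) ?lerDr// ?lerDl//; lra.
move=> e e0.
pose K := (`|cp| + `|cm|) * p + 1.
have K0 : 0 < K by rewrite ltr_wpDl// mulr_ge0 ?addr_ge0// ltW.
have [||M M0 MP] := @powR_small R (p - 1) (e / K); [lra|by rewrite divr_gt0|].
exists (M + 2); first lra.
have far' a b x : `|a| <= `|cp| + `|cm| -> M + 1 <= x ->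
    `|diff1 (signed_power p a b) x| <= e.
  move=> aK xM; apply: (le_trans (far _ _ _ _)); first lra.
  rewrite -[leRHS](@divfK _ K) ?gt_eqF// mulrC.
  apply: ler_pM; rewrite ?powR_ge0 ?mulr_ge0//; first exact: ltW.
    by apply: MP; lra.
  by rewrite /K; have := ler_wpM2r (ltW p0) aK; lra.
move=> x; have [x0|x0] := leP 0 x.
  by rewrite ger0_norm// => xM; apply: far'; rewrite ?lerDl//; lra.
rewrite ltr0_norm// => xM.
rewrite -[x in diff1 _ x]opprK refl; apply: far'; rewrite ?lerDr//; lra.
Qed.

Lemma diff2_signed_power0 p cp cm : p != 0 ->
  diff2 (signed_power p cp cm) 0 = cp + cm.
Proof.
move=> p0; rewrite /diff2 add0r sub0r signed_powerN// signed_power0//.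
by rewrite !signed_power_ge0// powR1; lra.
Qed.

Lemma count_near (M c : R) (n : nat) : 0 <= M ->
  \sum_(0 <= l < n) (`|l%:R - c| <= M)%R%:R <= 2 * M + 1.
Proof.
move=> M0.
(* the indicator is dominated by the increments of x |-> clamp (x - c + M) *)
pose clamp x : R := if x - c + M <= 0 then 0 else
                if 2 * M + 1 <= x - c + M then 2 * M + 1 else x - c + M.
have clampE x : 0 <= clamp x <= 2 * M + 1.
  rewrite /clamp; have [?|?] := leP (x - c + M) 0; first by apply/andP; split; lra.
  by have [?|?] := leP (2 * M + 1) (x - c + M); apply/andP; split; lra.
apply: (@le_trans _ _ (\sum_(0 <= l < n) (clamp l.+1%:R - clamp l%:R))); last first.
  rewrite (@telescope_sumr _ 0 n (fun l => clamp l%:R))//.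
  by have /andP[? ?] := clampE n%:R; have /andP[? ?] := clampE 0%:R; lra.
apply: ler_sum => l _; rewrite /clamp -[l.+1%:R]natr1.
rewrite ler_norml; set z := l%:R.
have [?|?] := leP (z - c + M) 0; have [?|?] := leP (z + 1 - c + M) 0;
have [?|?] := leP (2 * M + 1) (z - c + M);
have [?|?] := leP (2 * M + 1) (z + 1 - c + M); case: andP => [[? ?]|_] /=; lra.
Qed.

(** On each row all but a bounded number of the entries are small, and that
    number does not depend on the shift [a] ([count_near]).  The uniformity in
    [a] matters: the shifts are lags divided by the grid step, hence unbounded. *)
Lemma bounded_vanishing_mean f : bounded_vanishing f ->
  forall e : R, 0 < e -> exists N : nat, forall n, (N <= n)%N -> forall a : R,
    \sum_(0 <= k < n) \sum_(0 <= l < n) `|f (l%:R - k%:R + a)| <= e * n%:R ^+ 2.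
Proof.
move=> [[K K0 fK] fe] e e0.
have [M M0 MP] := fe (e / 2) (divr_gt0 e0 (ltr0Sn R 1)).
pose C := K * (2 * M + 1).
exists (Num.bound (C / (e / 2))).+1 => n Nn a.
have Cn : C <= e / 2 * n%:R.
  rewrite -ler_pdivrMl ?divr_gt0// mulrC; apply/ltW.
  have C0 : 0 <= C / (e / 2) by rewrite divr_ge0 ?mulr_ge0//; lra.
  have := archi_boundP C0 => /lt_le_trans; apply.
  by rewrite ler_nat (leq_trans _ Nn).
have row k : \sum_(0 <= l < n) `|f (l%:R - k%:R + a)| <= e * n%:R.
  apply: (@le_trans _ _ (\sum_(0 <= l < n) (e / 2 + K * (`|l%:R - (k%:R - a)| <= M)%R%:R))).
    apply: ler_sum => l _; have [lM|lM] := leP `|l%:R - (k%:R - a)| M.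
      by rewrite mulr1 (le_trans (fK _))// lerDr ltW// divr_gt0.
    rewrite mulr0 addr0; apply: MP.
    by rewrite (_ : l%:R - k%:R + a = l%:R - (k%:R - a)) ?ltW//; lra.
  rewrite big_split/= sumr_const_nat subn0 -mulr_sumr -[X in X + _]mulr_natr.
  have := ler_wpM2l K0 (count_near (k%:R - a) n M0).
  by rewrite -/C => ?; lra.
apply: (le_trans (ler_sum _ (fun k _ => row k))).
by rewrite sumr_const_nat subn0 -mulr_natr; lra.
Qed.

Lemma sum_diff2_telescope f n :
  \sum_(0 <= k < n) \sum_(0 <= l < n) diff2 f (l%:R - k%:R) =
  f n%:R + f (- n%:R) - 2 * f 0.
Proof.
have row k : \sum_(0 <= l < n) diff2 f (l%:R - k%:R) =
   (f (n%:R - k%:R) - f (n%:R - k%:R - 1)) - (f (- k%:R) - f (- k%:R - 1)).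
  have := @telescope_sumr _ 0 n (fun l => f (l%:R - k%:R) - f (l%:R - k%:R - 1)).
  rewrite /= sub0r => <-//.
  apply: eq_bigr => l _; rewrite /diff2 -[l.+1%:R]natr1.
  rewrite (_ : l%:R + 1 - k%:R - 1 = l%:R - k%:R); last lra.
  rewrite (_ : l%:R + 1 - k%:R = l%:R - k%:R + 1); last lra.
  lra.
under eq_bigr do rewrite row.
transitivity (\sum_(0 <= k < n) ((f (- k.+1%:R) - f (n%:R - k.+1%:R)) -
                                 (f (- k%:R) - f (n%:R - k%:R)))).
  apply: eq_bigr => k _; rewrite -[k.+1%:R]natr1.
  rewrite !opprD !addrA; lra.
have := @telescope_sumr _ 0 n (fun k => f (- k%:R) - f (n%:R - k%:R)).
by rewrite /= subrr oppr0 addr0 => ->//; lra.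
Qed.

End DoubleSums.

Section PowerDoubleSum.
Context {R : realType}.
Implicit Types (p cp cm x y : R) (f : R -> R).

Lemma diff2_powerN p x : p != 0 ->
  diff2 (signed_power p 1 1) (- x) = diff2 (signed_power p 1 1) x.
Proof.
move=> p0; rewrite /diff2 (_ : - x + 1 = - (x - 1)); last lra.
by rewrite (_ : - x - 1 = - (x + 1)) ?signed_powerN//; lra.
Qed.

(** [x |-> x `^ p] is convex for [1 <= p] and concave for [p <= 1]. *)
Lemma diff2_power_sign p (m : nat) : 0 < p -> (0 < m)%N ->
  0 <= (p - 1) * diff2 (signed_power p 1 1) m%:R.
Proof.
case: m => [//|[|m]] p0 _.
- rewrite /diff2 !signed_power_ge0; [|lra..]; rewrite powR1.
  rewrite (_ : 1 - 1 = 0) ?powR0 ?gt_eqF//; last lra.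
  rewrite (_ : 1 + 1 = 2 :> R); last lra.
  have [p1|p1] := leP 1 p.
    have : (2 : R) `^ 1 <= 2 `^ p by apply: ler_powR; lra.
    rewrite powRr1// => h; apply: mulr_ge0; lra.
  have : (2 : R) `^ p <= 2 `^ 1 by apply: ler_powR; lra.
  rewrite powRr1// => h.
  by apply: mulr_le0; lra.
- have x1 : 1 < m.+2%:R :> R by rewrite ltr1n.
  move: (m.+2%:R : R) x1 => x x1.
  rewrite /diff2 !signed_power_ge0; [|lra..].
  have [c /andP[c1 c2] E] := @diff2_powR_MVT R p _ x1.
  rewrite !mul1r E (_ : _ * _ = p * (p - 1) ^+ 2 * c `^ (p - 2)); last by ring.
  by rewrite mulr_ge0 ?powR_ge0// mulr_ge0 ?sqr_ge0// ltW.
Qed.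

(** Off the diagonal all second differences have the sign of [p - 1]
    ([diff2_power_sign]), so the absolute values can be dropped and the sum
    telescopes.  A vanishing bound [o(n^2)] would not be enough here: the sum is
    later divided by [n ^+ 2 * D `^ (2 * H2)]. *)
Lemma sum_norm_diff2_power p n : 0 < p < 2 ->
  \sum_(0 <= k < n) \sum_(0 <= l < n)
     `|diff2 (signed_power p 1 1) (l%:R - k%:R)| <= 2 * n%:R `^ p + 4 * n%:R.
Proof.
move=> /andP[p0 p2]; have pn0 : p != 0 by rewrite gt_eqF.
set g := signed_power p 1 1.
have gE : \sum_(0 <= k < n) \sum_(0 <= l < n) diff2 g (l%:R - k%:R) = 2 * n%:R `^ p.
  rewrite sum_diff2_telescope /g signed_powerN// signed_power0// signed_power_ge0//.
  lra.
have sgn k l : k != l -> 0 <= (p - 1) * diff2 g (l%:R - k%:R).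
  have aux (i j : nat) : (i < j)%N -> 0 <= (p - 1) * diff2 g (j%:R - i%:R).
    by move=> ij; rewrite -natrB ?(ltnW ij)// diff2_power_sign// subn_gt0.
  rewrite neq_ltn => /orP[kl|lk]; first exact: aux.
  by rewrite -[l%:R - k%:R]opprB diff2_powerN//; exact: aux.
have [p1|p1] := leP 1 p.
  rewrite (_ : \sum_(0 <= k < n) _ =
      \sum_(0 <= k < n) \sum_(0 <= l < n) diff2 g (l%:R - k%:R)).
    by rewrite gE lerDl mulr_ge0.
  apply: eq_bigr => k _; apply: eq_bigr => l _; rewrite ger0_norm//.
  have [->|kl] := eqVneq k l; first by rewrite subrr diff2_signed_power0//; lra.
  have [p1'|p1'] := eqVneq p 1; last first.
    by rewrite -(@pmulr_rge0 _ (p - 1)) ?sgn// subr_gt0 lt_neqAle eq_sym p1'.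
  have lin x : g x = `|x|.
    by rewrite /g /signed_power p1' powRr1//; case: ifP; rewrite mul1r.
  rewrite /diff2 !lin; set z := l%:R - k%:R.
  have := ler_normD (z + 1) (z - 1); rewrite (_ : z + 1 + (z - 1) = 2 * z); last lra.
  by rewrite normrM (ger0_norm (ler0n R 2)); lra.
rewrite (@le_trans _ _ (\sum_(0 <= k < n) \sum_(0 <= l < n)
    (- diff2 g (l%:R - k%:R) + 4 * (k == l)%:R)))//.
  apply: ler_sum => k _; apply: ler_sum => l _.
  have [->|kl] := eqVneq k l.
    by rewrite subrr diff2_signed_power0// mulr1 ger0_norm; lra.
  rewrite mulr0 addr0 ler0_norm//.
  by rewrite -(@nmulr_rge0 _ (p - 1)) ?sgn//; lra.
under eq_bigr do rewrite big_split/= sumrN.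
rewrite big_split/= sumrN gE.
have : \sum_(0 <= k < n) \sum_(0 <= l < n) (4 * (k == l)%:R) <= 4 * n%:R :> R.
  rewrite (_ : 4 * n%:R = \sum_(0 <= k < n) 4); last first.
    by rewrite sumr_const_nat subn0 mulr_natr.
  rewrite big_nat [leRHS]big_nat; apply: ler_sum => k /andP[_ kn].
  rewrite -mulr_sumr -[leRHS]mulr1 ler_wpM2l//.
  rewrite (bigD1_seq k) ?iota_uniq ?mem_index_iota//= eqxx big1 ?addr0//.
  by move=> i /negbTE; rewrite eq_sym => ->.
have : 0 <= n%:R `^ p :> R by exact: powR_ge0.
lra.
Qed.

End PowerDoubleSum.

(** * Moments of Gaussian random variables *)

Section Density.
Context {d} {T : measurableType d} {R : realType}.
Local Open Scope ereal_scope.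

(** The density agrees almost everywhere with the Radon-Nikodym derivative, for
    which the change of measure is known. *)
Lemma ge0_integral_density (nu : {finite_measure set T -> \bar R})
    (mu : {sigma_finite_measure set T -> \bar R}) (g : T -> R) :
  measurable_fun setT g -> (forall x, (0 <= g x)%R) ->
  (forall A, measurable A -> nu A = \int[mu]_(x in A) (g x)%:E) ->
  forall f : T -> \bar R, measurable_fun setT f -> (forall x, 0 <= f x) ->
  \int[nu]_x f x = \int[mu]_x (f x * (g x)%:E).
Proof.
move=> mg g0 nuE f mf f0.
have mgE : measurable_fun setT (EFin \o g) by exact/measurable_EFinP.
have dom : nu `<< mu.
  apply/null_content_dominatesP => A mA A0; rewrite nuE//.
  apply: null_set_integral => //; exact: measurable_funTS.
rewrite -(Radon_Nikodym_SigmaFinite.change_of_variables dom)//.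
apply: ae_eq_integral => //.
- apply: emeasurable_funM => //.
  exact: measurable_int (Radon_Nikodym_SigmaFinite.f_integrable dom).
- exact: emeasurable_funM.
- apply: ae_eqe_mul2l; apply: integral_ae_eq => //.
  + exact: Radon_Nikodym_SigmaFinite.f_integrable dom.
  + move=> E _ mE; rewrite -nuE//.
    by rewrite -(Radon_Nikodym_SigmaFinite.f_integral dom).
Qed.

End Density.

Section ImproperIntegral.
Context {R : realType}.
Notation mu := (@lebesgue_measure R).

(** The integral over [[- n, n]] is [F n - F (- n)], which tends to zero because
    [F] decays at least like [C / |x - m|]. *)
Lemma integral_derive_vanishing (f F h : R -> R) (m C : R) :
  continuous f -> (forall x : R, is_derive x 1 F (f x)) ->
  mu.-integrable setT (EFin \o h) -> (forall x, `|f x| <= h x) ->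
  (forall x, `|F x| * (1 + `|x - m|) <= C) ->
  mu.-integrable setT (EFin \o f) /\ (\int[mu]_x (f x)%:E = 0)%E.
Proof.
move=> cf dF ih fh FC.
have mf : measurable_fun setT f by exact: continuous_measurable_fun.
pose D (n : nat) := `[- n.+1%:R, n.+1%:R]%classic : set R.
pose f_ n := (EFin \o f) \_ (D n).
have [] := @dominated_convergence _ _ R mu setT measurableT f_ (EFin \o f) (EFin \o h).
- move=> n; apply/(measurable_restrictT _ _).1 => //; first exact: measurable_itv.
  by apply/measurable_funTS/measurable_EFinP.
- exact/measurable_EFinP.
- apply: aeW => x _; apply: cvg_near_cst.
  near=> n; rewrite /f_ /patch ifT//; rewrite inE /D /= in_itv/=.
  rewrite -ler_norml.
  apply: (@le_trans _ _ n%:R); last by rewrite ler_nat.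
  by near: n; exact: nbhs_infty_ger.
- exact: ih.
- apply: aeW => x n _; rewrite /f_ /patch; case: ifPn => _; first by rewrite lee_fin.
  by rewrite abse0 lee_fin (le_trans _ (fh x)).
move=> intf _ cvgf; split => //.
have E : [sequence (\int[mu]_x f_ n x)%E]_n = (fun n => (F n.+1%:R - F (- n.+1%:R))%:E).
  apply/funext => n; transitivity (\int[mu]_(x in D n) (f x)%:E)%E.
    by rewrite [RHS]integral_mkcond.
  rewrite (@continuous_FTC2 _ f F) ?EFinB//.
  - by rewrite -subr_gt0 opprK addr_gt0.
  - exact: continuous_subspaceT.
  - have cF : continuous F.
      by move=> x; apply/differentiable_continuous/derivable1_diffP; case: (dF x).
    split.
    + by move=> x _; case: (dF x).
    + apply: cvg_at_right_filter; exact: cF.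
    + apply: cvg_at_left_filter; exact: cF.
  - by move=> x _; rewrite derive1E; case: (dF x).
rewrite E in cvgf.
have lim0 : (F n.+1%:R - F (- n.+1%:R))%:E @[n --> \oo] --> (0%R)%:E.
  apply: cvg_EFin; first by apply: nearW.
  have C0 : 0 <= C by rewrite (le_trans _ (FC 0))// mulr_ge0// addr_ge0.
  have FtoC x e : 0 < e -> C / e <= `|x - m| -> `|F x| <= e.
    move=> e0; rewrite ler_pdivrMr// => Cx; rewrite leNgt; apply/negP => eF.
    have := FC x; apply/negP; rewrite -ltNge (le_lt_trans Cx)//.
    have := ler_wpM2l (normr_ge0 (x - m)) (ltW eF); lra.
  apply/cvgrPdist_le => e e0; near=> n.
  rewrite sub0r normrN (le_trans (ler_normB _ _))// [e]splitr.
  have nbig : C / (e / 2) + `|m| <= n.+1%:R.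
    apply: (@le_trans _ _ n%:R); last by rewrite ler_nat.
    by near: n; exact: nbhs_infty_ger.
  apply: lerD; apply: FtoC; rewrite ?divr_gt0//.
  - have := ler_norm (n.+1%:R - m); have := ler_norm m; lra.
  - rewrite -opprD normrN; have := ler_norm (n.+1%:R + m).
    have := ler_norm (- m); rewrite normrN; lra.
by apply/esym/(cvg_unique _ _ cvgf).
Unshelve. all: end_near. Qed.

End ImproperIntegral.

Section NormalMoments.
Context {R : realType}.
Variables (m s : R).
Hypothesis s0 : s != 0.
Notation mu := (@lebesgue_measure R).
Let v := s ^+ 2.
Let phi := normal_fun m s.

Let v0 : 0 < v. Proof. by rewrite /v exprn_even_gt0. Qed.

(** The density solves [phi' = - (x - m) / v * phi].  This provides primitives of
    [x - m], [(x - m) ^+ 2 - v] and [(x - m) ^+ 4 - 3 * v ^+ 2] against [phi]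
    which vanish at infinity, and hence the first, second and fourth moments. *)
Let dphi (x : R) : is_derive x 1 phi (- ((x - m) / v) * phi x).
Proof.
have d : is_derive x 1 (fun y : R => - (y - m) ^+ 2 / (v *+ 2)) (- ((x - m) / v)).
  apply: is_derive_eq.
  rewrite /GRing.scale/= -[v *+ 2]mulr_natr; field; exact: lt0r_neq0.
have := @is_derive1_comp R expR (fun y : R => - (y - m) ^+ 2 / (v *+ 2)) x _ _
  (is_derive_expR _) d.
by rewrite mulrC.
Qed.

Let dF1 (x : R) : is_derive x 1 (fun x => - v * phi x) ((x - m) * phi x).
Proof.
have := dphi x => dp.
apply: is_derive_eq.
rewrite /GRing.scale/=; field; exact: lt0r_neq0.
Qed.

Let dF2 (x : R) : is_derive x 1 (fun x => - v * ((x - m) * phi x))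
  (((x - m) ^+ 2 - v) * phi x).
Proof.
have := dphi x => dp.
apply: is_derive_eq.
rewrite /GRing.scale/=; field; exact: lt0r_neq0.
Qed.

Let dF4 (x : R) : is_derive x 1
  (fun x => - v * ((x - m) ^+ 3 * phi x) + - (3 * v ^+ 2) * ((x - m) * phi x))
  (((x - m) ^+ 4 - 3 * v ^+ 2) * phi x).
Proof.
have := dphi x => dp.
apply: is_derive_eq.
rewrite /GRing.scale/=; field; exact: lt0r_neq0.
Qed.

(** A dominating function for polynomials of degree at most four against [phi]:
    a multiple of the Gaussian density of twice the variance, which is known to
    be integrable. *)
Let h (x : R) := 4 * (1 + 4 * v) ^+ 2 * normal_fun m (Num.sqrt 2 * s) x.

Let bound (x : R) : (1 + (x - m) ^+ 2) ^+ 2 * phi x <= h x.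
Proof.
rewrite /h /phi /normal_fun.
set y := x - m.
have y2 : 0 <= y ^+ 2 by exact: sqr_ge0.
pose u := y ^+ 2 / (4 * v).
have u0 : 0 <= u by rewrite divr_ge0// mulr_ge0// ltW.
have yu : y ^+ 2 = 4 * v * u by rewrite /u; field; exact: lt0r_neq0.
have -> : - y ^+ 2 / (s ^+ 2 *+ 2) = - (2 * u).
  by rewrite -/v -[v *+ 2]mulr_natr /u; field; exact: lt0r_neq0.
have -> : - y ^+ 2 / ((Num.sqrt 2 * s) ^+ 2 *+ 2) = - u.
  rewrite exprMn sqr_sqrtr ?ler0n// -/v -[_ *+ 2]mulr_natr /u.
  by field; exact: lt0r_neq0.
have eu : 1 + u / 2 <= expR (u / 2) by exact: expR_ge1Dx.
have -> : - (2 * u) = - u - u by lra.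
rewrite expRD mulrA; apply: ler_wpM2r; first exact: expR_ge0.
rewrite expRN ler_pdivrMr ?expR_gt0// yu.
have -> : expR u = expR (u / 2) * expR (u / 2) by rewrite -expRD; congr expR; lra.
set w := expR _ in eu *.
have vu : 1 + 4 * v * u <= (1 + 4 * v) * (2 * w).
  have : (1 + 4 * v) * (1 + u) <= (1 + 4 * v) * (2 * w).
    by apply: ler_wpM2l; have := v0; lra.
  by rewrite mulrDl mul1r mulrDr mulr1; have := ltW v0; lra.
have : (1 + 4 * v * u) ^+ 2 <= ((1 + 4 * v) * (2 * w)) ^+ 2.
  have w0 : 0 <= w by exact: expR_ge0.
  have vu0 : 0 <= v * u by rewrite mulr_ge0// ltW.
  by apply: lerXn2r => //; rewrite nnegrE; lra.
by rewrite !exprMn; lra.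
Qed.

Let ih : mu.-integrable setT (EFin \o h).
Proof.
have s'0 : Num.sqrt 2 * s != 0 by rewrite mulf_neq0// sqrtr_eq0 -ltNge.
pose c := 4 * (1 + 4 * v) ^+ 2 / normal_peak (Num.sqrt 2 * s).
have := integrableZl measurableT c (@integrable_normal_pdf R m (Num.sqrt 2 * s)).
apply: eq_integrable => // x _.
rewrite /= normal_pdfE// -EFinM /c /h mulrA divfK// gt_eqF//.
exact: normal_peak_gt0.
Qed.

Let h_le (x : R) : h x <= 4 * (1 + 4 * v) ^+ 2.
Proof.
rewrite /h -[leRHS]mulr1; apply: ler_wpM2l; first by rewrite mulr_ge0 ?sqr_ge0.
rewrite /normal_fun.
by rewrite -[leRHS]expR0 ler_expR mulNr oppr_le0 divr_ge0 ?sqr_ge0 ?mulrn_wge0 ?sqr_ge0.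
Qed.

Let cphi : continuous phi.
Proof. by move=> x; apply/differentiable_continuous/derivable1_diffP; case: (dphi x). Qed.

Let moment0 (p F : R -> R) (c : R) : continuous p ->
  (forall x : R, is_derive x 1 F (p x * phi x)) ->
  (forall x, `|p x| <= c * (1 + (x - m) ^+ 2) ^+ 2) ->
  (forall x, `|F x| * (1 + `|x - m|) <= c * ((1 + (x - m) ^+ 2) ^+ 2 * phi x)) ->
  0 <= c ->
  mu.-integrable setT (EFin \o (fun x => p x * phi x)) /\
  (\int[mu]_x (p x * phi x)%:E = 0)%E.
Proof.
move=> cp dF pc Fc c0.
apply: (@integral_derive_vanishing R (fun x => p x * phi x) F (fun x => c * h x)
   m (c * (4 * (1 + 4 * v) ^+ 2))) => //.
- by move=> x; apply: continuousM; [exact: cp|exact: cphi].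
- have := integrableZl measurableT c ih.
  by apply: eq_integrable.
- move=> x; rewrite normrM (ger0_norm (normal_fun_ge0 m s x)).
  apply: (@le_trans _ _ (c * (1 + (x - m) ^+ 2) ^+ 2 * phi x)).
    by rewrite ler_wpM2r ?normal_fun_ge0.
  by rewrite -mulrA ler_wpM2l.
- move=> x; rewrite (le_trans (Fc x))// ler_wpM2l//.
  exact: le_trans (bound x) (h_le x).
Qed.

Let cpow (k : nat) : continuous (fun x : R => (x - m) ^+ k).
Proof.
move=> x; apply: (@continuous_comp _ _ _ (fun x => x - m) (fun y : R => y ^+ k)).
  by apply: continuousB; [exact: cvg_id|exact: cvg_cst].
exact: exprn_continuous.
Qed.

Let pdfE : normal_pdf m s = (fun x => normal_peak s * phi x).
Proof. by rewrite normal_pdfE. Qed.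

Let zero_pdf (p : R -> R) :
  mu.-integrable setT (EFin \o (fun x => p x * phi x)) ->
  (\int[mu]_x (p x * phi x)%:E = 0)%E ->
  mu.-integrable setT (EFin \o (fun x => p x * normal_pdf m s x)) /\
  (\int[mu]_x (p x * normal_pdf m s x)%:E = 0)%E.
Proof.
move=> ip ip0.
have E x : p x * normal_pdf m s x = normal_peak s * (p x * phi x).
  by rewrite pdfE mulrCA.
split.
  have := integrableZl measurableT (normal_peak s) ip.
  by apply: eq_integrable => // x _ /=; rewrite E.
under eq_integral do rewrite E EFinM.
by rewrite integralZl// ip0 mule0.
Qed.

Let shift_pdf (p : R -> R) (c : R) :
  mu.-integrable setT (EFin \o (fun x => (p x - c) * normal_pdf m s x)) /\
  (\int[mu]_x ((p x - c) * normal_pdf m s x)%:E = 0)%E ->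
  (\int[mu]_x (p x * normal_pdf m s x)%:E = c%:E)%E.
Proof.
move=> [ip ip0].
have E x : p x * normal_pdf m s x = (p x - c) * normal_pdf m s x + c * normal_pdf m s x.
  by rewrite -mulrDl subrK.
under eq_integral do rewrite E EFinD.
have iN := integrable_normal_pdf m s.
rewrite integralD//; last first.
  by have := integrableZl measurableT c iN.
under [X in (_ + X)%E]eq_integral do rewrite EFinM.
by rewrite ip0 add0e integralZl// integral_normal_pdf mule1.
Qed.

Let y2 (x : R) : 0 <= (x - m) ^+ 2. Proof. exact: sqr_ge0. Qed.
Let yabs2 (x : R) : `|x - m| ^+ 2 = (x - m) ^+ 2.
Proof. by rewrite -normrX ger0_norm. Qed.

Let powers_le (t : R) : 0 <= t -> let q := (1 + t ^+ 2) ^+ 2 in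
  [/\ 1 <= q, t <= q, t ^+ 2 <= q, t ^+ 3 <= q & t ^+ 4 <= q].
Proof.
move=> t0 q; have := sqr_ge0 (t ^+ 2 - t); have := sqr_ge0 (t - 1).
have t2 := sqr_ge0 t; have t4 := sqr_ge0 (t ^+ 2).
have -> : q = 1 + 2 * t ^+ 2 + t ^+ 4 by rewrite /q; ring.
have -> : (t ^+ 2 - t) ^+ 2 = t ^+ 4 - 2 * t ^+ 3 + t ^+ 2 by ring.
have -> : (t - 1) ^+ 2 = t ^+ 2 - 2 * t + 1 by ring.
move: t2 t4; have -> : (t ^+ 2) ^+ 2 = t ^+ 4 by ring.
by move: (t ^+ 2) (t ^+ 3) (t ^+ 4) => a b c *; split; lra.
Qed.

Lemma integral_normal_pdf1 :
  mu.-integrable setT (EFin \o (fun x => (x - m) * normal_pdf m s x)) /\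
  (\int[mu]_x ((x - m) * normal_pdf m s x)%:E = 0)%E.
Proof.
have [|||||i1 i0] := @moment0 (fun x => x - m) (fun x => - v * phi x) (1 + 2 * v).
- by move=> x; apply: continuousB; [exact: cvg_id|exact: cvg_cst].
- exact: dF1.
- move=> x; rewrite -yabs2; have := powers_le (normr_ge0 (x - m)).
  move: ((_ + _) ^+ 2) => q [q0 q1 _ _ _].
  by have := ler_wpM2l (ltW v0) q0; have := v0; lra.
- move=> x; rewrite normrM (ger0_norm (normal_fun_ge0 m s x)) normrN (gtr0_norm v0).
  rewrite mulrAC mulrA; apply: ler_wpM2r; first exact: normal_fun_ge0.
  rewrite -yabs2; have := powers_le (normr_ge0 (x - m)).
  move: ((_ + _) ^+ 2) => q [q0 q1 _ _ _].
  by have := ler_wpM2l (ltW v0) q0; have := ler_wpM2l (ltW v0) q1; have := v0; lra.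
- by have := v0; lra.
- exact: zero_pdf.
Qed.

Lemma integral_normal_pdf2 :
  (\int[mu]_x ((x - m) ^+ 2 * normal_pdf m s x)%:E = v%:E)%E.
Proof.
apply: shift_pdf.
have [|||||i1 i0] := @moment0 (fun x => (x - m) ^+ 2 - v)
  (fun x => - v * ((x - m) * phi x)) (1 + 2 * v).
- by move=> x; apply: cvgB; [exact: cpow|exact: cvg_cst].
- exact: dF2.
- move=> x; have := y2 x; rewrite -yabs2; have := powers_le (normr_ge0 (x - m)).
  move: (`|x - m| : R) => t.
  move: ((1 + t ^+ 2) ^+ 2) (t ^+ 2) => q z [q0 _ q2 _ _] z0.
  by rewrite ler_norml; have := ler_wpM2l (ltW v0) q0; have := v0; lra.
- move=> x; rewrite !normrM (ger0_norm (normal_fun_ge0 m s x)) normrN (gtr0_norm v0).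
  rewrite (mulrA v) mulrAC mulrA; apply: ler_wpM2r; first exact: normal_fun_ge0.
  rewrite -yabs2; have := powers_le (normr_ge0 (x - m)).
  move: (`|x - m| : R) => t.
  move: ((1 + t ^+ 2) ^+ 2) => q [q0 q1 q2 _ _].
  have := ler_wpM2l (ltW v0) q0; have := ler_wpM2l (ltW v0) q1.
  by have := ler_wpM2l (ltW v0) q2; have := v0; lra.
- by have := v0; lra.
- exact: zero_pdf.
Qed.

Lemma integral_normal_pdf4 :
  (\int[mu]_x ((x - m) ^+ 4 * normal_pdf m s x)%:E = (3 * v ^+ 2)%:E)%E.
Proof.
apply: shift_pdf.
have [|||||i1 i0] := @moment0 (fun x => (x - m) ^+ 4 - 3 * v ^+ 2)
  (fun x => - v * ((x - m) ^+ 3 * phi x) + - (3 * v ^+ 2) * ((x - m) * phi x))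
  (1 + 2 * v + 6 * v ^+ 2).
- by move=> x; apply: cvgB; [exact: cpow|exact: cvg_cst].
- exact: dF4.
- move=> x; have -> : (x - m) ^+ 4 = `|x - m| ^+ 4.
    by rewrite -[4%N]/(2 * 2)%N !exprM yabs2.
  have z0 : 0 <= `|x - m| ^+ 4 by rewrite exprn_ge0.
  rewrite -yabs2; have := powers_le (normr_ge0 (x - m)).
  move: (`|x - m| : R) z0 => t.
  move: ((1 + t ^+ 2) ^+ 2) (t ^+ 4) => q z z0 [q0 _ _ _ q4].
  have := ler_wpM2l (ltW v0) q0; have := ler_wpM2l (sqr_ge0 v) q0; have := v0.
  by have := sqr_ge0 v; rewrite ler_norml; lra.
- move=> x.
  apply: (@le_trans _ _ ((v * `|x - m| ^+ 3 + 3 * v ^+ 2 * `|x - m|) * phi x *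
      (1 + `|x - m|))).
    apply: ler_wpM2r; first by rewrite addr_ge0.
    rewrite (le_trans (ler_normD _ _))// [leRHS]mulrDl.
    have ev : `|- v| = v by rewrite normrN gtr0_norm.
    have ev2 : `|- (3 * v ^+ 2)| = 3 * v ^+ 2.
      by rewrite normrN ger0_norm// mulr_ge0// sqr_ge0.
    have ephi : `|phi x| = phi x by rewrite ger0_norm// normal_fun_ge0.
    rewrite (normrM (- v)) (normrM (- (3 * v ^+ 2))) ev ev2.
    rewrite (normrM ((x - m) ^+ 3)) normrX (normrM (x - m)).
    by rewrite ephi !mulrA.
  rewrite mulrAC mulrA; apply: ler_wpM2r; first exact: normal_fun_ge0.
  rewrite -yabs2; have := powers_le (normr_ge0 (x - m)).
  move: (`|x - m| : R) => t.
  move: ((1 + t ^+ 2) ^+ 2) => q [q0 q1 q2 q3 q4].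
  have v2 := sqr_ge0 v.
  have := ler_wpM2l (ltW v0) q0; have := ler_wpM2l v2 q0.
  have := ler_wpM2l (ltW v0) q3; have := ler_wpM2l (ltW v0) q4.
  by have := ler_wpM2l v2 q1; have := ler_wpM2l v2 q2; have := v0; lra.
- by have := v0; have := sqr_ge0 v; lra.
- exact: zero_pdf.
Qed.

End NormalMoments.

Section GaussianLaw.
Context {d : measure_display} {Omega : measurableType d} {R : realType}.
Variable P : probability Omega R.
Notation mu := (@lebesgue_measure R).

Lemma ge0_integral_gaussian_law (X : Omega -> R) (m s : R) (f : R -> \bar R) :
  measurable_fun setT X ->
  (forall A, measurable A -> P (X @^-1` A) = gaussian_law m s A) ->
  measurable_fun setT f -> (forall x, 0 <= f x)%E ->
  (\int[P]_w f (X w) = if (s == 0)%R then f m else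
    \int[mu]_x (f x * (normal_pdf m s x)%:E))%E.
Proof.
move=> mX XA mf f0.
have mX' : @measurable_fun _ _ Omega (measurableTypeR R) setT X by exact: mX.
pose X' : {mfun Omega >-> measurableTypeR R} := HB.pack X (isMeasurableFun.Build _ _ _ _ _ mX').
transitivity (\int[pushforward P X']_x f x)%E.
  by rewrite ge0_integral_pushforward.
have [s0|s0] := eqVneq s 0.
  transitivity (\int[dirac (m : measurableTypeR R)]_x f x)%E.
    apply: eq_measure_integral => A mA _.
    by rewrite -[LHS]/(P (X @^-1` A)) XA// /gaussian_law s0 eqxx.
  by rewrite integral_dirac// diracT mul1e.
transitivity (\int[normal_prob m s]_x f x)%E.
  apply: eq_measure_integral => A mA _.
  by rewrite -[LHS]/(P (X @^-1` A)) XA// /gaussian_law (negbTE s0).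
apply: (@ge0_integral_density _ _ R (normal_prob m s) mu) => //.
- exact: measurable_normal_pdf.
- exact: normal_pdf_ge0.
Qed.

(** The degenerate law [s = 0] has to be treated apart, since it is a Dirac mass
    and has no density. *)
Lemma gaussian_rv_moments (X : Omega -> R) :
  measurable_fun setT X -> gaussian_rv P X ->
  exists m v : R, [/\ P.-integrable setT (EFin \o X),
    (\int[P]_w (X w)%:E = m%:E)%E,
    (\int[P]_w ((X w - m) ^+ 2)%:E = v%:E)%E &
    (\int[P]_w ((X w - m) ^+ 4)%:E = (3 * v ^+ 2)%:E)%E].
Proof.
move=> mX [m [s [_ XA]]].
have T := ge0_integral_gaussian_law mX XA.
have msub : measurable_fun setT (fun x : R => x - m) by exact: measurable_funB.
have mpow k : measurable_fun setT (fun x : R => ((x - m) ^+ k)%:E).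
  by apply/measurable_EFinP; exact: measurable_funX.
have pow2 (x : R) : (0 <= ((x - m) ^+ 2)%:E)%E by rewrite lee_fin sqr_ge0.
have pow4 (x : R) : (0 <= ((x - m) ^+ 4)%:E)%E.
  by rewrite lee_fin -[4%N]/(2 * 2)%N exprM sqr_ge0.
exists m, (s ^+ 2).
have mXm : measurable_fun setT (EFin \o (fun w => X w - m)).
  by apply/measurable_EFinP; exact: measurable_funB.
have mp : measurable_fun setT ((fun x : R => (x - m)%:E)^\+)%E.
  by apply: measurable_funepos; apply/measurable_EFinP.
have mn : measurable_fun setT ((fun x : R => (x - m)%:E)^\-)%E.
  by apply: measurable_funeneg; apply/measurable_EFinP.
have ma : measurable_fun setT (fun x : R => `|x - m|%:E)%E.
  by apply/measurable_EFinP; exact: measurableT_comp.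
have Tp : (\int[P]_w ((fun w => (X w - m)%:E)^\+) w =
           \int[P]_w ((fun x : R => (x - m)%:E)^\+) (X w))%E.
  by apply: eq_integral => w _; rewrite !funeposE.
have Tn : (\int[P]_w ((fun w => (X w - m)%:E)^\-) w =
           \int[P]_w ((fun x : R => (x - m)%:E)^\-) (X w))%E.
  by apply: eq_integral => w _; rewrite !funenegE.
rewrite (T _ mp (fun x => funepos_ge0 _ _)) in Tp.
rewrite (T _ mn (fun x => funeneg_ge0 _ _)) in Tn.
have [ia mean0] : P.-integrable setT (EFin \o (fun w => X w - m)) /\
   (\int[P]_w (X w - m)%:E = 0)%E.
  have [s0|s0] := eqVneq s 0.
    have Ta := T _ ma (fun x => normr_ge0 _); rewrite s0 eqxx subrr normr0 in Ta.
    split; first by apply/integrableP; split => //=; rewrite Ta ?ltry.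
    rewrite integralE Tp Tn.
    by rewrite s0 eqxx funeposE funenegE subrr oppe0 !maxxx subee.
  have [i1 i10] := integral_normal_pdf1 m s0.
  have Ta := T _ ma (fun x => normr_ge0 _); rewrite (negbTE s0) in Ta.
  split.
    apply/integrableP; split => //=; rewrite Ta ?ltry.
    move/integrableP : i1 => [_]; apply: le_lt_trans.
    apply: ge0_le_integral => //.
    - by move=> x _; rewrite -EFinM lee_fin mulr_ge0// normal_pdf_ge0.
    - apply: emeasurable_funM => //.
      by apply/measurable_EFinP; exact: measurable_normal_pdf.
    - apply: measurableT_comp => //; apply/measurable_EFinP.
      by apply: measurable_funM => //; exact: measurable_normal_pdf.
    - move=> x _ /=; rewrite -EFinM lee_fin normrM (ger0_norm (normal_pdf_ge0 _ _ _)).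
      exact: lexx.
  rewrite integralE Tp Tn.
  rewrite (negbTE s0) -i10 [RHS]integralE; congr (_ - _)%E.
  - apply: eq_integral => x _; rewrite !funeposE EFinM maxe_pMl ?mul0e//.
    by rewrite lee_fin normal_pdf_ge0.
  - apply: eq_integral => x _; rewrite !funenegE EFinM -mulNe.
    by rewrite maxe_pMl ?mul0e// lee_fin normal_pdf_ge0.
have XE w : X w = (X w - m) + m by rewrite subrK.
have ic : P.-integrable setT (cst m%:E) by exact: finite_measure_integrable_cst.
split.
- have := integrableD measurableT ia ic; apply: eq_integrable => // w _.
  by rewrite /= -EFinD -XE.
- under eq_integral do rewrite XE EFinD.
  rewrite integralD// mean0 add0e integral_cst//.
  by rewrite [X in (_ * X)%E](_ : _ = 1%E) ?mule1//; exact: probability_setT.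
- rewrite (T (fun x => ((x - m) ^+ 2)%:E))//; case: eqVneq => [->|s0].
    by rewrite subrr expr0n.
  by rewrite -(integral_normal_pdf2 m s0); apply: eq_integral => x _; rewrite EFinM.
- rewrite (T (fun x => ((x - m) ^+ 4)%:E))//; case: eqVneq => [->|s0].
    by rewrite subrr !expr0n/= mulr0.
  by rewrite -(integral_normal_pdf4 m s0); apply: eq_integral => x _; rewrite EFinM.
Qed.

End GaussianLaw.

(** * Gaussian spaces and Isserlis' formula *)

Section HasMean.
Context {d : measure_display} {Omega : measurableType d} {R : realType}.
Variable P : probability Omega R.

(** Integrability and value of the integral are kept together, so that the
    relation is closed under linear combinations without side conditions. *)
Definition has_mean (f : Omega -> R) (m : R) : Prop :=
  P.-integrable setT (EFin \o f) /\ (\int[P]_w (f w)%:E = m%:E)%E.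

Lemma has_mean_unique f m n : has_mean f m -> has_mean f n -> m = n.
Proof. by move=> [_ fm] [_]; rewrite fm => -[]. Qed.

Lemma eq_has_mean f g m : f =1 g -> has_mean f m -> has_mean g m.
Proof. by move=> /funext ->. Qed.

Lemma has_mean_lin f g m n (a b : R) : has_mean f m -> has_mean g n ->
  has_mean (fun w => a * f w + b * g w) (a * m + b * n).
Proof.
move=> [fi fm] [gi gn].
have afi := integrableZl measurableT a fi; have bgi := integrableZl measurableT b gi.
split.
  by have := integrableD measurableT afi bgi; apply: eq_integrable.
under eq_integral do rewrite EFinD !EFinM.
rewrite integralD//.
by rewrite !integralZl// fm gn.
Qed.

Lemma has_mean_cst (c : R) : has_mean (fun=> c) c.
Proof.
split; first exact: finite_measure_integrable_cst.
by rewrite integral_cst// [X in (_ * X)%E](_ : _ = 1%E) ?mule1//; exact: probability_setT.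
Qed.

Lemma has_mean_scale f m (a : R) : has_mean f m -> has_mean (fun w => a * f w) (a * m).
Proof.
move=> fm; have := has_mean_lin a 0 fm fm; rewrite mul0r addr0.
by apply: eq_has_mean => w; rewrite mul0r addr0.
Qed.

Lemma has_mean_sum n (f : nat -> Omega -> R) (m : nat -> R) :
  (forall i, (i < n)%N -> has_mean (f i) (m i)) ->
  has_mean (fun w => \sum_(0 <= i < n) f i w) (\sum_(0 <= i < n) m i).
Proof.
elim: n => [_|n IHn fm].
  rewrite big_geq//; have := has_mean_cst 0; apply: eq_has_mean => w.
  by rewrite big_geq.
have IH : has_mean (fun w => \sum_(0 <= i < n) f i w) (\sum_(0 <= i < n) m i).
  by apply: IHn => i ni; apply: fm; rewrite ltnS ltnW.
have := has_mean_lin 1 1 IH (fm n (ltnSn n)).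
rewrite big_nat_recr//= !mul1r; apply: eq_has_mean => w.
by rewrite big_nat_recr//= !mul1r.
Qed.

Lemma has_mean_dominated (f g : Omega -> R) m : measurable_fun setT f -> has_mean g m ->
  (forall w, `|f w| <= g w) -> exists n, has_mean f n.
Proof.
move=> mf [gi gm] fg.
have fi : P.-integrable setT (EFin \o f).
  apply: (le_integrable measurableT _ _ gi); first exact/measurable_EFinP.
  move=> w _ /=; rewrite lee_fin (le_trans (fg w))// ler_norm//.
exists (fine (\int[P]_w (f w)%:E)); split => //.
by rewrite fineK//; exact: integrable_fin_num.
Qed.

Lemma has_mean_le f g m n : has_mean f m -> has_mean g n ->
  (forall w, f w <= g w) -> m <= n.
Proof.
move=> [fi fm] [gi gn] fg; rewrite -lee_fin -fm -gn.
by apply: le_integral => // w _; rewrite lee_fin.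
Qed.

End HasMean.

Section GaussianSpace.
Context {d : measure_display} {Omega : measurableType d} {R : realType}.
Variable P : probability Omega R.

(** Models a linear space of centered Gaussian variables, of which only the relation
    between the second and the fourth moment is recorded: by polarization this
    already determines all the moments used below. *)
Record gaussian_space (V : set (Omega -> R)) : Prop := GaussianSpace {
  gaussian_space_measurable : forall X, V X -> measurable_fun setT X ;
  gaussian_space_moments : forall X, V X -> exists v : R,
    has_mean P (fun w => X w ^+ 2) v /\ has_mean P (fun w => X w ^+ 4) (3 * v ^+ 2) ;
  gaussian_space_lin : forall X Y (a b : R), V X -> V Y ->
    V (fun w => a * X w + b * Y w) }.

Definition cov (X Y : Omega -> R) : R := \int[P]_w (X w * Y w).

Variable V : set (Omega -> R).
Hypothesis gV : gaussian_space V.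

Lemma has_mean_prod2 X Y : V X -> V Y -> has_mean P (fun w => X w * Y w) (cov X Y).
Proof.
move=> VX VY.
have [v [X2 _]] := gaussian_space_moments gV VX.
have [u [Y2 _]] := gaussian_space_moments gV VY.
have [||n [ni nE]] := has_mean_dominated (f := fun w => X w * Y w) _ (has_mean_lin 1 1 X2 Y2).
- by apply: measurable_funM; exact: (gaussian_space_measurable gV).
- move=> w; rewrite !mul1r ler_norml.
  have := sqr_ge0 (X w + Y w); have := sqr_ge0 (X w - Y w).
  have := sqr_ge0 (X w); have := sqr_ge0 (Y w).
  by move: (X w) (Y w) => x y; lra.
- by rewrite /cov /Rintegral nE.
Qed.

Lemma covC X Y : cov X Y = cov Y X.
Proof. by rewrite /cov; under eq_Rintegral do rewrite mulrC. Qed.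

Lemma cov_linl X Y Z (a b : R) : V X -> V Y -> V Z ->
  cov (fun w => a * X w + b * Y w) Z = a * cov X Z + b * cov Y Z.
Proof.
move=> VX VY VZ.
have /has_mean_unique := has_mean_prod2 (gaussian_space_lin gV a b VX VY) VZ.
apply.
have := has_mean_lin a b (has_mean_prod2 VX VZ) (has_mean_prod2 VY VZ).
by apply: eq_has_mean => w; ring.
Qed.

Lemma cov_linr X Y Z (a b : R) : V X -> V Y -> V Z ->
  cov Z (fun w => a * X w + b * Y w) = a * cov Z X + b * cov Z Y.
Proof. by move=> VX VY VZ; rewrite covC cov_linl// !(covC Z). Qed.

Lemma has_mean_pow4 X : V X -> has_mean P (fun w => X w ^+ 4) (3 * cov X X ^+ 2).
Proof.
move=> VX; have [v [X2 X4]] := gaussian_space_moments gV VX.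
by rewrite (has_mean_unique (has_mean_prod2 VX VX) X2).
Qed.

(** Polarization: the fourth moments of [X1 +- X2 +- X3 +- X4], each three times
    the square of a variance, are combined with the signs that isolate the
    monomial [X1 X2 X3 X4], whose coefficient is then [8 * 24 = 192]. *)
Lemma isserlis X1 X2 X3 X4 : V X1 -> V X2 -> V X3 -> V X4 ->
  has_mean P (fun w => X1 w * X2 w * X3 w * X4 w)
    (cov X1 X2 * cov X3 X4 + cov X1 X3 * cov X2 X4 + cov X1 X4 * cov X2 X3).
Proof.
move=> V1 V2 V3 V4.
pose L (e2 e3 e4 : R) w := 1 * (1 * (1 * X1 w + e2 * X2 w) + e3 * X3 w) + e4 * X4 w.
pose Q (e2 e3 e4 : R) := cov X1 X1 + e2 ^+ 2 * cov X2 X2 + e3 ^+ 2 * cov X3 X3 +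
  e4 ^+ 2 * cov X4 X4 + 2 * (e2 * cov X1 X2 + e3 * cov X1 X3 + e4 * cov X1 X4 +
  e2 * e3 * cov X2 X3 + e2 * e4 * cov X2 X4 + e3 * e4 * cov X3 X4).
have H e2 e3 e4 : has_mean P (fun w => L e2 e3 e4 w ^+ 4) (3 * Q e2 e3 e4 ^+ 2).
  have V12 := gaussian_space_lin gV 1 e2 V1 V2.
  have V123 := gaussian_space_lin gV 1 e3 V12 V3.
  have V1234 := gaussian_space_lin gV 1 e4 V123 V4.
  have := has_mean_pow4 V1234.
  rewrite !(cov_linl, cov_linr)//.
  rewrite (covC X2 X1) (covC X3 X1) (covC X4 X1) (covC X3 X2) (covC X4 X2) (covC X4 X3).
  by congr has_mean; rewrite /Q; ring.
have A3 e2 e3 := has_mean_lin 1 (- 1) (H e2 e3 1) (H e2 e3 (- 1)).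
have A2 e2 := has_mean_lin 1 (- 1) (A3 e2 1) (A3 e2 (- 1)).
have A1 := has_mean_scale (192%:R^-1) (has_mean_lin 1 (- 1) (A2 1) (A2 (- 1))).
rewrite (_ : cov X1 X2 * _ + _ + _ = 192^-1 *
   (1 * (1 * (1 * (3 * Q 1 1 1 ^+ 2) + -1 * (3 * Q 1 1 (-1) ^+ 2)) +
         -1 * (1 * (3 * Q 1 (-1) 1 ^+ 2) + -1 * (3 * Q 1 (-1) (-1) ^+ 2))) +
    -1 * (1 * (1 * (3 * Q (-1) 1 1 ^+ 2) + -1 * (3 * Q (-1) 1 (-1) ^+ 2)) +
         -1 * (1 * (3 * Q (-1) (-1) 1 ^+ 2) + -1 * (3 * Q (-1) (-1) (-1) ^+ 2))))).
  by move: A1; apply: eq_has_mean => w; rewrite /L; field.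
by rewrite /Q; field.
Qed.

(** The pairing of [X k] with [W k] and of [X l] with [W l] in Isserlis' formula
    produces the square of the mean; the two other pairings give the variance. *)
Lemma second_moment_bilinear n (X W : nat -> Omega -> R) (q c : R) :
  (forall k, V (X k)) -> (forall k, V (W k)) ->
  has_mean P (fun w => (q * (\sum_(0 <= k < n) X k w * W k w) - c) ^+ 2)
    (q ^+ 2 * \sum_(0 <= k < n) \sum_(0 <= l < n)
        (cov (X k) (X l) * cov (W k) (W l) + cov (X k) (W l) * cov (X l) (W k)) +
     (q * \sum_(0 <= k < n) cov (X k) (W k) - c) ^+ 2).
Proof.
move=> VX VW.
have m1 : has_mean P (fun w => \sum_(0 <= k < n) X k w * W k w)
                     (\sum_(0 <= k < n) cov (X k) (W k)).
  by apply: has_mean_sum => k _; apply: has_mean_prod2.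
have m2 : has_mean P
    (fun w => \sum_(0 <= k < n) \sum_(0 <= l < n) (X k w * W k w * X l w * W l w))
    (\sum_(0 <= k < n) \sum_(0 <= l < n) (cov (X k) (W k) * cov (X l) (W l) +
       cov (X k) (X l) * cov (W k) (W l) + cov (X k) (W l) * cov (W k) (X l))).
  by apply: has_mean_sum => k _; apply: has_mean_sum => l _; apply: isserlis.
have := has_mean_lin 1 1 (has_mean_lin (q ^+ 2) (- (2 * q * c)) m2 m1)
  (has_mean_cst P (c ^+ 2)).
set S := \sum_(0 <= k < n) cov (X k) (W k).
have dbl (a b : nat -> R) : \sum_(0 <= k < n) \sum_(0 <= l < n) (a k * b l) =
    (\sum_(0 <= k < n) a k) * (\sum_(0 <= l < n) b l).
  by rewrite big_distrl/=; apply: eq_bigr => k _; rewrite big_distrr.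
have -> : \sum_(0 <= k < n) \sum_(0 <= l < n) (cov (X k) (W k) * cov (X l) (W l) +
       cov (X k) (X l) * cov (W k) (W l) + cov (X k) (W l) * cov (W k) (X l)) =
   S * S + \sum_(0 <= k < n) \sum_(0 <= l < n)
        (cov (X k) (X l) * cov (W k) (W l) + cov (X k) (W l) * cov (X l) (W k)).
  rewrite -dbl -big_split/=; apply: eq_bigr => k _; rewrite -big_split/=.
  by apply: eq_bigr => l _; rewrite (covC (W k) (X l)) addrA.
set D := \sum_(0 <= k < n) \sum_(0 <= l < n) _.
rewrite (_ : 1 * _ + _ = q ^+ 2 * D + (q * S - c) ^+ 2); last by ring.
apply: eq_has_mean => w.
have -> : \sum_(0 <= k < n) \sum_(0 <= l < n) (X k w * W k w * X l w * W l w) =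
  (\sum_(0 <= k < n) X k w * W k w) * (\sum_(0 <= k < n) X k w * W k w).
  by rewrite -dbl; apply: eq_bigr => k _; apply: eq_bigr => l _; rewrite !mulrA.
by ring.
Qed.

End GaussianSpace.

Section GaussianSpan.
Context {d : measure_display} {Omega : measurableType d} {R : realType}.
Variable P : probability Omega R.
Context {I : Type}.
Variable G : I -> Omega -> R.

Definition process_span : set (Omega -> R) :=
  [set X | exists (n : nat) (a : 'I_n -> R) (t : 'I_n -> I),
     X = (fun w => \sum_(i < n) a i * G (t i) w)].

Lemma process_span_mem i : process_span (G i).
Proof.
exists 1%N, (fun=> 1), (fun=> i); apply/funext => w.
by rewrite big_ord1 mul1r.
Qed.

Lemma process_span_lin X Y (a b : R) : process_span X -> process_span Y ->
  process_span (fun w => a * X w + b * Y w).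
Proof.
move=> [n [x [t ->]]] [m [y [u ->]]].
exists (n + m)%N, (fun k => match fintype.split k with inl i => a * x i | inr j => b * y j end),
  (fun k => match fintype.split k with inl i => t i | inr j => u j end).
apply/funext => w; rewrite big_split_ord/= !mulr_sumr; congr (_ + _).
- apply: eq_bigr => i _; rewrite (unsplitK (inl i : 'I_n + 'I_m)).
  by rewrite mulrA.
- apply: eq_bigr => i _; rewrite (unsplitK (inr i : 'I_n + 'I_m)).
  by rewrite mulrA.
Qed.

Hypothesis mG : forall i, measurable_fun setT (G i).
Hypothesis gG : gaussian_process P G.
Hypothesis cG : centered_process P G.

Let measurable_span X : process_span X -> measurable_fun setT X.
Proof.
move=> [n [a [t ->]]]; apply: measurable_sum => i.
by apply: measurable_funM.
Qed.

Lemma process_span_gaussian : gaussian_space P process_span.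
Proof.
have mean0 i : has_mean P (G i) 0.
  have [n [a [t E]]] := process_span_mem i.
  have gGi : gaussian_rv P (G i) by rewrite E; exact: gG.
  have [m [v [iG meanG _ _]]] := gaussian_rv_moments (mG i) gGi.
  by split => //; have := cG i; rewrite unlock.
split; [exact: measurable_span| |exact: process_span_lin].
move=> X VX; have [n [a [t E]]] := VX.
have gX : gaussian_rv P X by rewrite E; exact: gG.
have [m [v [iX meanX X2 X4]]] := gaussian_rv_moments (measurable_span VX) gX.
have X0 : has_mean P X 0.
  rewrite E [X in has_mean _ _ X](_ : 0 = \sum_(0 <= i < n) 0); last by rewrite big1.
  have [n0|n0] := posnP n.
    have := has_mean_cst P (\sum_(0 <= i < n) 0); apply: eq_has_mean => w.
    by rewrite big1// big1// => i _; have := ltn_ord i; rewrite [X in (_ < X)%N]n0.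
  pose i0 : 'I_n := Ordinal n0.
  have := @has_mean_sum _ _ _ P n
    (fun k w => a (insubd i0 k) * G (t (insubd i0 k)) w) (fun=> 0).
  have -> : (fun w => \sum_(0 <= i < n) a (insubd i0 i) * G (t (insubd i0 i)) w) =
            (fun w => \sum_(i < n) a i * G (t i) w).
    apply/funext => w; rewrite big_mkord; apply: eq_bigr => i _.
    by rewrite valKd.
  move=> H; apply: H => k _.
  by rewrite -[X in has_mean _ _ X](mulr0 (a (insubd i0 k))); exact: has_mean_scale.
have m0 : m = 0 by case: X0 => _; rewrite meanX => -[].
have mpow k : measurable_fun setT (fun w => X w ^+ k).
  by apply: measurable_funX; exact: measurable_span.
exists v; split.
- have X2' : (\int[P]_w (X w ^+ 2)%:E = v%:E)%E.
    by rewrite -X2; apply: eq_integral => w _; rewrite m0 subr0.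
  split => //; apply/integrableP; split; first exact/measurable_EFinP.
  under eq_integral do rewrite /= ger0_norm ?sqr_ge0//.
  by rewrite X2' ltry.
- have X4' : (\int[P]_w (X w ^+ 4)%:E = (3 * v ^+ 2)%:E)%E.
    by rewrite -X4; apply: eq_integral => w _; rewrite m0 subr0.
  split => //; apply/integrableP; split; first exact/measurable_EFinP.
  under eq_integral do rewrite /= ger0_norm ?(exprn_even_ge0 _ (isT : ~~ odd 4))//.
  by rewrite X4' ltry.
Qed.

End GaussianSpan.

(** * Averages under an exponential law *)

Section ExponentialLaw.
Context {R : realType}.
Variable a : R.
Hypothesis a0 : 0 < a.
Notation mu := (@lebesgue_measure R).

Definition exponential_law : probability (measurableTypeR R) R :=
  exponential_distribution_exponential_prob__canonical__probability_measure_Probability a0.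

Lemma ge0_integral_exponential (f : R -> \bar R) :
  measurable_fun setT f -> (forall x, 0 <= f x)%E ->
  (\int[exponential_law]_x f x = \int[mu]_x (f x * (exponential_pdf a x)%:E))%E.
Proof.
move=> mf f0; apply: (@ge0_integral_density _ _ R exponential_law mu) => //.
- exact: measurable_exponential_pdf.
- by move=> x; exact/exponential_pdf_ge0/ltW.
Qed.

Lemma exponential_law_null (A : set R) : measurable A -> mu A = 0%E -> exponential_law A = 0%E.
Proof.
move=> mA A0; rewrite /= /exponential_prob.
apply: null_set_integral => //; apply/measurable_funTS/measurable_EFinP.
exact: measurable_exponential_pdf.
Qed.

Lemma ae_exponential_neq (x : R) : {ae exponential_law, forall s, s != x}.
Proof.
exists [set x]; split => //.
- by apply: exponential_law_null => //; exact: lebesgue_measure_set1.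
- by move=> s /= /negP; rewrite negbK => /eqP.
Qed.

Lemma ae_exponential_gt0 : {ae exponential_law, forall s, 0 < s}.
Proof.
have : {ae exponential_law, forall s, s != 0} by exact: ae_exponential_neq.
have : {ae exponential_law, forall s, 0 <= s}.
  exists `]-oo, 0[%classic; split => //.
    rewrite /= /exponential_prob; apply: integral0_eq => x.
    by rewrite /= in_itv/= => x0; rewrite lt0_exponential_pdf.
  by move=> s /= /negP; rewrite -ltNge in_itv.
have F := ae_filter_ringOfSetsType exponential_law.
by apply: filterS2 => s s0 sn0; rewrite lt_def sn0.
Qed.

(** The density of rate [a] times [1 + s ^+ 2] is dominated by a multiple of the
    density of rate [a / 2]. *)
Lemma exponential_moment2 : (\int[exponential_law]_s (1 + s ^+ 2)%:E < +oo)%E.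
Proof.
rewrite ge0_integral_exponential; last 2 first.
- by apply/measurable_EFinP; apply: measurable_funD => //; exact: measurable_funX.
- by move=> x; rewrite lee_fin addr_ge0// sqr_ge0.
have b0 : 0 < a / 2 by rewrite divr_gt0.
pose K := 2 * (1 + 16 / a ^+ 2).
have K0 : 0 <= K by rewrite mulr_ge0// addr_ge0// divr_ge0// sqr_ge0.
apply: (@le_lt_trans _ _ (\int[mu]_s (K%:E * (exponential_pdf (a / 2) s)%:E))%E).
  apply: ge0_le_integral => //.
  - move=> x _; rewrite -EFinM lee_fin mulr_ge0 ?addr_ge0 ?sqr_ge0//.
    exact/exponential_pdf_ge0/ltW.
  - apply/measurable_EFinP; apply: measurable_funM; last exact: measurable_exponential_pdf.
    by apply: measurable_funD => //; exact: measurable_funX.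
  - apply/measurable_EFinP; apply: measurable_funM => //; exact: measurable_exponential_pdf.
  - move=> s _; rewrite -!EFinM lee_fin.
    have [s0|s0] := ltP s 0; first by rewrite !lt0_exponential_pdf ?mulr0.
    rewrite !exponential_pdfE//.
    have eE : expR (- a * s) = expR (- (a / 2) * s) * expR (- (a / 2) * s).
      by rewrite -expRD; congr expR; lra.
    set w := expR (- (a / 2) * s) in eE *.
    have w0 : 0 < w by exact: expR_gt0.
    (* 1 + s^2 <= (1 + 16/a^2) (1 + (a s/4))^2 and 1 + x <= e^x *)
    have ww : w * (1 + a * s / 4) ^+ 2 <= 1.
      have e4 : 1 + a * s / 4 <= expR (a * s / 4) by exact: expR_ge1Dx.
      have as0 : 0 <= a * s by rewrite mulr_ge0// ltW.
      have h4 : (1 + a * s / 4) ^+ 2 <= expR (a * s / 4) ^+ 2.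
        apply: lerXn2r => //; rewrite nnegrE ?expR_ge0//; lra.
      have := ler_wpM2l (ltW w0) h4.
      suff -> : w * expR (a * s / 4) ^+ 2 = 1 by [].
      by rewrite expr2 -!expRD -[RHS]expR0; congr expR; lra.
    have poly : 1 + s ^+ 2 <= (1 + 16 / a ^+ 2) * (1 + a * s / 4) ^+ 2.
      have -> : (1 + 16 / a ^+ 2) * (1 + a * s / 4) ^+ 2 = 1 + s ^+ 2 +
          (a * s / 2 + (a * s) ^+ 2 / 16 + 16 / a ^+ 2 + 8 * s / a).
        by field; rewrite gt_eqF.
      rewrite lerDl !addr_ge0//.
      + by rewrite divr_ge0// mulr_ge0// ltW.
      + by rewrite divr_ge0// sqr_ge0.
      + by rewrite divr_ge0// sqr_ge0.
      + by rewrite divr_ge0 ?mulr_ge0// ltW.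
    have K1 : 0 <= 1 + 16 / a ^+ 2 by rewrite addr_ge0// divr_ge0// sqr_ge0.
    rewrite eE /K (_ : _ * (a * _) = (a * w) * (w * (1 + s ^+ 2))); last by ring.
    rewrite (_ : _ * (a / 2 * w) = (a * w) * (1 + 16 / a ^+ 2)); last by field; rewrite ?gt_eqF.
    apply: ler_wpM2l; first by rewrite mulr_ge0// ltW.
    apply: (le_trans (ler_wpM2l (ltW w0) poly)).
    rewrite mulrCA -[leRHS]mulr1; exact: ler_wpM2l.
rewrite integralZl//; last exact: integrable_exponential_pdf.
by rewrite integral_exponential_pdf// mule1 ltry.
Qed.

(** The substitution [u = t - s]; the kernel is [a^-1] times the density. *)
Lemma integral_past_exponential (G : R -> R) (t : R) :
  continuous G -> (forall u, 0 <= G u) ->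
  (\int[mu]_(u in `]-oo, t]) (G u * expR (- a * (t - u)))%:E =
   \int[exponential_law]_s (a^-1 * G (t - s))%:E)%E.
Proof.
move=> cG G0.
have ct : continuous (fun s : R => t - s).
  by move=> s; apply: cvgB; [exact: cvg_cst|exact: cvg_id].
have cGt : continuous (fun s : R => G (t - s)).
  by move=> s; apply: (@continuous_comp _ _ _ (fun s => t - s) G); [exact: ct|exact: cG].
have mGt : measurable_fun setT (fun s : R => G (t - s)) by exact: continuous_measurable_fun.
have cH : continuous (fun u : R => G u * expR (- a * (t - u))).
  move=> u; apply: cvgM; first exact: cG.
  apply: (@continuous_comp _ _ _ (fun u => - a * (t - u)) expR).
    by apply: cvgM; [exact: cvg_cst|exact: ct].
  exact: continuous_expR.
have dF (x : R) : is_derive x 1 (fun s : R => t - s) (- 1).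
  by apply: is_derive_eq; rewrite add0r mul1r.
have F' : (fun s : R => t - s)^`()%classic = cst (-1).
  by apply/funext => y; rewrite derive1E; case: (dF y).
have := @decreasing_ge0_integration_by_substitutiony R (fun s => t - s)
   (fun u => G u * expR (- a * (t - u))) 0.
rewrite subr0 F' => ->; last 8 first.
- by move=> x y _ _ xy; lra.
- by move=> x _; exact: cvg_cst.
- exact: is_cvg_cst.
- exact: is_cvg_cst.
- split; first by move=> x _; case: (dF x).
  by apply: cvg_at_right_filter; exact: ct.
- have -> : (fun s : R => t - s) = - (fun s : R => s + - t).
    by apply/funext => s; rewrite fctE opprB addrC.
  by apply/cvgNrNy; exact: cvg_addrr.
- exact: continuous_subspaceT.
- by move=> x _; rewrite mulr_ge0// expR_ge0.
rewrite ge0_integral_exponential; last 2 first.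
- by apply/measurable_EFinP; exact: measurable_funM.
- by move=> x; rewrite lee_fin mulr_ge0// invr_ge0 ltW.
rewrite integral_mkcond; apply: eq_integral => s _.
rewrite patchE; case: ifPn => [|].
  rewrite inE/= in_itv/= andbT => s0; rewrite exponential_pdfE// -EFinM.
  congr EFin; rewrite !fctE/= opprK mulr1 (_ : t - (t - s) = s); last by ring.
  rewrite (_ : a^-1 * _ * _ = (a^-1 * a) * (G (t - s) * expR (- a * s))); last by ring.
  by rewrite mulVf ?mul1r// gt_eqF.
rewrite notin_setE/= in_itv/= andbT => /negP; rewrite -ltNge => s0.
by rewrite lt0_exponential_pdf// mule0.
Qed.

End ExponentialLaw.

Section JointMeasurability.
Context {d : measure_display} {Omega : measurableType d} {R : realType}.

(** The process is the pointwise limit of its discretizations in time, each of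
    which is measurable as a countable union of rectangles. *)
Lemma measurable_continuous_process (X : R -> Omega -> R) :
  (forall t, measurable_fun setT (X t)) ->
  (forall w, continuous (fun t => X t w)) ->
  measurable_fun setT (fun z : measurableTypeR R * Omega => X z.1 z.2).
Proof.
move=> mX cX.
pose grid (n : nat) (s : R) : R := (Num.floor (s * n.+1%:R))%:~R / n.+1%:R.
apply: (@measurable_fun_cvg _ _ _ _ (fun n z => X (grid n z.1) z.2)).
- move=> n _ B mB; rewrite setTI.
  have N0 : 0 < n.+1%:R :> R by [].
  have -> : (fun z : measurableTypeR R * Omega => X (grid n z.1) z.2) @^-1` B =
      \bigcup_(k : int) (`[k%:~R / n.+1%:R, (k + 1)%:~R / n.+1%:R[ `*`
                         (X (k%:~R / n.+1%:R) @^-1` B)).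
    apply/seteqP; split => [[s w] /= sB|[s w] [k _] /= [+ wB]].
      exists (Num.floor (s * n.+1%:R)) => //; split => //=.
      rewrite in_itv/= ler_pdivrMr// ltr_pdivlMr//.
      by rewrite floor_le_tmp floorD1_gt.
    rewrite in_itv/= ler_pdivrMr// ltr_pdivlMr// => ks.
    by rewrite /grid (@floor_def _ _ k).
  apply: countable_bigcupT_measurable => [|k]; first exact: countableP.
  apply: measurableX; first exact: measurable_itv.
  by rewrite -[X in measurable X]setTI; exact: mX.
- move=> [s w] _ /=.
  apply: (@cvg_comp _ _ _ (fun n => grid n s) (fun t => X t w) \oo (nbhs s)); last exact: cX.
  apply/cvgrPdist_le => e e0; near=> n.
  have N0 : 0 < n.+1%:R :> R by [].
  have eN : e^-1 <= n.+1%:R.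
    apply: (@le_trans _ _ n%:R); last by rewrite ler_nat.
    by near: n; exact: nbhs_infty_ger.
  have /andP[z1 z2] := floor_itv (s * n.+1%:R).
  move: z1 z2; rewrite /grid intrD; set z := _%:~R => z1 z2.
  rewrite (_ : s - z / n.+1%:R = (s * n.+1%:R - z) / n.+1%:R); last first.
    by rewrite mulrBl mulfK// gt_eqF.
  rewrite ger0_norm ?divr_ge0 ?subr_ge0// ler_pdivrMr//.
  have : 1 <= e * n.+1%:R by rewrite -ler_pdivrMl// mulr1.
  by move=> ?; lra.
Unshelve. all: end_near. Qed.

End JointMeasurability.
Section MeanSquare.
Context {d : measure_display} {Omega : measurableType d} {R : realType}.
Variable P : probability Omega R.
Implicit Types f g : Omega -> R.

Definition mean_square f : \bar R := (\int[P]_w (f w ^+ 2)%:E)%E.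

Lemma mean_square_ge0 f : (0 <= mean_square f)%E.
Proof. by apply: integral_ge0 => w _; rewrite lee_fin sqr_ge0. Qed.

Lemma has_mean_square f m : has_mean P (fun w => f w ^+ 2) m -> mean_square f = m%:E.
Proof. by case. Qed.

Let msqr f : measurable_fun setT f -> measurable_fun setT (fun w => (f w ^+ 2)%:E).
Proof. by move=> mf; apply/measurable_EFinP; exact: measurable_funX. Qed.

Let sqr0 f w : (0 <= (f w ^+ 2)%:E)%E. Proof. by rewrite lee_fin sqr_ge0. Qed.

Lemma mean_squareD f g : measurable_fun setT f -> measurable_fun setT g ->
  (mean_square (fun w => f w + g w)%R <= 2%:E * (mean_square f + mean_square g))%E.
Proof.
move=> mf mg; rewrite /mean_square -ge0_integralD//; [|exact: msqr|exact: msqr].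
rewrite -ge0_integralZl//; [|by apply: emeasurable_funD; exact: msqr|]; last first.
  by move=> w _; rewrite -EFinD lee_fin addr_ge0// sqr_ge0.
apply: ge0_le_integral => //.
- by move=> w _; rewrite lee_fin sqr_ge0.
- by apply: msqr; exact: measurable_funD.
- by apply: emeasurable_funM => //; apply: emeasurable_funD; exact: msqr.
- move=> w _; rewrite -EFinD -EFinM lee_fin.
  by have := sqr_ge0 (f w - g w); move: (f w) (g w) => x y; nra.
Qed.

Lemma mean_squareZ (a : R) f : measurable_fun setT f ->
  mean_square (fun w => a * f w) = ((a ^+ 2)%:E * mean_square f)%E.
Proof.
move=> mf; rewrite /mean_square -ge0_integralZl//.
- by apply: eq_integral => w _; rewrite exprMn EFinM.
- exact: msqr.
- by rewrite lee_fin sqr_ge0.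
Qed.

End MeanSquare.

Section Jensen.
Context {R : realType}.

(** Expand the mean of the nonnegative function [(f - c) ^+ 2]. *)
Lemma sqr_mean_le {d} {T : measurableType d} (mu : probability T R) (f : T -> R) (c : R) :
  has_mean mu f c -> ((c ^+ 2)%:E <= mean_square mu f)%E.
Proof.
move=> [fi fc].
have mf : measurable_fun setT f by apply/measurable_EFinP; exact: measurable_int fi.
have mf2 : measurable_fun setT (EFin \o (fun x => f x ^+ 2)).
  by apply/measurable_EFinP; exact: measurable_funX.
have := mean_square_ge0 mu f.
case E : (mean_square mu f) => [m| |//] _; last by rewrite leey.
have h2 : has_mean mu (fun x => f x ^+ 2) m.
  split; last exact: E.
  apply/integrableP; split => //.
  under eq_integral do rewrite /= ger0_norm ?sqr_ge0//.
  by rewrite -/(mean_square mu f) E ltry.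
have h := has_mean_lin 1 1 (has_mean_lin 1 (- (2 * c)) h2 (conj fi fc))
  (has_mean_cst mu (c ^+ 2)).
rewrite lee_fin.
have := has_mean_le (has_mean_cst mu 0) h.
move=> /(_ _)/[!mul1r]; suff -> : m + - (2 * c) * c + c ^+ 2 = m - c ^+ 2.
  rewrite subr_ge0; apply => x.
  by rewrite !mul1r; have := sqr_ge0 (f x - c); rewrite sqrrB; lra.
by ring.
Qed.

Context {d : measure_display} {Omega : measurableType d}.
Variable P : probability Omega R.

(** Jensen's inequality for each [w], then the theorem of Tonelli. *)
Lemma mean_square_average (mu : probability (measurableTypeR R) R)
    (F : R -> Omega -> R) (Y : Omega -> R) :
  measurable_fun setT (fun z : measurableTypeR R * Omega => F z.1 z.2) ->
  measurable_fun setT Y ->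
  {ae P, forall w, has_mean mu (fun s => F s w) (Y w)} ->
  (mean_square P Y <= \int[mu]_s mean_square P (F s))%E.
Proof.
move=> mF mY FY.
pose F2 (z : measurableTypeR R * Omega) := (F z.1 z.2 ^+ 2)%:E.
have mF2 : measurable_fun setT F2 by apply/measurable_EFinP; exact: measurable_funX.
have F20 z : (0 <= F2 z)%E by rewrite lee_fin sqr_ge0.
rewrite [leRHS](@fubini_tonelli _ _ _ _ _ mu P F2)//.
apply: ae_ge0_le_integral => //.
- by move=> w _; rewrite lee_fin sqr_ge0.
- by apply/measurable_EFinP; exact: measurable_funX.
- by move=> w _; exact: integral_ge0.
- exact: measurable_fun_fubini_tonelli_G.
- have Fae := ae_filter_ringOfSetsType P.
  by move: FY; apply: filterS => w FYw _; exact: (sqr_mean_le FYw).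
Qed.

End Jensen.

(** * The Ornstein-Uhlenbeck process as an average of lagged increments *)

Section OrnsteinUhlenbeck.
Context {d : measure_display} {Omega : measurableType d} {R : realType}.
Variable P : probability Omega R.
Variables (alpha nu : R) (B : R -> {RV P >-> R}) (K : R).
Hypothesis alpha0 : 0 < alpha.
Hypothesis cB : continuous_paths (fun t => B t : Omega -> R).
Hypothesis K0 : 0 <= K.
Hypothesis BK : forall u, (mean_square P (B u) <= (K * (1 + u ^+ 2))%:E)%E.
Notation mu := (@lebesgue_measure R).
Notation law := (exponential_law alpha0).
Variable t : R.

Let mB (u : R) : measurable_fun setT (B u).
Proof. exact: measurable_funP. Qed.

Let past (z : measurableTypeR R * Omega) : \bar R := (alpha^-1 * B (t - z.1) z.2)%:E.

Lemma measurable_lag (X : R -> Omega -> R) : (forall u, measurable_fun setT (X u)) ->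
  (forall w, continuous (fun u => X u w)) ->
  measurable_fun setT (fun z : measurableTypeR R * Omega => X (t - z.1) z.2).
Proof.
move=> mX cX; apply: (@measurable_continuous_process _ _ _ (fun s w => X (t - s) w)).
  by move=> s; exact: mX.
move=> w s; apply: (@continuous_comp _ _ _ (fun s => t - s) (fun u => X u w)).
  by apply: cvgB; [exact: cvg_cst|exact: cvg_id].
exact: cX.
Qed.

Let mpast : measurable_fun setT past.
Proof.
apply/measurable_EFinP; apply: measurable_funM => //.
by apply: (@measurable_lag (fun u => B u)) => // w; exact: cB.
Qed.

(** The variance of [B (t - s)] grows at most quadratically in [s], whereas the
    exponential law has a second moment. *)
Let ipast : (law \x P)%E.-integrable setT past.
Proof.
apply/integrable12ltyP => //.
have msq : measurable_fun setT (fun s : measurableTypeR R => (1 + s ^+ 2)%:E).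
  apply/measurable_EFinP; apply: measurable_funD; first exact: measurable_cst.
  by apply: measurable_funX; exact: measurable_id.
have C0 : 0 <= alpha^-1 * (1 + K * (2 + 2 * t ^+ 2)).
  by rewrite mulr_ge0 ?invr_ge0 ?ltW// ltr_wpDr// mulr_ge0// addr_ge0// mulr_ge0// sqr_ge0.
apply: (@le_lt_trans _ _ (\int[law]_s ((alpha^-1 * (1 + K * (2 + 2 * t ^+ 2)))%:E *
   (1 + s ^+ 2)%:E))%E).
  have mabs : measurable_fun setT (abse \o past) by exact: measurableT_comp.
  apply: ge0_le_integral => //.
  - by move=> s _; exact: integral_ge0.
  - apply: (@measurable_fun_fubini_tonelli_F _ _ _ _ _ P (abse \o past)) => // z.
    exact: abse_ge0.
  - apply: emeasurable_funM => //; exact: msq.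
  - move=> s _ /=.
    apply: (@le_trans _ _ (\int[P]_w ((alpha^-1)%:E * (1 + (B (t - s) w ^+ 2)%:E)))%E).
      apply: ge0_le_integral => //.
      + apply/measurable_EFinP; apply: measurableT_comp => //.
        exact: measurable_funM.
      + apply: emeasurable_funM => //; apply: emeasurable_funD => //.
        by apply/measurable_EFinP; exact: measurable_funX.
      + move=> w _; rewrite -EFinD -EFinM lee_fin normrM gtr0_norm ?invr_gt0//.
        apply: ler_wpM2l; first by rewrite invr_ge0 ltW.
        have := sqr_ge0 (B (t - s) w - 1); have := sqr_ge0 (B (t - s) w + 1).
        by rewrite ler_norml; move: (B (t - s) w) => b; nra.
    rewrite ge0_integralZl//; last 3 first.
    + by apply: emeasurable_funD => //; apply/measurable_EFinP; exact: measurable_funX.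
    + by move=> w _; rewrite -EFinD lee_fin addr_ge0// sqr_ge0.
    + by rewrite lee_fin invr_ge0 ltW.
    rewrite ge0_integralD//; last 2 first.
    + by move=> w _; rewrite lee_fin sqr_ge0.
    + by apply/measurable_EFinP; exact: measurable_funX.
    rewrite integral_cst// [X in (1 * X)%E](_ : _ = 1%E); last exact: probability_setT.
    rewrite mule1 -EFinM -mulrA EFinM; apply: lee_wpmul2l.
      by rewrite lee_fin invr_ge0 ltW.
    apply: (@le_trans _ _ (1 + (K * (1 + (t - s) ^+ 2))%:E)%E); first by apply: leeD2l; exact: BK.
    rewrite -EFinD lee_fin mulrDl mul1r; apply: lerD; first by rewrite lerDl sqr_ge0.
    rewrite -mulrA; apply: ler_wpM2l => //.
    have := sqr_ge0 (t + s); have := sqr_ge0 t; have := sqr_ge0 s.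
    by have := sqr_ge0 (t * s); nra.
rewrite ge0_integralZl//; last first.
  by move=> s _; rewrite lee_fin addr_ge0// sqr_ge0.
by apply: lte_mul_pinfty => //; exact: exponential_moment2.
Qed.

Let integral_past w :
  (\int[mu]_(u in `]-oo, t]) (B u w * expR (- alpha * (t - u)))%:E =
   \int[law]_s past (s, w))%E.
Proof.
have cpos : continuous (fun u : R => Num.max (B u w) 0).
  move=> u; apply: (@continuous_max R R (fun u => B u w) (cst 0)).
    exact: cB.
  exact: cst_continuous.
have cneg : continuous (fun u : R => Num.max (- B u w) 0).
  move=> u; apply: (@continuous_max R R (fun u => - B u w) (cst 0)).
    by apply: cvgN; exact: cB.
  exact: cst_continuous.
have pos0 b : 0 <= Num.max b 0 :> R by rewrite le_max lexx orbT.
rewrite integralE [RHS]integralE; congr (_ - _)%E.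
- have := @integral_past_exponential _ _ alpha0 _ t cpos (fun u => pos0 _).
  congr (_ = _); apply: eq_integral => s _; rewrite funeposE -EFin_max; congr EFin.
    by rewrite maxr_pMl ?mul0r// expR_ge0.
  by rewrite maxr_pMr ?mulr0// invr_ge0 ltW.
- have := @integral_past_exponential _ _ alpha0 _ t cneg (fun u => pos0 _).
  congr (_ = _); apply: eq_integral => s _; rewrite funenegE -EFinN -EFin_max; congr EFin.
    by rewrite maxr_pMl ?mul0r ?expR_ge0// mulNr.
  by rewrite maxr_pMr ?mulr0 ?invr_ge0 ?(ltW alpha0)// mulrN.
Qed.

Lemma measurable_fOU : measurable_fun setT (fOU alpha nu B t).
Proof.
have E w : fOU alpha nu B t w =
    nu * (B t w - alpha * fine (\int[law]_s past (s, w))%E).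
  by rewrite /fOU /Rintegral integral_past.
apply: (eq_measurable_fun (fun w => nu * (B t w - alpha * fine (\int[law]_s past (s, w))%E))).
  by move=> w _; rewrite E.
apply: measurable_funM => //; apply: measurable_funB => //.
apply: measurable_funM => //.
apply: (measurableT_comp (fine_measurable measurableT)).
exact: (measurable_fubini_G ipast).
Qed.

(** For almost every [w] the path is integrable against the exponential kernel,
    by the theorem of Fubini, so that the integral in [fOU] does not take its
    default value. *)
Lemma fOU_has_mean : {ae P, forall w,
  has_mean law (fun s => nu * (B t w - B (t - s) w)) (fOU alpha nu B t w)}.
Proof.
have F := ae_filter_ringOfSetsType P.
move: (ae_integrable2 ipast); apply: filterS => w iw.
have hp : has_mean law (fun s => alpha^-1 * B (t - s) w)
    (\int[mu]_(u in `]-oo, t]) (B u w * expR (- alpha * (t - u)))).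
  split => //; rewrite /Rintegral integral_past fineK//.
  exact: integrable_fin_num.
have := has_mean_lin (nu * B t w) (- (nu * alpha)) (has_mean_cst law 1) hp.
rewrite (_ : _ + _ = fOU alpha nu B t w); last by rewrite /fOU; ring.
apply: eq_has_mean => s; rewrite mulr1 mulNr mulrA mulfK ?mulrBr//.
by rewrite gt_eqF.
Qed.

End OrnsteinUhlenbeck.

(** * Increments of a bivariate fractional Brownian motion *)

Section UniformCesaro.
Context {R : realType}.

(** The supremum over all shifts of the averaged double sum serves as the rate. *)
Lemma bounded_vanishing_rate (f : R -> R) : bounded_vanishing f ->
  exists eps : nat -> R, [/\ (exists K, forall n, 0 <= eps n <= K),
    eps n @[n --> \oo] --> 0 &
    forall n (a : R), \sum_(0 <= k < n) \sum_(0 <= l < n) `|f (l%:R - k%:R + a)| <=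
      eps n * n%:R ^+ 2].
Proof.
move=> bf; have [[K K0 fK] _] := bf.
pose s n a : R := \sum_(0 <= k < n) \sum_(0 <= l < n) `|f (l%:R - k%:R + a)|.
have s0 n a : 0 <= s n a by apply: sumr_ge0 => k _; apply: sumr_ge0.
have sK n a : s n a <= K * n%:R ^+ 2.
  apply: (@le_trans _ _ (\sum_(0 <= k < n) \sum_(0 <= l < n) K)).
    by apply: ler_sum => k _; apply: ler_sum.
  by rewrite !sumr_const_nat subn0 expr2 mulrA !mulr_natr.
have r0 n a : 0 <= s n a / n%:R ^+ 2 by rewrite divr_ge0// sqr_ge0.
have rK n a : s n a / n%:R ^+ 2 <= K.
  have [->|n0] := posnP n; first by rewrite expr0n/= invr0 mulr0.
  by rewrite ler_pdivrMr// exprn_gt0// ltr0n.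
pose E n := [set s n a / n%:R ^+ 2 | a in [set: R]].
have supE n : has_sup (E n).
  split; first by exists (s n 0 / n%:R ^+ 2), 0.
  by exists K => _ [a _ <-].
have Ele n a : s n a / n%:R ^+ 2 <= sup (E n).
  by apply: ub_le_sup; [exact: (supE n).2|exists a].
exists (fun n => sup (E n)); split.
- exists K => n; apply/andP; split; first exact: le_trans (r0 n 0) (Ele n 0).
  by apply: ge_sup; [exact: (supE n).1|move=> _ [a _ <-]].
- apply/cvgrPdist_le => e e0.
  have [N NP] := bounded_vanishing_mean bf e0.
  near=> n.
  rewrite sub0r normrN ger0_norm; last exact: le_trans (r0 n 0) (Ele n 0).
  apply: ge_sup; [exact: (supE n).1|move=> _ [a _ <-]].
  have Nn : (N < n)%N by near: n; exact: nbhs_infty_gt.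
  rewrite ler_pdivrMr; last by rewrite exprn_gt0// ltr0n (leq_ltn_trans _ Nn).
  by apply: NP; exact: ltnW.
- move=> n a; have [->|n0] := posnP n; first by rewrite big_geq// expr0n/= mulr0.
  by rewrite -ler_pdivrMr ?exprn_gt0 ?ltr0n//; exact: Ele.
Unshelve. all: end_near. Qed.

End UniformCesaro.

Section LaggedIncrements.
Context {Omega : Type} {R : realType}.
Implicit Types (b : R -> Omega -> R) (D H : R).

Definition incr b (x y : R) : Omega -> R := fun w => b x w - b y w.

Definition cell b D (a : R) (k : nat) : Omega -> R :=
  incr b ((k%:R + 1) * D - a) (k%:R * D - a).

Definition lag b D (s : R) (k : nat) : Omega -> R :=
  incr b (k%:R * D) (k%:R * D - s).

Definition cell_sum H b1 b2 (n : nat) D (a1 a2 : R) (w : Omega) : R :=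
  (n%:R * D `^ H)^-1 * \sum_(0 <= k < n) cell b1 D a1 k w * cell b2 D a2 k w.

Definition lag_sum H b1 b2 (n : nat) D (a s : R) (w : Omega) : R :=
  (n%:R * D `^ H)^-1 * \sum_(0 <= k < n) cell b1 D a k w * lag b2 D s k w.

(** [rho_form] and [eta_form] are the statistics [rho_est] and [eta_est] with each
    process replaced by its increments of a fixed lag; the scale factors of the
    processes cancel against the normalization. *)
Definition rho_form H b1 b2 (n : nat) D (s1 s2 : R) (w : Omega) : R :=
  (n%:R * D `^ H)^-1 * \sum_(0 <= k < n)
    (lag b1 D s1 k.+1 w - lag b1 D s1 k w) * (lag b2 D s2 k.+1 w - lag b2 D s2 k w).

Definition eta_form H b1 b2 (n : nat) D (s1 s2 : R) (w : Omega) : R :=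
  (n%:R * D `^ H)^-1 * \sum_(0 <= k < n)
    (lag b1 D s1 k w * lag b2 D s2 k.+1 w - lag b1 D s1 k.+1 w * lag b2 D s2 k w).

End LaggedIncrements.

Section IncrementCovariance.
Context {d : measure_display} {Omega : measurableType d} {R : realType}.
Variable P : probability Omega R.

(** The covariance of the increments between [y] and [x] and between [u] and [z]
    when the covariance of the processes at [s] and [t] is [- 2^-1 * g (t - s)]
    up to functions of [s] alone and of [t] alone. *)
Definition incr_cov (g : R -> R) (x y z u : R) : R :=
  - 2^-1 * (g (z - x) - g (u - x) - g (z - y) + g (u - y)).

(** Only increments are considered, because the processes themselves do not have
    stationary covariances.  The record is stable under exchanging the two
    components ([fbm_pair_swap]), which exchanges [cp] and [cm]. *)
Record fbm_pair (V : set (Omega -> R)) (H1 H2 cp cm : R)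
    (b1 b2 : R -> Omega -> R) : Prop := FbmPair {
  fbm_pair_space : gaussian_space P V ;
  fbm_pair_mem1 : forall t, V (b1 t) ;
  fbm_pair_mem2 : forall t, V (b2 t) ;
  fbm_pair_cov1 : forall x y z u, cov P (incr b1 x y) (incr b1 z u) =
    incr_cov (signed_power (2 * H1) 1 1) x y z u ;
  fbm_pair_cov2 : forall x y z u, cov P (incr b2 x y) (incr b2 z u) =
    incr_cov (signed_power (2 * H2) 1 1) x y z u ;
  fbm_pair_cov12 : forall x y z u, cov P (incr b1 x y) (incr b2 z u) =
    incr_cov (signed_power (H1 + H2) cp cm) x y z u }.

Lemma fbm_pair_swap V H1 H2 cp cm b1 b2 : 0 < H1 + H2 ->
  fbm_pair V H1 H2 cp cm b1 b2 -> fbm_pair V H2 H1 cm cp b2 b1.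
Proof.
move=> H0 [gV V1 V2 c1 c2 c12]; split => // x y z u.
have Hn0 : H1 + H2 != 0 by rewrite gt_eqF.
rewrite covC c12 /incr_cov (addrC H2).
rewrite -![signed_power _ cm cp _](@signed_powerN _ _ cp cm)// !opprB.
by ring.
Qed.

Lemma incr_mem V (gV : gaussian_space P V) b x y : (forall t, V (b t)) ->
  V (incr b x y).
Proof.
move=> Vb; have := gaussian_space_lin gV 1 (- 1) (Vb x) (Vb y).
by congr V; apply/funext => w; rewrite /incr mul1r mulN1r.
Qed.

(** Signed powers are homogeneous ([signed_powerM]), so that covariances of
    increments over lengths proportional to [D] are differences with step one. *)
Lemma incr_cov_cells p cp cm (D a b k l : R) : 0 < D ->
  incr_cov (signed_power p cp cm) ((k + 1) * D - a) (k * D - a)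
    ((l + 1) * D - b) (l * D - b) =
  2^-1 * D `^ p * diff2 (signed_power p cp cm) (l - k + (a - b) / D).
Proof.
move=> D0; have Dn0 : D != 0 by rewrite gt_eqF.
rewrite /incr_cov /diff2; set x := l - k + (a - b) / D.
rewrite (_ : (l + 1) * D - b - ((k + 1) * D - a) = D * x); last by rewrite /x; field.
rewrite (_ : l * D - b - ((k + 1) * D - a) = D * (x - 1)); last by rewrite /x; field.
rewrite (_ : (l + 1) * D - b - (k * D - a) = D * (x + 1)); last by rewrite /x; field.
rewrite (_ : l * D - b - (k * D - a) = D * x); last by rewrite /x; field.
by rewrite !signed_powerM//; ring.
Qed.

Lemma incr_cov_cell_lag p cp cm (D a s k l : R) : 0 < D ->
  incr_cov (signed_power p cp cm) ((k + 1) * D - a) (k * D - a) (l * D) (l * D - s) =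
  2^-1 * D `^ p * (diff1 (signed_power p cp cm) (l - k - 1 + a / D) -
                   diff1 (signed_power p cp cm) (l - k - 1 + (a - s) / D)).
Proof.
move=> D0; have Dn0 : D != 0 by rewrite gt_eqF.
rewrite /incr_cov /diff1.
set x := l - k - 1 + a / D; set y := l - k - 1 + (a - s) / D.
rewrite (_ : l * D - ((k + 1) * D - a) = D * x); last by rewrite /x; field.
rewrite (_ : l * D - s - ((k + 1) * D - a) = D * y); last by rewrite /y; field.
rewrite (_ : l * D - (k * D - a) = D * (x + 1)); last by rewrite /x; field.
rewrite (_ : l * D - s - (k * D - a) = D * (y + 1)); last by rewrite /y; field.
by rewrite !signed_powerM//; ring.
Qed.

Lemma incr_cov_lag p cp cm (s x y : R) : 0 < s ->
  incr_cov (signed_power p cp cm) x (x - s) y (y - s) =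
  2^-1 * s `^ p * diff2 (signed_power p cp cm) ((y - x) / s).
Proof.
move=> s0; have sn0 : s != 0 by rewrite gt_eqF.
rewrite /incr_cov /diff2.
have : y - x = s * ((y - x) / s) by field.
move: ((y - x) / s) => z yx.
rewrite (_ : y - s - x = s * (z - 1)); last by rewrite mulrBr -yx; ring.
rewrite (_ : y - (x - s) = s * (z + 1)); last by rewrite mulrDr -yx; ring.
rewrite (_ : y - s - (x - s) = y - x); last by ring.
by rewrite yx !signed_powerM//; ring.
Qed.

End IncrementCovariance.

(** * Mean square errors of sums of products of increments *)

Section LaggedSums.
Context {d : measure_display} {Omega : measurableType d} {R : realType}.
Variable P : probability Omega R.
Variables (V : set (Omega -> R)) (H1 H2 cp cm : R) (b1 b2 : R -> Omega -> R).
Hypothesis hb : fbm_pair P V H1 H2 cp cm b1 b2.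
Hypothesis H1_01 : 0 < H1 < 1.
Hypothesis H2_01 : 0 < H2 < 1.

Let H := H1 + H2.
Let d11 := diff2 (signed_power (2 * H1) 1 1).
Let d22 := diff2 (signed_power (2 * H2) 1 1).
Let d12 := diff2 (signed_power H cp cm).

Let gV := fbm_pair_space hb.
Let V1 a D k : V (cell b1 D a k).
Proof. by apply: (incr_mem gV) => t; exact: (fbm_pair_mem1 hb). Qed.
Let V2 a D k : V (cell b2 D a k).
Proof. by apply: (incr_mem gV) => t; exact: (fbm_pair_mem2 hb). Qed.
Let W2 s D k : V (lag b2 D s k).
Proof. by apply: (incr_mem gV) => t; exact: (fbm_pair_mem2 hb). Qed.

Let H1_02 : 0 < 2 * H1 < 2. Proof. by move/andP: H1_01 => [? ?]; apply/andP; split; lra. Qed.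
Let H2_02 : 0 < 2 * H2 < 2. Proof. by move/andP: H2_01 => [? ?]; apply/andP; split; lra. Qed.
Let H_02 : 0 < H < 2.
Proof.
by move/andP: H1_01 => [? ?]; move/andP: H2_01 => [? ?]; rewrite /H; apply/andP; split; lra.
Qed.

Let DH (D : R) : 0 < D -> D `^ (2 * H1) * D `^ (2 * H2) = (D `^ H) ^+ 2.
Proof.
move=> D0; rewrite -powRD; last by rewrite (gt_eqF D0) implybT.
by rewrite expr2 -powRD ?(gt_eqF D0) ?implybT// /H; congr (_ `^ _); ring.
Qed.

(** In the variance each product of covariances has a bounded factor and a factor
    with a vanishing double mean; the powers of [D] cancel. *)
Lemma cell_sum_rate : exists (eps : nat -> R) (K : R),
  [/\ forall n, 0 <= eps n <= K, eps n @[n --> \oo] --> 0 &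
   forall (n : nat) (D a b c : R), (0 < n)%N -> 0 < D ->
     (mean_square P (fun w => cell_sum H b1 b2 n D a b w - c)%R <=
       (eps n + (2^-1 * d12 ((a - b) / D) - c) ^+ 2)%:E)%E].
Proof.
have v11 := @diff2_signed_power_vanishing R _ 1 1 H1_02.
have v22 := @diff2_signed_power_vanishing R _ 1 1 H2_02.
have v12 := @diff2_signed_power_vanishing R _ cp cm H_02.
have [[K2 K20 d22K] _] := v22.
have [[K3 K30 d12K] _] := v12.
have [e1 [[C1 e1C] e1cvg e1P]] := bounded_vanishing_rate v11.
have [e2 [[C2 e2C] e2cvg e2P]] := bounded_vanishing_rate v12.
exists (fun n => 4^-1 * (K2 * e1 n + K3 * e2 n)), (4^-1 * (K2 * C1 + K3 * C2)).
split.
- move=> n; have /andP[? ?] := e1C n; have /andP[? ?] := e2C n.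
  apply/andP; split; first by rewrite mulr_ge0// addr_ge0// mulr_ge0.
  by apply: ler_wpM2l => //; apply: lerD; apply: ler_wpM2l.
- rewrite [X in _ --> X](_ : 0 = 4^-1 * (K2 * 0 + K3 * 0)); last by rewrite !mulr0 addr0 mulr0.
  apply: cvgM; first exact: cvg_cst.
  by apply: cvgD; apply: cvgM => //; exact: cvg_cst.
move=> n D a b c n0 D0.
have := second_moment_bilinear gV n (n%:R * D `^ H)^-1 c (V1 a D) (V2 b D).
move=> /has_mean_square; rewrite /cell_sum => ->; rewrite lee_fin.
have nr0 : 0 < n%:R :> R by rewrite ltr0n.
have p0 : 0 < D `^ H by exact: powR_gt0.
set delta := (a - b) / D.
have c11 k l : cov P (cell b1 D a k) (cell b1 D a l) =
    2^-1 * D `^ (2 * H1) * d11 (l%:R - k%:R).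
  by rewrite (fbm_pair_cov1 hb) incr_cov_cells// subrr mul0r addr0.
have c22 k l : cov P (cell b2 D b k) (cell b2 D b l) =
    2^-1 * D `^ (2 * H2) * d22 (l%:R - k%:R).
  by rewrite (fbm_pair_cov2 hb) incr_cov_cells// subrr mul0r addr0.
have c12 k l : cov P (cell b1 D a k) (cell b2 D b l) =
    2^-1 * D `^ H * d12 (l%:R - k%:R + delta).
  by rewrite (fbm_pair_cov12 hb) incr_cov_cells.
apply: lerD; last first.
  under eq_bigr do rewrite c12 subrr add0r.
  rewrite sumr_const_nat subn0.
  rewrite (_ : _ * (_ *+ n) = 2^-1 * d12 delta)//.
  by rewrite -[X in _ * X]mulr_natr; field; rewrite !gt_eqF.
apply: (@le_trans _ _ ((n%:R * D `^ H)^-1 ^+ 2 * (4^-1 * (D `^ H) ^+ 2 *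
   (\sum_(0 <= k < n) \sum_(0 <= l < n)
     (K2 * `|d11 (l%:R - k%:R)| + K3 * `|d12 (l%:R - k%:R + delta)|))))).
  apply: ler_wpM2l; first exact: sqr_ge0.
  rewrite mulr_sumr; apply: ler_sum => k _; rewrite mulr_sumr; apply: ler_sum => l _.
  rewrite c11 c22 !c12.
  rewrite [leLHS](_ : _ = 4^-1 * (D `^ H) ^+ 2 * (d11 (l%:R - k%:R) * d22 (l%:R - k%:R) +
     d12 (l%:R - k%:R + delta) * d12 (k%:R - l%:R + delta))); last first.
    rewrite [X in X + _](_ : _ = 4^-1 * (D `^ (2 * H1) * D `^ (2 * H2)) *
      (d11 (l%:R - k%:R) * d22 (l%:R - k%:R))); last by field.
    by rewrite DH//; field.
  apply: ler_wpM2l; first by rewrite mulr_ge0// sqr_ge0.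
  apply: (le_trans (ler_norm _)); apply: (le_trans (ler_normD _ _)).
  rewrite !normrM; apply: lerD; rewrite mulrC; apply: ler_wpM2r => //.
under eq_bigr do rewrite big_split/= -!mulr_sumr.
rewrite big_split/= -!mulr_sumr.
have := e1P n 0; under eq_bigr do under eq_bigr do rewrite addr0.
have := e2P n delta.
rewrite -/d11 -/d12; set S12 := \sum_(0 <= i < n) _; set S11 := \sum_(0 <= i < n) _.
move=> s12 s11.
rewrite [leLHS](_ : _ = 4^-1 * ((K2 * S11 + K3 * S12) / n%:R ^+ 2)); last first.
  by field; rewrite !gt_eqF.
apply: ler_wpM2l => //; rewrite ler_pdivrMr ?exprn_gt0// mulrDl.
by apply: lerD; rewrite -mulrA; apply: ler_wpM2l.
Qed.

Let f12 := diff1 (signed_power H cp cm).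

(** The bound of [sum_norm_diff2_power], divided by [n ^+ 2] and by the part
    [D `^ (2 * H2)] of the normalization that the long lagged increments of the
    second component do not compensate. *)
Definition row_rate (n : nat) (D : R) : R :=
  (n%:R ^+ 2 * D `^ (2 * H2))^-1 * (2 * n%:R `^ (2 * H1) + 4 * n%:R).

Lemma row_rate_ge0 n D : 0 <= row_rate n D.
Proof.
apply: mulr_ge0; first by rewrite invr_ge0 mulr_ge0 ?powR_ge0// sqr_ge0.
by rewrite addr_ge0// mulr_ge0// powR_ge0.
Qed.

(** The long increments of the second component are not small with [D] and their
    covariances are only bounded.  The first pairing is therefore summed exactly,
    through [sum_norm_diff2_power], and gives [row_rate].  The cross covariances
    are first differences, of vanishing double mean since [H1 + H2 < 1]. *)
Lemma lag_sum_rate : H < 1 -> exists (eps : nat -> R) (K : R),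
  [/\ forall n, 0 <= eps n <= K, eps n @[n --> \oo] --> 0 &
   forall (n : nat) (D a s c : R), (0 < n)%N -> 0 < D -> 0 < s ->
     (mean_square P (fun w => lag_sum H b1 b2 n D a s w - c)%R <=
       (K * (s `^ (2 * H2) * row_rate n D) + eps n +
         (2^-1 * (f12 (a / D - 1) - f12 ((a - s) / D - 1)) - c) ^+ 2)%:E)%E].
Proof.
move=> Hlt1.
have H_01 : 0 < H < 1 by move/andP: H_02 => [-> _].
have v22 := @diff2_signed_power_vanishing R _ 1 1 H2_02.
have vf := @diff1_signed_power_vanishing R _ cp cm H_01.
have [[K2 K20 d22K] _] := v22.
have [[K3 K30 f12K] _] := vf.
have [e [[C eC] ecvg eP]] := bounded_vanishing_rate vf.
exists (fun n => K3 * e n), (K3 * C + K2); split.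
- move=> n; have /andP[? ?] := eC n; rewrite mulr_ge0//=.
  by apply: (@le_trans _ _ (K3 * C)); [exact: ler_wpM2l|rewrite lerDl].
- rewrite [X in _ --> X](_ : 0 = K3 * 0); last by rewrite mulr0.
  by apply: cvgM => //; exact: cvg_cst.
move=> n D a s c n0 D0 s0.
have := second_moment_bilinear gV n (n%:R * D `^ H)^-1 c (V1 a D) (W2 s D).
move=> /has_mean_square; rewrite /lag_sum => ->; rewrite lee_fin.
have nr0 : 0 < n%:R :> R by rewrite ltr0n.
have p0 : 0 < D `^ H by exact: powR_gt0.
have p20 : 0 < D `^ (2 * H2) by exact: powR_gt0.
have q20 : 0 <= s `^ (2 * H2) by exact: powR_ge0.
have q0 : 0 <= D `^ (2 * H1) * s `^ (2 * H2) by rewrite mulr_ge0// powR_ge0.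
have c11 k l : cov P (cell b1 D a k) (cell b1 D a l) =
    2^-1 * D `^ (2 * H1) * d11 (l%:R - k%:R).
  by rewrite (fbm_pair_cov1 hb) incr_cov_cells// subrr mul0r addr0.
have c22 k l : cov P (lag b2 D s k) (lag b2 D s l) =
    2^-1 * s `^ (2 * H2) * d22 ((l%:R * D - k%:R * D) / s).
  by rewrite (fbm_pair_cov2 hb) incr_cov_lag.
pose x (k l : nat) : R := l%:R - k%:R - 1 + a / D.
pose y (k l : nat) : R := l%:R - k%:R - 1 + (a - s) / D.
have c12 k l : cov P (cell b1 D a k) (lag b2 D s l) =
    2^-1 * D `^ H * (f12 (x k l) - f12 (y k l)).
  by rewrite (fbm_pair_cov12 hb) incr_cov_cell_lag.
apply: lerD; last first.
  have c12k k : cov P (cell b1 D a k) (lag b2 D s k) =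
      2^-1 * D `^ H * (f12 (a / D - 1) - f12 ((a - s) / D - 1)).
    by rewrite c12; congr (_ * (f12 _ - f12 _)); rewrite /x /y; ring.
  under eq_bigr do rewrite c12k.
  rewrite sumr_const_nat subn0 -[X in _ * X]mulr_natr.
  set u := f12 _; set v := f12 _.
  rewrite [X in (X - c) ^+ 2 <= _](_ : _ = 2^-1 * (u - v))//.
  by field; rewrite !gt_eqF.
apply: (@le_trans _ _ ((n%:R * D `^ H)^-1 ^+ 2 *
   (\sum_(0 <= k < n) \sum_(0 <= l < n)
     (4^-1 * (D `^ (2 * H1) * s `^ (2 * H2)) * K2 * `|d11 (l%:R - k%:R)| +
      (2^-1 * (D `^ H) ^+ 2 * K3 * `|f12 (x k l)| +
       2^-1 * (D `^ H) ^+ 2 * K3 * `|f12 (y k l)|))))).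
  apply: ler_wpM2l; first exact: sqr_ge0.
  apply: ler_sum => k _; apply: ler_sum => l _.
  rewrite c11 c22 !c12; apply: lerD.
    rewrite (_ : 2^-1 * _ * _ * _ = 4^-1 * (D `^ (2 * H1) * s `^ (2 * H2)) *
      (d11 (l%:R - k%:R) * d22 ((l%:R * D - k%:R * D) / s))); last by field.
    rewrite -!mulrA; apply: ler_wpM2l => //; rewrite !mulrA -[leRHS]mulrA.
    rewrite -[leLHS]mulrA.
    apply: ler_wpM2l => //; apply: (le_trans (ler_norm _)).
    by rewrite normrM mulrC; apply: ler_wpM2r.
  rewrite [leLHS](_ : _ = 4^-1 * (D `^ H) ^+ 2 *
    ((f12 (x k l) - f12 (y k l)) * (f12 (x l k) - f12 (y l k)))); last by field.
  rewrite [leRHS](_ : _ = 4^-1 * (D `^ H) ^+ 2 *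
    ((`|f12 (x k l)| + `|f12 (y k l)|) * (2 * K3))); last by field.
  apply: ler_wpM2l; first by rewrite mulr_ge0// sqr_ge0.
  apply: (le_trans (ler_norm _)); rewrite normrM; apply: ler_pM => //.
    exact: ler_normB.
  by rewrite (le_trans (ler_normB _ _))// mulr_natl mulr2n lerD.
have s11 := @sum_norm_diff2_power R _ n H1_02.
have Sx : \sum_(0 <= k < n) \sum_(0 <= l < n) `|f12 (x k l)| <= e n * n%:R ^+ 2.
  have := eP n (- 1 + a / D); rewrite -/f12; congr (_ <= _).
  by apply: eq_bigr => k _; apply: eq_bigr => l _; rewrite /x addrA.
have Sy : \sum_(0 <= k < n) \sum_(0 <= l < n) `|f12 (y k l)| <= e n * n%:R ^+ 2.
  have := eP n (- 1 + (a - s) / D); rewrite -/f12; congr (_ <= _).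
  by apply: eq_bigr => k _; apply: eq_bigr => l _; rewrite /y addrA.
under eq_bigr do rewrite big_split/= big_split/= -!mulr_sumr.
rewrite big_split/= big_split/= -!mulr_sumr.
move: s11 Sx Sy; rewrite -/d11.
set S11 := \sum_(0 <= k < n) _; set S1 := \sum_(0 <= k < n) _.
set S2 := \sum_(0 <= k < n) _ => s11 s1 s2.
have C0 : 0 <= C by have /andP[h1 h2] := eC 0%N; exact: le_trans h1 h2.
have -> : (n%:R * D `^ H)^-1 ^+ 2 *
   (4^-1 * (D `^ (2 * H1) * s `^ (2 * H2)) * K2 * S11 +
     (2^-1 * D `^ H ^+ 2 * K3 * S1 + 2^-1 * D `^ H ^+ 2 * K3 * S2)) =
   4^-1 * K2 * (s `^ (2 * H2) * ((n%:R ^+ 2 * D `^ (2 * H2))^-1 * S11)) +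
   K3 * (2^-1 * (S1 + S2) / n%:R ^+ 2).
  have -> : (n%:R * D `^ H)^-1 ^+ 2 = (n%:R ^+ 2 * (D `^ (2 * H1) * D `^ (2 * H2)))^-1.
    by rewrite DH// exprVn exprMn.
  rewrite -DH//; field.
  by rewrite !gt_eqF ?powR_gt0.
have SR0 : 0 <= s `^ (2 * H2) * row_rate n D.
  by rewrite mulr_ge0// row_rate_ge0.
apply: lerD.
  apply: (@le_trans _ _ (K2 * (s `^ (2 * H2) * row_rate n D))).
    apply: (@le_trans _ _ (4^-1 * K2 * (s `^ (2 * H2) * row_rate n D))).
      apply: ler_wpM2l; first by rewrite mulr_ge0.
      apply: ler_wpM2l => //; apply: ler_wpM2l => //.
      by rewrite invr_ge0 mulr_ge0 ?sqr_ge0 ?powR_ge0.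
    by rewrite ler_wpM2r//; lra.
  by rewrite ler_wpM2r// lerDr mulr_ge0.
apply: ler_wpM2l => //; rewrite ler_pdivrMr ?exprn_gt0//.
lra.
Qed.

End LaggedSums.

(** * Mean square errors of the estimators at fixed lags *)

Section Forms.
Context {d : measure_display} {Omega : measurableType d} {R : realType}.
Variable P : probability Omega R.

Lemma mean_square_sub_le (f g : Omega -> R) (x y : R) :
  measurable_fun setT f -> measurable_fun setT g ->
  (mean_square P f <= x%:E)%E -> (mean_square P g <= y%:E)%E ->
  (mean_square P (fun w => f w - g w)%R <= (2 * (x + y))%:E)%E.
Proof.
move=> mf mg fx gy.
have mNg : measurable_fun setT (fun w => -1 * g w) by exact: measurable_funM.
have := mean_squareD P mf mNg; rewrite mean_squareZ// sqrrN expr1n mul1e.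
have -> : (fun w => f w + -1 * g w) = (fun w => f w - g w).
  by apply/funext => w; rewrite mulN1r.
move=> /le_trans; apply; rewrite EFinM (EFinD x y).
by apply: lee_wpmul2l => //; exact: leeD.
Qed.

Lemma powR_le_quadratic (p s : R) : 0 < p < 2 -> 0 < s -> s `^ p <= 1 + s ^+ 2.
Proof.
move=> /andP[p0 p2] s0; have [s1|s1] := leP s 1.
  have : s `^ p <= s `^ 0 by apply: ger_powR; rewrite ?s0// ltW.
  by rewrite powRr0 => h; rewrite (le_trans h)// lerDl sqr_ge0.
have : s `^ p <= s `^ 2%:R by apply: ler_powR; rewrite ltW.
by rewrite powR_mulrn ?(ltW s0)// => h; rewrite (le_trans h)// lerDr.
Qed.

(** A fixed nonzero lag is sent to infinity when it is measured in grid steps. *)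
Lemma bounded_vanishing_scaled (f : R -> R) (Delta : nat -> R) (x y : R) :
  bounded_vanishing f -> (forall n, (0 < n)%N -> 0 < Delta n) ->
  Delta n @[n --> \oo] --> 0 -> x != 0 ->
  f (x / Delta n + y) @[n --> \oo] --> 0.
Proof.
move=> [_ fe] Delta0 cDelta x0; apply/cvgrPdist_le => e e0.
have [M M0 MP] := fe _ e0.
have My0 : 0 < M + `|y| + 1 by rewrite ltr_wpDl// addr_ge0.
have xM0 : 0 < `|x| / (M + `|y| + 1) by rewrite divr_gt0 ?normr_gt0.
near=> n; rewrite sub0r normrN; apply: MP.
have n0 : (0 < n)%N by near: n; exact: nbhs_infty_gt.
have Dn0 := Delta0 _ n0.
have Dn : Delta n <= `|x| / (M + `|y| + 1).
  have : `|0 - Delta n| <= `|x| / (M + `|y| + 1).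
    by near: n; move/cvgrPdist_le : cDelta; apply.
  by rewrite sub0r normrN gtr0_norm.
have big : M + `|y| + 1 <= `|x| / Delta n.
  by rewrite ler_pdivlMr// mulrC -ler_pdivlMr.
have := ler_normB (x / Delta n + y) y; rewrite addrK normrM normfV (gtr0_norm Dn0).
lra.
Unshelve. all: end_near. Qed.

Variables (V : set (Omega -> R)) (H1 H2 cp cm : R) (b1 b2 : R -> Omega -> R).
Hypothesis hb : fbm_pair P V H1 H2 cp cm b1 b2.
Hypothesis H1_01 : 0 < H1 < 1.
Hypothesis H2_01 : 0 < H2 < 1.

Let H := H1 + H2.
Let d12 := diff2 (signed_power H cp cm).

Let rhoF := rho_form H b1 b2.
Let etaF := eta_form H b1 b2.

Let lagS (b : R -> Omega -> R) (D s : R) (k : nat) w :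
  lag b D s k.+1 w - lag b D s k w = cell b D 0 k w - cell b D s k w.
Proof. by rewrite /lag /cell /incr -natr1 !subr0; ring. Qed.

Let S := cell_sum H b1 b2.
Let L := lag_sum H b1 b2.

Let rhoFE n D s1 s2 w : rhoF n D s1 s2 w =
  (S n D 0 0 w - S n D 0 s2 w) - (S n D s1 0 w - S n D s1 s2 w).
Proof.
rewrite /rhoF /rho_form /S /cell_sum -!mulrBr; congr (_ * _).
rewrite -!sumrB; apply: eq_bigr => k _; rewrite !lagS; ring.
Qed.

(** Summation by parts:
    [u_k v_(k+1) - u_(k+1) v_k = - 2 (u_(k+1) - u_k) v_k
       - (u_(k+1) - u_k) (v_(k+1) - v_k) + (u_(k+1) v_(k+1) - u_k v_k)]. *)
Let etaFE n D s1 s2 w : etaF n D s1 s2 w =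
  - 2 * (L n D 0 s2 w - L n D s1 s2 w) - rhoF n D s1 s2 w +
  (n%:R * D `^ H)^-1 *
    (lag b1 D s1 n w * lag b2 D s2 n w - lag b1 D s1 0 w * lag b2 D s2 0 w).
Proof.
rewrite /etaF /rhoF /eta_form /rho_form /L /lag_sum.
rewrite -(@telescope_sumr _ 0 n (fun k => lag b1 D s1 k w * lag b2 D s2 k w))//.
set q := (_)^-1.
rewrite -[- 2 * _]mulrC -mulrBr -!mulrA -sumrB mulr_suml -mulrBr -mulrDr; congr (_ * _).
rewrite -sumrB -big_split/=; apply: eq_bigr => k _.
by have := lagS b1 D s1 k w => E; rewrite -[_ - cell b1 D s1 k w * _]mulrBl -E; ring.
Qed.

Let gV := fbm_pair_space hb.
Let mV X : V X -> measurable_fun setT X.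
Proof. exact: (gaussian_space_measurable gV). Qed.
Let mcell1 D a k : measurable_fun setT (cell b1 D a k).
Proof. by apply/mV/(incr_mem gV) => t; exact: (fbm_pair_mem1 hb). Qed.
Let mcell2 D a k : measurable_fun setT (cell b2 D a k).
Proof. by apply/mV/(incr_mem gV) => t; exact: (fbm_pair_mem2 hb). Qed.
Let Vlag1 D a k : V (lag b1 D a k).
Proof. by apply/(incr_mem gV) => t; exact: (fbm_pair_mem1 hb). Qed.
Let Vlag2 D a k : V (lag b2 D a k).
Proof. by apply/(incr_mem gV) => t; exact: (fbm_pair_mem2 hb). Qed.

Let mS n D a b : measurable_fun setT (S n D a b).
Proof.
apply: measurable_funM => //; apply: measurable_sum => k; exact: measurable_funM.
Qed.

Let mL n D a b : measurable_fun setT (L n D a b).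
Proof.
apply: measurable_funM => //; apply: measurable_sum => k.
by apply: measurable_funM => //; exact: mV.
Qed.

(** The four sums in [rhoFE] have mean close to zero except the one with both
    lags zero, whose mean is the limit.  Distinct lags are needed for the sum at
    [s1] and [s2]. *)
Lemma rho_form_rate : exists (r : nat -> R -> R -> R -> R) (K : R),
  (forall (n : nat) (D s1 s2 : R), (0 < n)%N -> 0 < D ->
     (mean_square P (fun w => rhoF n D s1 s2 w - 2^-1 * (cp + cm))%R
        <= (r n D s1 s2)%:E)%E /\ 0 <= r n D s1 s2 <= K) /\
  (forall Delta : nat -> R, (forall n, (0 < n)%N -> 0 < Delta n) ->
     Delta n @[n --> \oo] --> 0 -> forall s1 s2, 0 < s1 -> 0 < s2 -> s1 != s2 ->
     r n (Delta n) s1 s2 @[n --> \oo] --> 0).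
Proof.
have [eps [C [epsC epscvg epsP]]] := cell_sum_rate hb H1_01 H2_01.
have H_02 : 0 < H < 2.
  move/andP: H1_01 => [? ?]; move/andP: H2_01 => [? ?].
  by rewrite /H; apply/andP; split; lra.
have Hn0 : H != 0 by case/andP: H_02 => h _; rewrite gt_eqF.
have v12 := @diff2_signed_power_vanishing R _ cp cm H_02.
have [[K2 K20 d12K] _] := v12.
pose c := 2^-1 * (cp + cm).
pose x n D a b c' := eps n + (2^-1 * d12 ((a - b) / D) - c') ^+ 2.
pose r n D s1 s2 := 2 * (2 * (x n D 0 0 c + x n D 0 s2 0) +
                         2 * (x n D s1 0 0 + x n D s1 s2 0)).
pose K := C + (2^-1 * K2 + `|c|) ^+ 2.
exists r, (16 * K); split.
  move=> n D s1 s2 n0 D0; split.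
    have -> : (fun w => rhoF n D s1 s2 w - 2^-1 * (cp + cm)) =
       (fun w => ((S n D 0 0 w - c) - (S n D 0 s2 w - 0)) -
                 ((S n D s1 0 w - 0) - (S n D s1 s2 w - 0))).
      by apply/funext => w; rewrite rhoFE /c; ring.
    have mSc a b c' : measurable_fun setT (fun w => S n D a b w - c').
      exact: measurable_funB.
    apply: mean_square_sub_le; [exact: measurable_funB..| |].
      by apply: mean_square_sub_le => //; exact: epsP.
    by apply: mean_square_sub_le => //; exact: epsP.
  have xK a b c' : `|c'| <= `|c| -> 0 <= x n D a b c' <= K.
    move=> cc; have /andP[e0 eC] := epsC n.
    rewrite addr_ge0 ?sqr_ge0//=; apply: lerD => //.
    rewrite -[leLHS]real_normK ?num_real//; apply: lerXn2r; rewrite ?nnegrE//.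
      by rewrite addr_ge0// mulr_ge0.
    rewrite (le_trans (ler_normB _ _))//; apply: lerD => //.
    by rewrite normrM gtr0_norm// ler_wpM2l.
  have /andP[? ?] := xK 0 0 c (lexx _).
  have x0 a b : 0 <= x n D a b 0 <= K by apply: xK; rewrite normr0.
  have /andP[? ?] := x0 0 s2; have /andP[? ?] := x0 s1 0; have /andP[? ?] := x0 s1 s2.
  by rewrite /r; apply/andP; split; lra.
move=> Delta Delta0 cDelta s1 s2 s10 s20 s12.
have xc a b : a != b -> x n (Delta n) a b 0 @[n --> \oo] --> 0.
  move=> ab; rewrite [X in _ --> X](_ : 0 = 0 + (2^-1 * 0 - 0) ^+ 2); last first.
    by rewrite mulr0 subrr expr0n addr0.
  apply: cvgD => //; apply: (@cvg_comp _ _ _ _ (fun z : R => z ^+ 2)); last first.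
    exact: exprn_continuous.
  apply: cvgB; last exact: cvg_cst.
  apply: cvgM; first exact: cvg_cst.
  have := bounded_vanishing_scaled 0 v12 Delta0 cDelta (x := a - b).
  rewrite subr_eq0 => /(_ ab); apply: cvg_trans; apply: near_eq_cvg.
  by apply: nearW => n; rewrite addr0.
have x00 : x n (Delta n) 0 0 c @[n --> \oo] --> 0.
  have E n : x n (Delta n) 0 0 c = eps n.
    by rewrite /x subrr mul0r /d12 diff2_signed_power0// /c subrr expr0n addr0.
  by under eq_fun do rewrite E.
rewrite [X in _ --> X](_ : 0 = 2 * (2 * (0 + 0) + 2 * (0 + 0))); last by lra.
apply: cvgM; first exact: cvg_cst.
apply: cvgD; (apply: cvgM; first exact: cvg_cst); apply: cvgD => //; apply: xc => //.
- by rewrite eq_sym gt_eqF.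
- by rewrite gt_eqF.
Qed.

(** By Isserlis' formula the mean is [A * B + 2 * cov P U Z ^+ 2].  The bound
    [U ^+ 2 * Z ^+ 2 <= (B / A * U ^+ 4 + A / B * Z ^+ 4) / 2] plays the role of
    the Cauchy-Schwarz inequality for [cov P U Z]. *)
Let mean_square_prod U Z (A B : R) : V U -> V Z -> cov P U U = A -> cov P Z Z = B ->
  0 < A -> 0 < B -> (mean_square P (fun w => U w * Z w)%R <= (3 * (A * B))%:E)%E.
Proof.
move=> VU VZ UA ZB A0 B0.
have UZ := isserlis gV VU VU VZ VZ.
have U4 := has_mean_pow4 gV VU; have Z4 := has_mean_pow4 gV VZ.
have dom := has_mean_lin (2^-1 * (B / A)) (2^-1 * (A / B)) U4 Z4.
have le := has_mean_le UZ dom.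
rewrite (has_mean_square (m := cov P U U * cov P Z Z + cov P U Z * cov P U Z +
  cov P U Z * cov P U Z)); last by move: UZ; apply: eq_has_mean => w; ring.
rewrite lee_fin; apply: (le_trans (le _)).
  move=> w; pose a := B / A; have a0 : 0 < a by rewrite divr_gt0.
  have ia : A / B = a^-1 by rewrite /a invf_div.
  rewrite ia -/a -subr_ge0.
  rewrite (_ : _ - _ = 2^-1 * a^-1 * (a * U w ^+ 2 - Z w ^+ 2) ^+ 2).
    by rewrite mulr_ge0 ?sqr_ge0// mulr_ge0// invr_ge0 ltW.
  by field; rewrite gt_eqF.
rewrite UA ZB le_eqVlt; apply/orP; left; apply/eqP.
by field; rewrite !gt_eqF.
Qed.

Let mlag1 D a k : measurable_fun setT (lag b1 D a k).
Proof. exact: mV. Qed.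
Let mlag2 D a k : measurable_fun setT (lag b2 D a k).
Proof. exact: mV. Qed.

Let mean_square_end D s1 s2 k (q : R) : 0 < s1 -> 0 < s2 ->
  (mean_square P (fun w => q * (lag b1 D s1 k w * lag b2 D s2 k w))%R <=
   (q ^+ 2 * (3 * (s1 `^ (2 * H1) * s2 `^ (2 * H2))))%:E)%E.
Proof.
move=> s10 s20.
have d0 p : 0 < p -> 2^-1 * diff2 (signed_power p 1 1) 0 = 1 :> R.
  by move=> p0; rewrite diff2_signed_power0 ?gt_eqF//; lra.
move/andP: H1_01 => [h1 _]; move/andP: H2_01 => [h2 _].
rewrite mean_squareZ; last exact: measurable_funM.
rewrite [leRHS]EFinM; apply: lee_wpmul2l; first by rewrite lee_fin sqr_ge0.
apply: mean_square_prod => //; last 2 first.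
- exact: powR_gt0.
- exact: powR_gt0.
- by rewrite (fbm_pair_cov1 hb) incr_cov_lag// subrr mul0r mulrAC d0 ?mul1r//; lra.
- by rewrite (fbm_pair_cov2 hb) incr_cov_lag// subrr mul0r mulrAC d0 ?mul1r//; lra.
Qed.

Let f12 := diff1 (signed_power H cp cm).

(** Summation by parts ([etaFE]) reduces the statement to [lag_sum_rate], to
    [rho_form_rate] and to the two end terms.  The error is bounded by a
    polynomial in the lags, to be integrated against the exponential laws later,
    and by a factor that converges as soon as [row_rate] does. *)
Lemma eta_form_rate : H < 1 -> exists (r : nat -> R -> R -> R -> R) (K : R),
  (forall (n : nat) (D s1 s2 : R), (0 < n)%N -> 0 < D -> 0 < s1 -> 0 < s2 ->
     (mean_square P (fun w => etaF n D s1 s2 w - 2^-1 * (cm - cp))%R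
        <= (r n D s1 s2)%:E)%E /\
     0 <= r n D s1 s2 <= K * (1 + row_rate H1 H2 n D + (n%:R * D `^ H)^-1 ^+ 2) *
       ((1 + s1 ^+ 2) * (1 + s2 ^+ 2))) /\
  (forall Delta : nat -> R, (forall n, (0 < n)%N -> 0 < Delta n) ->
     Delta n @[n --> \oo] --> 0 ->
     row_rate H1 H2 n (Delta n) @[n --> \oo] --> 0 ->
     (n%:R * Delta n `^ H)^-1 ^+ 2 @[n --> \oo] --> 0 ->
     forall s1 s2, 0 < s1 -> 0 < s2 -> s1 != s2 ->
     r n (Delta n) s1 s2 @[n --> \oo] --> 0).
Proof.
move=> Hlt1.
have [rr [Kr [rrP rrcvg]]] := rho_form_rate.
have [eps [C [epsC epscvg epsP]]] := lag_sum_rate hb H1_01 H2_01 Hlt1.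
move/andP: (H1_01) => [h1 h1']; move/andP: (H2_01) => [h2 h2'].
have H_01 : 0 < H < 1 by rewrite /H; apply/andP; split=> //; lra.
have Hn0 : H != 0 by case/andP: H_01 => h _; rewrite gt_eqF.
have vf := @diff1_signed_power_vanishing R _ cp cm H_01.
have [[K2 K20 f12K] _] := vf.
have C0 : 0 <= C by have /andP[h h'] := epsC 0%N; exact: le_trans h h'.
pose c := - (2^-1 * cm).
pose z a (D s : R) c' := (2^-1 * (f12 (a / D - 1) - f12 ((a - s) / D - 1)) - c') ^+ 2.
pose x n D a s c' := C * (s `^ (2 * H2) * row_rate H1 H2 n D) + eps n + z a D s c'.
pose y n D s1 s2 := (n%:R * D `^ H)^-1 ^+ 2 * (3 * (s1 `^ (2 * H1) * s2 `^ (2 * H2))).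
pose r n D s1 s2 := 2 * (2 * (4 * (2 * (x n D s1 s2 0 + x n D 0 s2 c)) + rr n D s1 s2) +
   2 * (y n D s1 s2 + y n D s1 s2)).
pose Z := (K2 + `|c|) ^+ 2.
exists r, (64 * (C + C + Z) + 4 * Kr + 24); split.
  move=> n D s1 s2 n0 D0 s10 s20; have [rrn /andP[rr0 rrK]] := rrP n D s1 s2 n0 D0.
  split.
    pose q := (n%:R * D `^ H)^-1.
    have -> : (fun w => etaF n D s1 s2 w - 2^-1 * (cm - cp)) =
       (fun w => (2 * ((L n D s1 s2 w - 0) - (L n D 0 s2 w - c)) -
                  (rhoF n D s1 s2 w - 2^-1 * (cp + cm))) -
                 (q * (lag b1 D s1 0 w * lag b2 D s2 0 w) -
                  q * (lag b1 D s1 n w * lag b2 D s2 n w))).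
      by apply/funext => w; rewrite etaFE /c -/q; field.
    have mLc a c' : measurable_fun setT (fun w => L n D a s2 w - c').
      exact: measurable_funB.
    have mq k : measurable_fun setT (fun w => q * (lag b1 D s1 k w * lag b2 D s2 k w)).
      by apply: measurable_funM => //; exact: measurable_funM.
    have mrho : measurable_fun setT (fun w => rhoF n D s1 s2 w - 2^-1 * (cp + cm)).
      apply: measurable_funB => //.
      apply: (eq_measurable_fun _ (fun w _ => esym (rhoFE n D s1 s2 w))).
      by apply: measurable_funB; apply: measurable_funB.
    have mLL : measurable_fun setT
        (fun w => 2 * ((L n D s1 s2 w - 0) - (L n D 0 s2 w - c))).
      by apply: measurable_funM => //; exact: measurable_funB.
    apply: mean_square_sub_le; [exact: measurable_funB|exact: measurable_funB| |].
      apply: mean_square_sub_le => //.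
      rewrite mean_squareZ; last exact: measurable_funB.
      rewrite (_ : 2 ^+ 2 = 4); last by ring.
      rewrite [leRHS]EFinM; apply: lee_wpmul2l => //.
      by apply: mean_square_sub_le => //; exact: epsP.
    by apply: mean_square_sub_le => //; exact: mean_square_end.
  have M1 : 1 <= 1 + s1 ^+ 2 by rewrite lerDl sqr_ge0.
  have M2 : 1 <= 1 + s2 ^+ 2 by rewrite lerDl sqr_ge0.
  set M := (1 + s1 ^+ 2) * (1 + s2 ^+ 2).
  have M1M : 1 + s1 ^+ 2 <= M by rewrite /M ler_peMr// (le_trans ler01).
  have M2M : 1 + s2 ^+ 2 <= M by rewrite /M ler_peMl// (le_trans ler01).
  have M_1 : 1 <= M by exact: le_trans M1 M1M.
  have p1 : s1 `^ (2 * H1) <= 1 + s1 ^+ 2.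
    by apply: powR_le_quadratic => //; apply/andP; split; lra.
  have p2 : s2 `^ (2 * H2) <= 1 + s2 ^+ 2.
    by apply: powR_le_quadratic => //; apply/andP; split; lra.
  have p12 : s1 `^ (2 * H1) * s2 `^ (2 * H2) <= M by apply: ler_pM => //; exact: powR_ge0.
  have p2M : s2 `^ (2 * H2) <= M by exact: le_trans p2 M2M.
  have th0 := row_rate_ge0 H1 H2 n D.
  set th := row_rate H1 H2 n D in th0 *.
  have be0 : 0 <= (n%:R * D `^ H)^-1 ^+ 2 by exact: sqr_ge0.
  set be := (n%:R * D `^ H)^-1 ^+ 2 in be0 *.
  have zK a c' : `|c'| <= `|c| -> 0 <= z a D s2 c' <= Z.
    move=> cc; rewrite /z sqr_ge0/=.
    rewrite -[leLHS]real_normK ?num_real//; apply: lerXn2r; rewrite ?nnegrE//.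
      by rewrite addr_ge0.
    rewrite (le_trans (ler_normB _ _))//; apply: lerD => //.
    rewrite normrM gtr0_norm//.
    have := ler_normB (f12 (a / D - 1)) (f12 ((a - s2) / D - 1)).
    have := f12K (a / D - 1); have := f12K ((a - s2) / D - 1); rewrite -/f12.
    by lra.
  have /andP[e0 eC] := epsC n.
  have Z0 : 0 <= Z by exact: sqr_ge0.
  have xK a c' : `|c'| <= `|c| -> 0 <= x n D a s2 c' <= (C + C + Z) * ((1 + th + be) * M).
    move=> /(zK a) /andP[z0 zZ]; rewrite /x -/th.
    have q0 : 0 <= s2 `^ (2 * H2) * th by rewrite mulr_ge0 ?powR_ge0.
    have t1 : s2 `^ (2 * H2) * th <= (1 + th + be) * M.
      rewrite mulrC; apply: ler_pM => //; [exact: powR_ge0|lra].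
    have t2 : 1 <= (1 + th + be) * M.
      by rewrite -[leLHS]mulr1; apply: ler_pM => //; lra.
    have := ler_wpM2l C0 t1; have := ler_wpM2l C0 t2; have := ler_wpM2l Z0 t2.
    have := mulr_ge0 C0 q0.
    by move: (_ * M) (_ * th) => tM sth *; apply/andP; split; lra.
  have /andP[x1 x1'] : 0 <= x n D s1 s2 0 <= (C + C + Z) * ((1 + th + be) * M).
    by apply: xK; rewrite normr0.
  have /andP[x2 x2'] := xK 0 c (lexx _).
  have t0 : 1 <= 1 + th + be by lra.
  have y0 : 0 <= y n D s1 s2 by rewrite /y -/be mulr_ge0// mulr_ge0// mulr_ge0 ?powR_ge0.
  have yM : y n D s1 s2 <= 3 * ((1 + th + be) * M).
    rewrite /y -/be mulrCA; apply: ler_wpM2l => //; apply: ler_pM => //.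
      by rewrite mulr_ge0 ?powR_ge0.
    lra.
  have Kr0 : 0 <= Kr by exact: le_trans rr0 rrK.
  have rrM : rr n D s1 s2 <= Kr * ((1 + th + be) * M).
    rewrite (le_trans rrK)// -[leLHS]mulr1; apply: ler_wpM2l => //.
    by rewrite -[leLHS]mulr1; apply: ler_pM => //; lra.
  rewrite -[X in _ <= _ <= X]mulrA /r.
  move: ((1 + th + be) * M) x1' x2' yM rrM => Q x1' x2' yM rrM.
  by apply/andP; split; lra.
move=> Delta Delta0 cDelta crow cend s1 s2 s10 s20 s12.
have fcvg a : a != 0 -> f12 (a / Delta n - 1) @[n --> \oo] --> 0.
  by move=> a0; exact: (bounded_vanishing_scaled (- 1) vf Delta0 cDelta a0).
have sq0 (u : nat -> R) : u n @[n --> \oo] --> 0 -> u n ^+ 2 @[n --> \oo] --> 0.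
  move=> u0; rewrite [X in _ --> X](_ : 0 = 0 ^+ 2); last by rewrite expr0n.
  by apply: (@cvg_comp _ _ _ _ (fun z : R => z ^+ 2) _ _ _ u0); exact: exprn_continuous.
have xcvg a c' : z a (Delta n) s2 c' @[n --> \oo] --> 0 ->
    x n (Delta n) a s2 c' @[n --> \oo] --> 0.
  move=> zc; rewrite [X in _ --> X](_ : 0 = C * (s2 `^ (2 * H2) * 0) + 0 + 0); last first.
    by rewrite !mulr0 !addr0.
  apply: cvgD => //; apply: cvgD => //; apply: cvgM; first exact: cvg_cst.
  by apply: cvgM => //; exact: cvg_cst.
have x1 : x n (Delta n) s1 s2 0 @[n --> \oo] --> 0.
  apply: xcvg; apply: sq0.
  rewrite [X in _ --> X](_ : 0 = 2^-1 * (0 - 0) - 0); last by rewrite !subr0 mulr0.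
  apply: cvgB; last exact: cvg_cst.
  apply: cvgM; first exact: cvg_cst.
  apply: cvgB; first by apply: fcvg; rewrite gt_eqF.
  by apply: fcvg; rewrite subr_eq0.
have x2 : x n (Delta n) 0 s2 c @[n --> \oo] --> 0.
  apply: xcvg; apply: sq0.
  rewrite [X in _ --> X](_ : 0 = 2^-1 * (- cm - 0) - c); last by rewrite /c; lra.
  apply: cvgB; last exact: cvg_cst.
  apply: cvgM; first exact: cvg_cst.
  apply: cvgB; last by apply: fcvg; rewrite sub0r oppr_eq0 gt_eqF.
  have f1 : f12 (- 1) = - cm.
    rewrite /f12 /diff1 addNr signed_power0// signed_powerN// signed_power_ge0//.
    by rewrite powR1 mulr1 sub0r.
  by rewrite -f1; under eq_fun do rewrite mul0r sub0r; exact: cvg_cst.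
have ycvg : y n (Delta n) s1 s2 @[n --> \oo] --> 0.
  rewrite [X in _ --> X](_ : 0 = 0 * (3 * (s1 `^ (2 * H1) * s2 `^ (2 * H2)))).
    by apply: cvgM => //; exact: cvg_cst.
  by rewrite mul0r.
have rrc := rrcvg Delta Delta0 cDelta s1 s2 s10 s20 s12.
rewrite [X in _ --> X](_ : 0 = 2 * (2 * (4 * (2 * (0 + 0)) + 0) + 2 * (0 + 0))); last by lra.
have two (k : R) (u : nat -> R) (l : R) : u n @[n --> \oo] --> l ->
    k * u n @[n --> \oo] --> k * l.
  by move=> ul; apply: cvgM => //; exact: cvg_cst.
apply: (two 2); apply: cvgD; apply: (two 2); apply: cvgD => //.
by apply: (two 4); apply: (two 2); apply: cvgD.
Qed.

End Forms.

(** * Rates along the sampling scheme *)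

Section SamplingRates.
Context {R : realType}.
Variables (Delta : nat -> R).
Hypothesis Delta0 : forall n, (0 < n)%N -> 0 < Delta n.
Hypothesis cDelta : Delta n @[n --> \oo] --> 0.
Hypothesis cT : n%:R * Delta n @[n --> \oo] --> +oo.

Let stepX (q : R) : 0 < q -> Delta n `^ q @[n --> \oo] --> 0.
Proof.
move=> q0; apply/cvgrPdist_le => e e0; near=> n.
have n0 : (0 < n)%N by near: n; exact: nbhs_infty_gt.
rewrite sub0r normrN (ger0_norm (powR_ge0 _ _)).
have Dn : `|0 - Delta n| <= e `^ q^-1.
  by near: n; move/cvgrPdist_le : cDelta; apply; exact: powR_gt0.
rewrite sub0r normrN gtr0_norm ?Delta0// in Dn.
rewrite -[leRHS](@powRr1 _ e) ?(ltW e0)// -[1](@mulVf _ q) ?gt_eqF// powRrM.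
by apply: ge0_ler_powR; rewrite ?nnegrE ?powR_ge0// ltW// Delta0.
Unshelve. all: end_near. Qed.

Let horizonX (q : R) : q < 0 -> (n%:R * Delta n) `^ q @[n --> \oo] --> 0.
Proof.
move=> q0; apply/cvgrPdist_le => e e0.
have [M M0 MP] := powR_small q0 e0.
near=> n; rewrite sub0r normrN (ger0_norm (powR_ge0 _ _)); apply: MP.
by near: n; move/cvgryPge : cT; apply.
Unshelve. all: end_near. Qed.

Let prod0 (c : R) (u v : nat -> R) : u n @[n --> \oo] --> 0 -> v n @[n --> \oo] --> 0 ->
  c * (u n * v n) @[n --> \oo] --> 0.
Proof.
move=> u0 v0; rewrite [X in _ --> X](_ : 0 = c * (0 * 0)); last by rewrite !mulr0.
by apply: cvgM; [exact: cvg_cst|exact: cvgM].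
Qed.

(** Written with the horizon [n%:R * Delta n], which diverges, and the step, which
    vanishes, the rate is a sum of two products of a negative power of the
    former with a positive power of the latter. *)
Lemma row_rate_cvg (H1 H2 : R) : H1 < 1 -> H1 + H2 < 1 -> 2 * H2 < 1 ->
  row_rate H1 H2 n (Delta n) @[n --> \oo] --> 0.
Proof.
move=> h1 h h2.
have E n : (0 < n)%N -> row_rate H1 H2 n (Delta n) =
    2 * ((n%:R * Delta n) `^ (2 * H1 - 2) * Delta n `^ (2 - 2 * (H1 + H2))) +
    4 * ((n%:R * Delta n) `^ (- 1) * Delta n `^ (1 - 2 * H2)).
  move=> n0; have D0 := Delta0 n0; rewrite /row_rate; set D := Delta n in D0 *.
  have nr0 : 0 < n%:R :> R by rewrite ltr0n.
  have sqr (x : R) : 0 < x -> x `^ 2 = x ^+ 2 by move=> x0; rewrite -powR_mulrn ?ltW.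
  have cut (x r s : R) : 0 < x -> x `^ (r - s) = x `^ r / x `^ s.
    by move=> x0; rewrite powRB// (gt_eqF x0) implybT.
  rewrite powR_inv1; last by rewrite mulr_ge0// ltW.
  rewrite powRM ?(ltW nr0) ?(ltW D0)// !cut// !sqr// powRr1 ?(ltW D0)//.
  have -> : D `^ (2 * (H1 + H2)) = D `^ (2 * H1) * D `^ (2 * H2).
    by rewrite mulrDr powRD// (gt_eqF D0) implybT.
  have a0 : 0 < D `^ (2 * H1) by exact: powR_gt0.
  have b0 : 0 < D `^ (2 * H2) by exact: powR_gt0.
  by field; rewrite !gt_eqF.
rewrite [X in _ --> X](_ : 0 = 0 + 0); last by rewrite addr0.
apply: (@cvg_trans _ ((2 * ((n%:R * Delta n) `^ (2 * H1 - 2) *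
    Delta n `^ (2 - 2 * (H1 + H2))) +
  4 * ((n%:R * Delta n) `^ (- 1) * Delta n `^ (1 - 2 * H2))) @[n --> \oo])).
  by apply: near_eq_cvg; near=> n; rewrite E//; near: n; exact: nbhs_infty_gt.
apply: cvgD; apply: prod0.
- by apply: horizonX; lra.
- by apply: stepX; lra.
- by apply: horizonX; lra.
- by apply: stepX; lra.
Unshelve. all: end_near. Qed.

Lemma end_rate_cvg (H : R) : H < 1 -> (n%:R * Delta n `^ H)^-1 ^+ 2 @[n --> \oo] --> 0.
Proof.
move=> h.
have E n : (0 < n)%N -> (n%:R * Delta n `^ H)^-1 =
    1 * ((n%:R * Delta n) `^ (- 1) * Delta n `^ (1 - H)).
  move=> n0; have D0 := Delta0 n0; set D := Delta n in D0 *.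
  have nr0 : 0 < n%:R :> R by rewrite ltr0n.
  rewrite mul1r powR_inv1 ?mulr_ge0 ?ltW// powRB ?(gt_eqF D0) ?implybT// powRr1 ?ltW//.
  by field; rewrite !gt_eqF ?powR_gt0.
have c0 : 1 * ((n%:R * Delta n) `^ (- 1) * Delta n `^ (1 - H)) @[n --> \oo] --> 0.
  by apply: prod0; [apply: horizonX; lra|apply: stepX; lra].
rewrite [X in _ --> X](_ : 0 = 0 ^+ 2); last by rewrite expr0n.
apply: (@cvg_comp _ _ _ _ (fun z : R => z ^+ 2)); last exact: exprn_continuous.
apply: cvg_trans c0.
by apply: near_eq_cvg; near=> n; rewrite E//; near: n; exact: nbhs_infty_gt.
Unshelve. all: end_near. Qed.

End SamplingRates.

(** * From fixed lags to the estimators *)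

Section AverageLinear.
Context {d : measure_display} {Omega : measurableType d} {R : realType}.
Variable P : probability Omega R.

Lemma measurable_mean_square (F : R -> Omega -> R) :
  measurable_fun setT (fun z : measurableTypeR R * Omega => F z.1 z.2) ->
  measurable_fun setT (fun s : measurableTypeR R => mean_square P (F s)).
Proof.
move=> mF; apply: (@measurable_fun_fubini_tonelli_F _ _ _ _ _ P
  (fun z : measurableTypeR R * Omega => (F z.1 z.2 ^+ 2)%:E)).
  by apply/measurable_EFinP; exact: measurable_funX.
by move=> z; rewrite lee_fin sqr_ge0.
Qed.

Section OneComponent.
Variables (alpha nu : R) (B : R -> {RV P >-> R}) (K : R).
Hypothesis alpha0 : 0 < alpha.
Hypothesis cB : continuous_paths (fun t => B t : Omega -> R).
Hypothesis K0 : 0 <= K.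
Hypothesis BK : forall u, (mean_square P (B u) <= (K * (1 + u ^+ 2))%:E)%E.
Notation law := (exponential_law alpha0).
Notation Y := (fOU alpha nu B).
Notation U := (lag (fun t => B t : Omega -> R)).

(** The estimators are linear in each component.  This lemma treats one component,
    the other one entering through the coefficients [a] and [b]: they are values
    of the other process the first time, and of its lagged increments the second
    time. *)
Lemma average_linear (n : nat) (D c : R) (a b : nat -> Omega -> R) :
  (forall k, measurable_fun setT (a k)) -> (forall k, measurable_fun setT (b k)) ->
  let F s w := \sum_(0 <= k < n)
    (a k w * (nu * U D s k.+1 w) + b k w * (nu * U D s k w)) - c in
  measurable_fun setT (fun s : measurableTypeR R => mean_square P (F s)) /\
  (mean_square P (fun w => \sum_(0 <= k < n)
    (a k w * Y (k.+1%:R * D) w + b k w * Y (k%:R * D) w) - c)%R <=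
  \int[law]_s mean_square P (F s))%E.
Proof.
move=> ma mb F.
have mU k : measurable_fun setT
    (fun z : measurableTypeR R * Omega => U D z.1 k z.2).
  apply: measurable_funB.
    by apply: measurableT_comp => //; exact: measurable_snd.
  by apply: (@measurable_lag _ _ _ _ (fun u => B u : Omega -> R)) => // w; exact: cB.
have m2 (f : Omega -> R) : measurable_fun setT f ->
    measurable_fun setT (fun z : measurableTypeR R * Omega => f z.2).
  by move=> mf; apply: measurableT_comp => //; exact: measurable_snd.
have mF : measurable_fun setT (fun z : measurableTypeR R * Omega => F z.1 z.2).
  apply: measurable_funB => //; apply: measurable_sum => k.
  apply: measurable_funD; apply: measurable_funM; try exact: m2.
    by apply: measurable_funM => //; exact: mU.
  by apply: measurable_funM => //; exact: mU.
split; first exact: measurable_mean_square.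
apply: mean_square_average => //.
  apply: measurable_funB => //; apply: measurable_sum => k.
  apply: measurable_funD; apply: measurable_funM => //;
    exact: (measurable_fOU nu alpha0 cB K0 BK).
have aeF := ae_filter_ringOfSetsType P.
have : {ae P, forall w, forall k : nat, has_mean law
    (fun s => nu * (B (k%:R * D) w - B (k%:R * D - s) w)) (Y (k%:R * D) w)}.
  by apply/ae_foralln => k; exact: (fOU_has_mean nu alpha0 cB K0 BK).
apply: filterS => w hk.
have hs : has_mean law (fun s => \sum_(0 <= k < n)
    (a k w * (nu * U D s k.+1 w) + b k w * (nu * U D s k w)))
  (\sum_(0 <= k < n) (a k w * Y (k.+1%:R * D) w + b k w * Y (k%:R * D) w)).
  by apply: has_mean_sum => k _; apply: has_mean_lin; exact: hk.
have := has_mean_lin 1 (- c) hs (has_mean_cst law 1).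
by rewrite mul1r mulr1; apply: eq_has_mean => s; rewrite /= mul1r ?mulr1 /F.
Qed.

End OneComponent.

Variables (alpha1 alpha2 nu1 nu2 H K : R) (B1 B2 : R -> {RV P >-> R}).
Hypothesis alpha1_gt0 : 0 < alpha1.
Hypothesis alpha2_gt0 : 0 < alpha2.
Hypothesis nu1_gt0 : 0 < nu1.
Hypothesis nu2_gt0 : 0 < nu2.
Hypothesis cB1 : continuous_paths (fun t => B1 t : Omega -> R).
Hypothesis cB2 : continuous_paths (fun t => B2 t : Omega -> R).
Hypothesis K0 : 0 <= K.
Hypothesis BK1 : forall u, (mean_square P (B1 u) <= (K * (1 + u ^+ 2))%:E)%E.
Hypothesis BK2 : forall u, (mean_square P (B2 u) <= (K * (1 + u ^+ 2))%:E)%E.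
Notation law1 := (exponential_law alpha1_gt0).
Notation law2 := (exponential_law alpha2_gt0).
Notation Y1 := (fOU alpha1 nu1 B1).
Notation Y2 := (fOU alpha2 nu2 B2).
Notation b1 := (fun t => B1 t : Omega -> R).
Notation b2 := (fun t => B2 t : Omega -> R).

Let mY1 t : measurable_fun setT (Y1 t).
Proof. exact: (measurable_fOU nu1 alpha1_gt0 cB1 K0 BK1). Qed.
Let mY2 t : measurable_fun setT (Y2 t).
Proof. exact: (measurable_fOU nu2 alpha2_gt0 cB2 K0 BK2). Qed.
Let mlag1 D s k : measurable_fun setT (lag b1 D s k).
Proof. by apply: measurable_funB. Qed.

(** The interface between the estimators and dominated convergence: the error of
    [est] is at most an average, over a second order statistic [mid s1] where
    only the first process has been replaced by its increments of lag [s1], and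
    the error of the latter is an average over the second lag. *)
Definition averaged (est : Omega -> R) (form : R -> R -> Omega -> R) (c : R) : Prop :=
  exists mid : R -> Omega -> R,
  [/\ measurable_fun setT (fun s : measurableTypeR R => mean_square P (mid s)),
      (mean_square P (fun w => est w - c)%R <= \int[law1]_s mean_square P (mid s))%E,
      forall s1, measurable_fun setT
        (fun s2 : measurableTypeR R => mean_square P (fun w => form s1 s2 w - c)) &
      forall s1, (mean_square P (mid s1) <=
        \int[law2]_s2 mean_square P (fun w => form s1 s2 w - c)%R)%E].

Lemma measurable_rho_est n D : measurable_fun setT (rho_est nu1 nu2 H D Y1 Y2 n).
Proof.
apply: measurable_funM => //; apply: measurable_sum => k.
by apply: measurable_funM; exact: measurable_funB.
Qed.

Lemma measurable_eta_est n D : measurable_fun setT (eta_est nu1 nu2 H D Y1 Y2 n).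
Proof.
apply: measurable_funM => //; apply: measurable_sum => k.
by apply: measurable_funB; exact: measurable_funM.
Qed.

Let scaleE n D : nu1 * nu2 * (nu1 * nu2 * n%:R * D `^ H)^-1 = (n%:R * D `^ H)^-1.
Proof.
rewrite -(mulrA (nu1 * nu2)) invfM mulrA mulfV ?mul1r//.
by rewrite mulf_neq0// gt_eqF.
Qed.

Lemma rho_est_averaged n D c :
  averaged (rho_est nu1 nu2 H D Y1 Y2 n) (rho_form H b1 b2 n D) c.
Proof.
pose q := (nu1 * nu2 * n%:R * D `^ H)^-1.
pose dY2 (k : nat) w := q * (Y2 (k.+1%:R * D) w - Y2 (k%:R * D) w).
have mdY2 k : measurable_fun setT (dY2 k).
  by apply: measurable_funM => //; exact: measurable_funB.
have mNdY2 k : measurable_fun setT (fun w => -1 * dY2 k w) by exact: measurable_funM.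
have [m1 l1] := average_linear nu1 alpha1_gt0 cB1 K0 BK1 n D c mdY2 mNdY2.
pose dU s (k : nat) w := q * nu1 * (lag b1 D s k.+1 w - lag b1 D s k w).
have mdU s k : measurable_fun setT (dU s k).
  by apply: measurable_funM => //; exact: measurable_funB.
have mNdU s k : measurable_fun setT (fun w => -1 * dU s k w) by exact: measurable_funM.
have avg2 s := average_linear nu2 alpha2_gt0 cB2 K0 BK2 n D c (mdU s) (mNdU s).
have formE s1 s2 w : \sum_(0 <= k < n) (dU s1 k w * (nu2 * lag b2 D s2 k.+1 w) +
    -1 * dU s1 k w * (nu2 * lag b2 D s2 k w)) - c = rho_form H b1 b2 n D s1 s2 w - c.
  congr (_ - _); rewrite /rho_form -scaleE mulr_sumr; apply: eq_bigr => k _.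
  by rewrite /dU -/q; ring.
have form_fun s1 : (fun s2 => mean_square P (fun w => \sum_(0 <= k < n)
     (dU s1 k w * (nu2 * lag b2 D s2 k.+1 w) +
      -1 * dU s1 k w * (nu2 * lag b2 D s2 k w)) - c)) =
   (fun s2 => mean_square P (fun w => rho_form H b1 b2 n D s1 s2 w - c)).
  by apply/funext => s2; congr mean_square; apply/funext => w; exact: formE.
exists (fun s w => \sum_(0 <= k < n) (dY2 k w * (nu1 * lag b1 D s k.+1 w) +
    -1 * dY2 k w * (nu1 * lag b1 D s k w)) - c); split.
- exact: m1.
- apply: le_trans l1; rewrite le_eqVlt; apply/orP; left; apply/eqP.
  congr mean_square; apply/funext => w; congr (_ - _).
  rewrite /rho_est -/q mulr_sumr; apply: eq_bigr => k _.
  rewrite /dY2; move: (Y1 (k.+1%:R * D) w) (Y1 (k%:R * D) w) (Y2 (k.+1%:R * D) w) (Y2 (k%:R * D) w)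
    => y1' y1 y2' y2; ring.
- by move=> s1; have [] := avg2 s1; rewrite form_fun.
- move=> s1; have [_] := avg2 s1; rewrite form_fun; apply: le_trans.
  rewrite le_eqVlt; apply/orP; left; apply/eqP.
  congr mean_square; apply/funext => w; congr (_ - _).
  apply: eq_bigr => k _; rewrite /dY2 /dU.
  move: (Y2 (k.+1%:R * D) w) (Y2 (k%:R * D) w) => y2' y2; ring.
Qed.

Lemma eta_est_averaged n D c :
  averaged (eta_est nu1 nu2 H D Y1 Y2 n) (eta_form H b1 b2 n D) c.
Proof.
pose q := (nu1 * nu2 * n%:R * D `^ H)^-1.
pose a (k : nat) w := - q * Y2 (k%:R * D) w.
pose b (k : nat) w := q * Y2 (k.+1%:R * D) w.
have ma k : measurable_fun setT (a k) by exact: measurable_funM.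
have mb k : measurable_fun setT (b k) by exact: measurable_funM.
have [m1 l1] := average_linear nu1 alpha1_gt0 cB1 K0 BK1 n D c ma mb.
pose a' s (k : nat) w := q * nu1 * lag b1 D s k w.
pose b' s (k : nat) w := - (q * nu1) * lag b1 D s k.+1 w.
have ma' s k : measurable_fun setT (a' s k) by exact: measurable_funM.
have mb' s k : measurable_fun setT (b' s k) by exact: measurable_funM.
have avg2 s := average_linear nu2 alpha2_gt0 cB2 K0 BK2 n D c (ma' s) (mb' s).
have formE s1 s2 w : \sum_(0 <= k < n) (a' s1 k w * (nu2 * lag b2 D s2 k.+1 w) +
    b' s1 k w * (nu2 * lag b2 D s2 k w)) - c = eta_form H b1 b2 n D s1 s2 w - c.
  congr (_ - _); rewrite /eta_form -scaleE mulr_sumr; apply: eq_bigr => k _.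
  by rewrite /a' /b' -/q; ring.
have form_fun s1 : (fun s2 => mean_square P (fun w => \sum_(0 <= k < n)
     (a' s1 k w * (nu2 * lag b2 D s2 k.+1 w) +
      b' s1 k w * (nu2 * lag b2 D s2 k w)) - c)) =
   (fun s2 => mean_square P (fun w => eta_form H b1 b2 n D s1 s2 w - c)).
  by apply/funext => s2; congr mean_square; apply/funext => w; exact: formE.
exists (fun s w => \sum_(0 <= k < n) (a k w * (nu1 * lag b1 D s k.+1 w) +
    b k w * (nu1 * lag b1 D s k w)) - c); split.
- exact: m1.
- apply: le_trans l1; rewrite le_eqVlt; apply/orP; left; apply/eqP.
  congr mean_square; apply/funext => w; congr (_ - _).
  rewrite /eta_est -/q mulr_sumr; apply: eq_bigr => k _.
  rewrite /a /b; move: (Y1 (k.+1%:R * D) w) (Y1 (k%:R * D) w) (Y2 (k.+1%:R * D) w) (Y2 (k%:R * D) w)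
    => y1' y1 y2' y2; ring.
- by move=> s1; have [] := avg2 s1; rewrite form_fun.
- move=> s1; have [_] := avg2 s1; rewrite form_fun; apply: le_trans.
  rewrite le_eqVlt; apply/orP; left; apply/eqP.
  congr mean_square; apply/funext => w; congr (_ - _).
  apply: eq_bigr => k _; rewrite /a /b /a' /b'.
  move: (Y2 (k.+1%:R * D) w) (Y2 (k%:R * D) w) => y2' y2; ring.
Qed.

End AverageLinear.

Section AverageConvergence.
Context {R : realType}.

Definition quadratic_mass (alpha : R) (alpha0 : 0 < alpha) : R :=
  fine (\int[exponential_law alpha0]_s (1 + s ^+ 2)%:E)%E.

Lemma quadratic_massE (alpha : R) (alpha0 : 0 < alpha) :
  (\int[exponential_law alpha0]_s (1 + s ^+ 2)%:E)%E = (quadratic_mass alpha0)%:E.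
Proof.
rewrite /quadratic_mass fineK// ge0_fin_numE ?exponential_moment2//.
by apply: integral_ge0 => s _; rewrite lee_fin addr_ge0// sqr_ge0.
Qed.

Let mquad : measurable_fun setT (fun s : measurableTypeR R => (1 + s ^+ 2)%:E).
Proof.
apply/measurable_EFinP; apply: measurable_funD; first exact: measurable_cst.
by apply: measurable_funX; exact: measurable_id.
Qed.

Lemma average_le (alpha : R) (alpha0 : 0 < alpha) (G : R -> \bar R) (C : R) :
  measurable_fun setT (G : measurableTypeR R -> \bar R) -> (forall s, 0 <= G s)%E ->
  0 <= C -> (forall s, 0 < s -> (G s <= (C * (1 + s ^+ 2))%:E)%E) ->
  (\int[exponential_law alpha0]_s G s <= (C * quadratic_mass alpha0)%:E)%E.
Proof.
move=> mG G0 C0 GC; rewrite EFinM -quadratic_massE -ge0_integralZl//; last first.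
  by move=> s _; rewrite lee_fin addr_ge0// sqr_ge0.
apply: ae_ge0_le_integral => //.
- by move=> s _; rewrite mule_ge0// lee_fin addr_ge0// sqr_ge0.
- by apply: emeasurable_funM => //; exact: mquad.
have F := ae_filter_ringOfSetsType (exponential_law alpha0).
by move: (ae_exponential_gt0 alpha0); apply: filterS => s s0 _; rewrite -EFinM GC.
Qed.

Lemma average_cvg0 (alpha : R) (alpha0 : 0 < alpha) (G : nat -> R -> \bar R)
    (C x : R) (N : nat) :
  (forall n, (N <= n)%N -> measurable_fun setT (G n : measurableTypeR R -> \bar R)) ->
  (forall n s, 0 <= G n s)%E ->
  (forall n s, (N <= n)%N -> 0 < s -> (G n s <= (C * (1 + s ^+ 2))%:E)%E) ->
  (forall s, 0 < s -> s != x -> G n s @[n --> \oo] --> 0%E) ->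
  (\int[exponential_law alpha0]_s G n s)%E @[n --> \oo] --> 0%E.
Proof.
move=> mG G0 GC Gcvg.
have F := ae_filter_ringOfSetsType (exponential_law alpha0).
rewrite -(cvg_shiftn N).
have := @dominated_convergence _ (measurableTypeR R) R (exponential_law alpha0) setT
  measurableT (fun n s => G (n + N)%N s) (cst 0%E)
  (fun s => (`|C|)%:E * (1 + s ^+ 2)%:E)%E.
case => //.
- by move=> n; apply: mG; rewrite leq_addl.
- have := ae_exponential_gt0 alpha0; have := ae_exponential_neq alpha0 x.
  apply: filterS2 => s sx s0 _.
  have := Gcvg s s0 sx; rewrite -(cvg_shiftn N).
  exact.
- apply: integrableZl => //; apply/integrableP; split; first exact: mquad.
  apply: le_lt_trans (exponential_moment2 alpha0).
  rewrite le_eqVlt; apply/orP; left; apply/eqP; apply: eq_integral => s _.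
  by rewrite gee0_abs// lee_fin addr_ge0// sqr_ge0.
- have := ae_exponential_gt0 alpha0; apply: filterS => s s0 n _.
  rewrite gee0_abs// (le_trans (GC _ _ (leq_addl _ _) s0))// -EFinM lee_fin.
  by rewrite ler_wpM2r ?ler_norm// addr_ge0// sqr_ge0.
move=> _ _; rewrite integral_cst// mul0e; exact.
Qed.

End AverageConvergence.

Section Averaged.
Context {d : measure_display} {Omega : measurableType d} {R : realType}.
Variable P : probability Omega R.
Variables (alpha1 alpha2 : R) (alpha1_gt0 : 0 < alpha1) (alpha2_gt0 : 0 < alpha2).

(** Dominated convergence in the second lag, then in the first.  The diagonal
    [s1 = s2], where the errors need not vanish, is negligible. *)
Lemma averaged_cvg (est : nat -> Omega -> R) (form : nat -> R -> R -> Omega -> R)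
    (c : R) (r : nat -> R -> R -> R) (K : nat -> R) (C : R) :
  (forall n, averaged P alpha1_gt0 alpha2_gt0 (est n) (form n) c) ->
  (forall n s1 s2, (0 < n)%N -> 0 < s1 -> 0 < s2 ->
     (mean_square P (fun w => form n s1 s2 w - c)%R <= (r n s1 s2)%:E)%E /\
     0 <= r n s1 s2 <= K n * ((1 + s1 ^+ 2) * (1 + s2 ^+ 2))) ->
  (forall n, 0 <= K n) ->
  (\forall n \near \oo, K n <= C) ->
  (forall s1 s2, 0 < s1 -> 0 < s2 -> s1 != s2 -> r n s1 s2 @[n --> \oo] --> 0) ->
  (forall n, (0 < n)%N -> (mean_square P (fun w => est n w - c)%R < +oo)%E) /\
  mean_square P (fun w => est n w - c) @[n --> \oo] --> 0%E.
Proof.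
move=> avg formr K0 KC rcvg.
have [mid midP] := choice avg.
have [N _ NC] := KC.
have C0 : 0 <= C by have := NC N (leqnn _); exact: le_trans.
set m1 := quadratic_mass alpha1_gt0; set m2 := quadratic_mass alpha2_gt0.
have m20 : 0 <= m2.
  by apply: fine_ge0; apply: integral_ge0 => s _; rewrite lee_fin addr_ge0// sqr_ge0.
have quad0 (s : R) : 0 <= 1 + s ^+ 2 by rewrite addr_ge0// sqr_ge0.
have form_le n s1 s2 : (0 < n)%N -> 0 < s1 -> 0 < s2 ->
    (mean_square P (fun w => form n s1 s2 w - c)%R <=
      (K n * (1 + s1 ^+ 2) * (1 + s2 ^+ 2))%:E)%E.
  move=> n0 s10 s20; have [f1 /andP[_ f2]] := formr n s1 s2 n0 s10 s20.
  by apply: (le_trans f1); rewrite lee_fin -mulrA.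
have mid_le n s1 : (0 < n)%N -> 0 < s1 ->
    (mean_square P (mid n s1) <= (K n * m2 * (1 + s1 ^+ 2))%:E)%E.
  move=> n0 s10; have [_ _ mform midle] := midP n.
  apply: (le_trans (midle s1)).
  rewrite (_ : K n * m2 * _ = K n * (1 + s1 ^+ 2) * m2); last by ring.
  apply: (@average_le _ _ alpha2_gt0
    (fun s2 => mean_square P (fun w => form n s1 s2 w - c)%R)).
  - exact: (mform s1).
  - by move=> s; exact: mean_square_ge0.
  - by rewrite mulr_ge0.
  - by move=> s s0; exact: form_le.
split.
  move=> n n0; have [mmid estle _ _] := midP n.
  apply: (le_lt_trans estle).
  apply: (@le_lt_trans _ _ (K n * m2 * m1)%:E); last by rewrite ltry.
  apply: (@average_le _ _ alpha1_gt0 (fun s => mean_square P (mid n s))).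
  - exact: mmid.
  - by move=> s; exact: mean_square_ge0.
  - by rewrite mulr_ge0.
  - by move=> s s0; exact: mid_le.
have squeeze0 (u v : nat -> \bar R) : (forall n, 0 <= u n <= v n)%E ->
    v n @[n --> \oo] --> 0%E -> u n @[n --> \oo] --> 0%E.
  by move=> uv; apply: squeeze_cvge (cvg_cst _); apply: nearW.
have near1 : (0 < N.+1)%N by [].
apply: (squeeze0 _ (fun n => \int[exponential_law alpha1_gt0]_s mean_square P (mid n s))%E).
  by move=> n; have [_ estle _ _] := midP n; rewrite mean_square_ge0.
apply: (@average_cvg0 _ _ alpha1_gt0 _ (C * m2) 0 N.+1).
- by move=> n _; have [] := midP n.
- by move=> n s; exact: mean_square_ge0.
- move=> n s Nn s0; have n0 : (0 < n)%N by exact: leq_trans Nn.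
  apply: (le_trans (mid_le n s n0 s0)); rewrite lee_fin ler_wpM2r// ler_wpM2r//.
  by apply: NC; exact: ltnW.
move=> s1 s10 _.
apply: (squeeze0 _ (fun n => \int[exponential_law alpha2_gt0]_s
    mean_square P (fun w => form n s1 s w - c)%R)%E).
  by move=> n; have [_ _ _ midle] := midP n; rewrite mean_square_ge0/=; exact: midle.
apply: (@average_cvg0 _ _ alpha2_gt0 _ (C * (1 + s1 ^+ 2)) s1 N.+1).
- by move=> n _; have [_ _ + _] := midP n; apply.
- by move=> n s; exact: mean_square_ge0.
- move=> n s Nn s0; have n0 : (0 < n)%N by exact: leq_trans Nn.
  apply: (le_trans (form_le n s1 s n0 s10 s0)); rewrite lee_fin ler_wpM2r// ler_wpM2r//.
  by apply: NC; exact: ltnW.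
move=> s2 s20 s21.
apply: (@squeeze_cvge _ _ _ _ (cst 0%E) _ (fun n => (r n s1 s2)%:E)).
- near=> n; have n0 : (0 < n)%N by near: n; exact: nbhs_infty_gt.
  by have [f1 _] := formr n s1 s2 n0 s10 s20; rewrite mean_square_ge0.
- exact: cvg_cst.
- by apply: cvg_EFin; [exact: nearW|apply: rcvg; rewrite // eq_sym].
Unshelve. all: end_near. Qed.

End Averaged.

(** * Covariances of a bivariate fractional Brownian motion *)

Section FractionalPair.
Context {d : measure_display} {Omega : measurableType d} {R : realType}.
Variable P : probability Omega R.

Lemma covariance_centered (X Y : Omega -> R) (c : R) : ('E_P[X] = 0)%E -> ('E_P[Y] = 0)%E ->
  covariance P X Y = c%:E -> cov P X Y = c.
Proof.
move=> X0 Y0 XYc; rewrite /cov /Rintegral.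
have : ('E_P[X \* Y] = c%:E)%E.
  rewrite -XYc [in RHS]unlock X0 Y0; congr expectation.
  apply/funext => w; change (X w * Y w = (X w - 0) * (Y w - 0)); by rewrite !subr0.
by rewrite unlock => ->.
Qed.

(** The terms [f1] and [f2] depend on one time only and cancel in increments. *)
Lemma cov_incr V (b1 b2 : R -> Omega -> R) (g f1 f2 : R -> R) :
  gaussian_space P V -> (forall t, V (b1 t)) -> (forall t, V (b2 t)) ->
  (forall t u, cov P (b1 t) (b2 u) = 2^-1 * (f1 t + f2 u - g (u - t))) ->
  forall x y z u, cov P (incr b1 x y) (incr b2 z u) = incr_cov g x y z u.
Proof.
move=> gV V1 V2 covE x y z u.
have linE (b : R -> Omega -> R) s t : incr b s t = (fun w => 1 * b s w + -1 * b t w).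
  by apply/funext => w; rewrite /incr mul1r mulN1r.
have V2' : V (incr b2 z u) := incr_mem gV z u V2.
rewrite linE (cov_linl gV)//.
by rewrite !linE !(cov_linr gV)// !covE /incr_cov; ring.
Qed.

Variables (H1 H2 rho eta12 : R) (B1 B2 : R -> {RV P >-> R}).
Hypothesis H1_01 : 0 < H1 < 1.
Hypothesis H2_01 : 0 < H2 < 1.
Hypothesis B_bfBm : is_bfBm H1 H2 B1 B2.
Notation b1 := (fun t => B1 t : Omega -> R).
Notation b2 := (fun t => B2 t : Omega -> R).

Lemma fBm_cov (H : R) (B : R -> {RV P >-> R}) : is_fBm H B -> ('V_P[B 1%R] = 1)%E ->
  forall t u, cov P (B t) (B u) =
    2^-1 * (`|t| `^ (2 * H) + `|u| `^ (2 * H) - `|u - t| `^ (2 * H)).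
Proof.
move=> [_ cB _ covB] V1 t u; apply: covariance_centered; [exact: cB|exact: cB|].
by rewrite covB V1 mul1e.
Qed.

Lemma both_space : gaussian_space P (process_span (both B1 B2)).
Proof.
apply: process_span_gaussian.
- by case=> t; exact: measurable_funP.
- exact: bfBm_gaussian B_bfBm.
- exact: bfBm_centered B_bfBm.
Qed.

Let V1 t : process_span (both B1 B2) (B1 t).
Proof. exact: (process_span_mem (both B1 B2) (inl t)). Qed.
Let V2 t : process_span (both B1 B2) (B2 t).
Proof. exact: (process_span_mem (both B1 B2) (inr t)). Qed.

Lemma bfBm_fbm_pair : bfBm_correlations H1 H2 rho eta12 B1 B2 -> H1 + H2 != 1 ->
  fbm_pair P (process_span (both B1 B2)) H1 H2 (rho - eta12) (rho + eta12) b1 b2.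
Proof.
move=> [_ crossB] Hneq; split => //; first exact: both_space.
- apply: (cov_incr (V := process_span (both B1 B2)) (f1 := fun t => `|t| `^ (2 * H1))
    (f2 := fun t => `|t| `^ (2 * H1))) => //; first exact: both_space.
  move=> t u; rewrite (fBm_cov (bfBm_fBm1 B_bfBm) (bfBm_var1 B_bfBm)).
  by rewrite /signed_power if_same mul1r.
- apply: (cov_incr (V := process_span (both B1 B2)) (f1 := fun t => `|t| `^ (2 * H2))
    (f2 := fun t => `|t| `^ (2 * H2))) => //; first exact: both_space.
  move=> t u; rewrite (fBm_cov (bfBm_fBm2 B_bfBm) (bfBm_var2 B_bfBm)).
  by rewrite /signed_power if_same mul1r.
- apply: (cov_incr (V := process_span (both B1 B2))
    (f1 := fun t => (rho + sign t * eta12) * `|t| `^ (H1 + H2))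
    (f2 := fun t => (rho - sign t * eta12) * `|t| `^ (H1 + H2))) => //.
    exact: both_space.
  move=> t u; rewrite (covariance_centered _ _ (crossB Hneq t u)).
  + congr (_ * (_ - _)); rewrite /signed_power /sign; case: ifP => _; congr (_ * _); ring.
  + exact: (bfBm_centered B_bfBm (inl t)).
  + exact: (bfBm_centered B_bfBm (inr u)).
Qed.

Lemma fBm_mean_square (H : R) (B : R -> {RV P >-> R}) V : gaussian_space P V ->
  (forall t, V (B t)) -> 0 < H < 1 -> is_fBm H B -> ('V_P[B 1%R] = 1)%E ->
  forall u, (mean_square P (B u) <= (1 * (1 + u ^+ 2))%:E)%E.
Proof.
move=> gV VB /andP[h0 h1] fB v1 u.
rewrite (has_mean_square (m := cov P (B u) (B u))).
  rewrite (fBm_cov fB v1) subrr normr0 powR0 ?mulf_neq0// ?gt_eqF// lee_fin mul1r subr0.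
  have : `|u| `^ (2 * H) <= 1 + u ^+ 2; last by lra.
  rewrite -(real_normK (num_real u)); have [->|u0] := eqVneq u 0.
    by rewrite normr0 powR0 ?mulf_neq0// ?gt_eqF// addr_ge0// sqr_ge0.
  by apply: powR_le_quadratic; [lra|rewrite normr_gt0].
by have := has_mean_prod2 gV (VB u) (VB u); apply: eq_has_mean => w; rewrite expr2.
Qed.

Lemma bfBm_mean_square1 u : (mean_square P (B1 u) <= (1 * (1 + u ^+ 2))%:E)%E.
Proof.
exact: (fBm_mean_square both_space V1 H1_01 (bfBm_fBm1 B_bfBm) (bfBm_var1 B_bfBm)).
Qed.

Lemma bfBm_mean_square2 u : (mean_square P (B2 u) <= (1 * (1 + u ^+ 2))%:E)%E.
Proof.
exact: (fBm_mean_square both_space V2 H2_01 (bfBm_fBm2 B_bfBm) (bfBm_var2 B_bfBm)).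
Qed.

End FractionalPair.

(** * Consistency of the estimators *)

Section MeanSquareConvergence.
Context {d : measure_display} {Omega : measurableType d} {R : realType}.
Variable P : probability Omega R.

Lemma Lnorm_mean_square (f : Omega -> R) : (mean_square P f < +oo)%E ->
  ('N[P]_2%:E[EFin \o f] = (Num.sqrt (fine (mean_square P f)))%:E)%E.
Proof.
move=> foo; rewrite unlock /Lnorm.
have -> : (\int[P]_x `|(EFin \o f) x| `^ 2 = (fine (mean_square P f))%:E)%E.
  rewrite fineK ?ge0_fin_numE ?mean_square_ge0//; apply: eq_integral => w _.
  by rewrite /= powR_mulrn// real_normK// num_real.
by rewrite poweR_EFin powR12_sqrt// fine_ge0// mean_square_ge0.
Qed.

Lemma Lfun_mean_square (f : Omega -> R) (c : R) : measurable_fun setT f ->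
  (mean_square P (fun w => f w - c)%R < +oo)%E -> f \in Lfun P 2%:E.
Proof.
move=> mf foo; have mfc : measurable_fun setT (fun w => f w - c).
  by apply: measurable_funB.
have -> : f = (fun w => f w - c) \+ cst c by apply/funext => w /=; rewrite subrK.
have p1 : (1 <= 2%:E :> \bar R)%E by rewrite lee_fin ler1n.
have [_ LfunD] := Lfun_addr_closed P p1.
apply: LfunD; last exact: Lfun_cst.
rewrite inE; apply/andP; split; rewrite inE//=.
by rewrite /finite_norm Lnorm_mean_square// ltry.
Qed.

(** The bound in probability is Chebyshev's inequality. *)
Lemma mean_square_cvg (X : nat -> Omega -> R) (c : R) :
  (forall n, measurable_fun setT (X n)) -> X 0%N =1 cst 0 ->
  (forall n, (0 < n)%N -> (mean_square P (fun w => X n w - c)%R < +oo)%E) ->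
  mean_square P (fun w => X n w - c) @[n --> \oo] --> 0%E ->
  cvg_in_L2 P X c /\ cvg_in_probability P X c.
Proof.
move=> mX X0 Xoo Xcvg; split; [split|].
- case=> [|n]; last by apply: (@Lfun_mean_square _ c); [exact: mX|exact: Xoo].
  by rewrite (funext X0); exact: Lfun_cst.
- apply: (@cvg_trans _ ((Num.sqrt (fine (mean_square P (fun w => X n w - c))))%:E @[n --> \oo])).
    apply: near_eq_cvg; near=> n; rewrite -Lnorm_mean_square//.
    by apply: Xoo; near: n; exact: nbhs_infty_gt.
  have -> : (0 = (Num.sqrt 0)%:E :> \bar R)%E by rewrite sqrtr0.
  apply: cvg_EFin; first exact: nearW.
  apply: (@cvg_comp _ _ _ (fun n => fine (mean_square P (fun w => X n w - c)))
    Num.sqrt \oo (nbhs (0 : R))); last exact: sqrt_continuous.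
  by have /fine_cvgP [] := Xcvg.
- move=> e e0.
  apply: (@squeeze_cvge _ _ _ _ (cst 0%E) _
    (fun n => (e ^- 2)%:E * mean_square P (fun w => X n w - c)%R)%E).
  + apply: nearW => n; rewrite measure_ge0/=.
    have mXc : measurable_fun setT (fun w => X n w - c) by apply: measurable_funB.
    have e20 : 0 < e ^+ 2 by rewrite exprn_gt0.
    rewrite -lee_pdivrMl ?invr_gt0//.
    have msq : measurable_fun setT (fun w => ((X n w - c) ^+ 2)%:E).
      by apply/measurable_EFinP; exact: measurable_funX.
    have sqrE w : (`|((X n w - c) ^+ 2)%:E| = ((X n w - c) ^+ 2)%:E :> \bar R)%E.
      by rewrite gee0_abs// lee_fin sqr_ge0.
    have := le_integral_abse P measurableT msq e20.
    rewrite setTI invrK; under eq_integral do rewrite sqrE.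
    apply: le_trans; apply: lee_wpmul2l; first by rewrite lee_fin ltW.
    apply: le_measure; rewrite ?inE.
    * rewrite -[X in measurable X]setTI.
      apply: (@emeasurable_fun_o_infty _ Omega R setT (fun w => (`|X n w - c|)%:E) _ _ e%:E) => //.
      by apply/measurable_EFinP; exact: measurableT_comp.
    * rewrite -[X in measurable X]setTI; apply: emeasurable_fun_c_infty => //.
      exact: measurableT_comp.
    * move=> w /= ew; rewrite normrX lee_fin.
      apply: lerXn2r; rewrite ?nnegrE ?normr_ge0 ?(ltW e0)//; exact: ltW.
  + exact: cvg_cst.
  + by have := cvgeZl (y := (e ^- 2)%:E) isT Xcvg; rewrite mule0.
Unshelve. all: end_near. Qed.

End MeanSquareConvergence.

Section Consistency.
Context {d : measure_display} {Omega : measurableType d} {R : realType}.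
Variable P : probability Omega R.
Variables (alpha1 alpha2 nu1 nu2 H1 H2 cp cm : R) (B1 B2 : R -> {RV P >-> R}).
Variables (V : set (Omega -> R)) (Delta : nat -> R).
Hypothesis alpha1_gt0 : 0 < alpha1.
Hypothesis alpha2_gt0 : 0 < alpha2.
Hypothesis nu1_gt0 : 0 < nu1.
Hypothesis nu2_gt0 : 0 < nu2.
Hypothesis H1_01 : 0 < H1 < 1.
Hypothesis H2_01 : 0 < H2 < 1.
Notation b1 := (fun t => B1 t : Omega -> R).
Notation b2 := (fun t => B2 t : Omega -> R).
Hypothesis hb : fbm_pair P V H1 H2 cp cm b1 b2.
Hypothesis cB1 : continuous_paths b1.
Hypothesis cB2 : continuous_paths b2.
Hypothesis BK1 : forall u, (mean_square P (B1 u) <= (1 * (1 + u ^+ 2))%:E)%E.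
Hypothesis BK2 : forall u, (mean_square P (B2 u) <= (1 * (1 + u ^+ 2))%:E)%E.
Hypothesis Delta_gt0 : forall n, (0 < n)%N -> 0 < Delta n.
Hypothesis Delta_cvg : Delta n @[n --> \oo] --> 0.
Hypothesis horizon_cvg : n%:R * Delta n @[n --> \oo] --> +oo.
Notation H := (H1 + H2).
Notation Y1 := (fOU alpha1 nu1 B1).
Notation Y2 := (fOU alpha2 nu2 B2).

Lemma rho_est_cvg :
  cvg_in_L2 P (fun n => rho_est nu1 nu2 H (Delta n) Y1 Y2 n) (2^-1 * (cp + cm)) /\
  cvg_in_probability P (fun n => rho_est nu1 nu2 H (Delta n) Y1 Y2 n) (2^-1 * (cp + cm)).
Proof.
have [r [K [rP rcvg]]] := rho_form_rate hb H1_01 H2_01.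
have [|||||fin cvg] := @averaged_cvg _ _ _ P _ _ alpha1_gt0 alpha2_gt0
  (fun n => rho_est nu1 nu2 H (Delta n) Y1 Y2 n) (fun n => rho_form H b1 b2 n (Delta n))
  (2^-1 * (cp + cm)) (fun n => r n (Delta n)) (fun=> `|K|) `|K|.
- by move=> n; exact: (rho_est_averaged H alpha1_gt0 alpha2_gt0 nu1_gt0 nu2_gt0
    cB1 cB2 ler01 BK1 BK2).
- move=> n s1 s2 n0 s10 s20.
  have [le1 /andP[r0 rK]] := rP n (Delta n) s1 s2 n0 (Delta_gt0 n0).
  split=> //; rewrite r0/=; apply: (le_trans rK); apply: (le_trans (ler_norm K)).
  rewrite ler_peMr// -[leLHS]mulr1; apply: ler_pM => //; rewrite lerDl sqr_ge0//.
- by move=> n; exact: normr_ge0.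
- exact: nearW.
- by move=> s1 s2 s10 s20 s12; exact: rcvg.
apply: mean_square_cvg => //.
  by move=> n; exact: (measurable_rho_est nu1 nu2 H alpha1_gt0 alpha2_gt0 cB1 cB2 ler01 BK1 BK2).
by move=> w; rewrite /rho_est big_geq// mulr0.
Qed.

(** With [H1 + H2 < 1], the assumption [H2 <= H1] gives [2 * H2 < 1], as required
    by [row_rate_cvg]. *)
Lemma eta_est_cvg : H < 1 -> H2 <= H1 ->
  cvg_in_L2 P (fun n => eta_est nu1 nu2 H (Delta n) Y1 Y2 n) (2^-1 * (cm - cp)) /\
  cvg_in_probability P (fun n => eta_est nu1 nu2 H (Delta n) Y1 Y2 n) (2^-1 * (cm - cp)).
Proof.
move=> Hlt1 H21.
have [r [K [rP rcvg]]] := eta_form_rate hb H1_01 H2_01 Hlt1.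
have rows : row_rate H1 H2 n (Delta n) @[n --> \oo] --> 0.
  by apply: row_rate_cvg => //; case/andP: H1_01 => *; lra.
have ends := end_rate_cvg Delta_gt0 Delta_cvg horizon_cvg Hlt1.
have [|||||fin cvg] := @averaged_cvg _ _ _ P _ _ alpha1_gt0 alpha2_gt0
  (fun n => eta_est nu1 nu2 H (Delta n) Y1 Y2 n) (fun n => eta_form H b1 b2 n (Delta n))
  (2^-1 * (cm - cp)) (fun n => r n (Delta n))
  (fun n => `|K| * (1 + row_rate H1 H2 n (Delta n) + (n%:R * Delta n `^ H)^-1 ^+ 2))
  (`|K| * 3).
- by move=> n; exact: (eta_est_averaged H alpha1_gt0 alpha2_gt0 nu1_gt0 nu2_gt0
    cB1 cB2 ler01 BK1 BK2).
- move=> n s1 s2 n0 s10 s20.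
  have [le1 /andP[r0 rK]] := rP n (Delta n) s1 s2 n0 (Delta_gt0 n0) s10 s20.
  split=> //; rewrite r0/=; apply: (le_trans rK); rewrite ler_wpM2r//.
    by rewrite mulr_ge0// addr_ge0// sqr_ge0.
  by rewrite ler_wpM2r ?ler_norm// !addr_ge0// ?row_rate_ge0// sqr_ge0.
- by move=> n; rewrite mulr_ge0// !addr_ge0// ?row_rate_ge0// sqr_ge0.
- near=> n; rewrite ler_wpM2l//.
  have : row_rate H1 H2 n (Delta n) <= 1.
    by near: n; move/cvgr_le : rows; apply; exact: ltr01.
  have : (n%:R * Delta n `^ H)^-1 ^+ 2 <= 1.
    by near: n; move/cvgr_le : ends; apply; exact: ltr01.
  by move=> *; lra.
- by move=> s1 s2 s10 s20 s12; exact: rcvg.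
apply: mean_square_cvg => //.
  by move=> n; exact: (measurable_eta_est nu1 nu2 H alpha1_gt0 alpha2_gt0 cB1 cB2 ler01 BK1 BK2).
by move=> w; rewrite /eta_est big_geq// mulr0.
Unshelve. all: end_near. Qed.

End Consistency.

Lemma eta_est_swap (Omega : Type) (R : realType) (nu1 nu2 H D : R)
    (Y1 Y2 : R -> Omega -> R) (n : nat) (w : Omega) :
  eta_est nu1 nu2 H D Y1 Y2 n w = - eta_est nu2 nu1 H D Y2 Y1 n w.
Proof.
rewrite /eta_est (mulrC nu2) -mulrN -sumrN; congr (_ * _).
by apply: eq_bigr => k _; ring.
Qed.

Lemma cvg_opp (d : measure_display) (Omega : measurableType d) (R : realType)
    (P : probability Omega R) (X Z : nat -> Omega -> R) (c : R) :
  (forall n w, Z n w = - X n w) ->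
  cvg_in_L2 P X (- c) /\ cvg_in_probability P X (- c) ->
  cvg_in_L2 P Z c /\ cvg_in_probability P Z c.
Proof.
move=> ZX [[XL Xc] Xp]; have -> : Z = (fun n => \- X n).
  by apply/funext => n; apply/funext => w; rewrite ZX.
have distE n w : - X n w - c = - (X n w - - c) by rewrite opprK opprD.
split; first split.
- move=> n; exact: (Lfun_oppr_closed (XL n)).
- move: Xc; apply: cvg_trans; apply: near_eq_cvg; apply: nearW => n.
  rewrite -oppe_Lnorm; apply: eq_Lnorm => w /=.
  by rewrite distE EFinN.
- move=> e e0; have := Xp e e0; apply: cvg_trans; apply: near_eq_cvg; apply: nearW => n.
  by congr (P _); apply/seteqP; split => w /=; rewrite distE normrN.
Qed.


Theorem theorem3p14 (R : realType) (d : measure_display)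
  (Omega : measurableType d) (P : probability Omega R)
  (alpha1 alpha2 nu1 nu2 H1 H2 rho eta12 : R)
  (B1 B2 : R -> {RV P >-> R}) (T : nat -> R)
  (alpha1_gt0 : 0 < alpha1) (alpha2_gt0 : 0 < alpha2)
  (nu1_gt0 : 0 < nu1) (nu2_gt0 : 0 < nu2)
  (H1_01 : 0 < H1 < 1) (H1_neq : H1 != 2^-1)
  (H2_01 : 0 < H2 < 1) (H2_neq : H2 != 2^-1)
  (B_bfBm : is_bfBm H1 H2 B1 B2)
  (B_corr : bfBm_correlations H1 H2 rho eta12 B1 B2)
  (T_gt0 : forall n, (0 < n)%N -> 0 < T n) :
  let H := H1 + H2 in
  let Delta := fun n : nat => T n / n%:R in
  let Y1 := fOU alpha1 nu1 B1 in
  let Y2 := fOU alpha2 nu2 B2 in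
  let rho_ := fun n => rho_est nu1 nu2 H (Delta n) Y1 Y2 n in
  let eta_ := fun n => eta_est nu1 nu2 H (Delta n) Y1 Y2 n in
  Delta n @[n --> \oo] --> (0 : R) ->
  n%:R * Delta n @[n --> \oo] --> +oo ->
  (0 < H < 2 -> H != 1 ->
     cvg_in_L2 P rho_ rho /\ cvg_in_probability P rho_ rho) /\
  (0 < H < 1 ->
     cvg_in_L2 P eta_ eta12 /\ cvg_in_probability P eta_ eta12).
Proof.
move=> H Delta Y1 Y2 rho_ eta_ Delta_cvg horizon_cvg.
have Delta_gt0 n : (0 < n)%N -> 0 < Delta n.
  by move=> n0; rewrite divr_gt0 ?T_gt0// ltr0n.
have cB1 := fBm_continuous (bfBm_fBm1 B_bfBm).
have cB2 := fBm_continuous (bfBm_fBm2 B_bfBm).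
have BK1 := bfBm_mean_square1 H1_01 B_bfBm.
have BK2 := bfBm_mean_square2 H2_01 B_bfBm.
split=> [_ Hneq1|/andP[H_gt0 Hlt1]].
  have hb := bfBm_fbm_pair B_bfBm B_corr Hneq1.
  have -> : rho = 2^-1 * ((rho - eta12) + (rho + eta12)) by field.
  exact: (rho_est_cvg alpha1_gt0 alpha2_gt0 nu1_gt0 nu2_gt0 H1_01 H2_01 hb).
have hb := bfBm_fbm_pair B_bfBm B_corr (negbT (lt_eqF Hlt1)).
have [H21|/ltW H12] := leP H2 H1.
  have -> : eta12 = 2^-1 * ((rho + eta12) - (rho - eta12)) by field.
  exact: (eta_est_cvg alpha1_gt0 alpha2_gt0 nu1_gt0 nu2_gt0 H1_01 H2_01 hb).
apply: cvg_opp (fun n w => eta_est_swap nu1 nu2 H (Delta n) Y1 Y2 n w) _.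
have -> : - eta12 = 2^-1 * ((rho - eta12) - (rho + eta12)) by field.
rewrite /H (addrC H1) in Hlt1 *.
exact: (eta_est_cvg alpha2_gt0 alpha1_gt0 nu2_gt0 nu1_gt0 H2_01 H1_01
  (fbm_pair_swap H_gt0 hb)).
Qed.
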